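(* Let $\nu,\mu\in\mathbb{C}$, put $\nu_0:=\mathrm{Re}\,\nu$, $\mu_0:=\mathrm{Re}\,\mu$, and assume that they satisfy the inequalities $$n\nu_0+d\mu_0<\frac{n(n+1)}{2},\qquad n\nu_0-d\mu_0<\frac{n(n+1)}{2},$$ and $$\nu_0+\mu_0\le n-d,\qquad \mu_0\ge n .$$ If $\alpha=-(\nu+d)/2$ and $\beta=(\mu-n)/2$, then the integral $$\mathcal{Q}F(z)=\int_{S_{n,d}}F(y)K^{\alpha,\beta}(z,y)\,d\sigma(y)\qquad(z\in\mathrm{Sym}_n(\mathbb{R}))$$ converges and gives an $L$-intertwiner $\mathcal{Q}:\mathcal{H}^L_\mu\to\mathcal{H}^G_\nu$ (from $\pi^L_\mu$ to $\pi^G_\nu|_L$).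
   Context: Let $1\le d\le n-1$ and $L=\mathrm{GL}_n(\mathbb{R})$. Here $L$ is the Levi subgroup $\left\{\begin{pmatrix}a&0\\0&{}^ta^{-1}\end{pmatrix}\right\}$ of the Siegel parabolic $P_S$ of $G=\mathrm{Sp}_{2n}(\mathbb{R})$. $\mathrm{Sym}_n(\mathbb{R})$ is the space of real symmetric $n\times n$ matrices with Lebesgue measure $dz$; it embeds as an open dense subset of $G/P_S$. $\mathrm{M}^\circ_{n,d}(\mathbb{R})$ is the set of real $n\times d$ matrices of rank $d$, and $S_{n,d}=\{y\in\mathrm{M}^\circ_{n,d}(\mathbb{R})\mid{}^tyy=1_d\}$ is the Stiefel manifold with its nonzero $\mathrm{O}(n)$-invariant measure $d\sigma$. Kernel: $K^{\alpha,\beta}(z,y)=|\det z|^{\alpha}\,|\det({}^tyz^{-1}y)|^{\beta}=|\det z|^{\alpha-\beta}\left|\det\begin{pmatrix}z&y\\{}^ty&0\end{pmatrix}\right|^{\beta}$ (the last expression is used also for singular $z$). Degenerate principal series of $G$: $\pi^G_\nu=\mathrm{Ind}_{P_S}^G\chi_{P_S}$ (unnormalized induction), $\chi_{P_S}\begin{pmatrix}a&w\\0&{}^ta^{-1}\end{pmatrix}=|\det a|^\nu$, realized on the Hilbert space $\mathcal{H}^G_\nu$ of functions $f:\mathrm{Sym}_n(\mathbb{R})\to\mathbb{C}$ with $\int_{\mathrm{Sym}_n(\mathbb{R})}|f(z)|^2(\det(1+z^2))^{\nu_0-\frac{n+1}{2}}dz<\infty$. Its restriction to $L$ is $(\pi^G_\nu(a)f)(z)=|\det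 a|^{-\nu}f(a^{-1}z\,{}^ta^{-1})$ for $a\in\mathrm{GL}_n(\mathbb{R})$. Degenerate principal series of $L$: $\pi^L_\mu=\mathrm{Ind}_Q^L\chi_Q$ with $Q=\left\{\begin{pmatrix}k&*\\0&k'\end{pmatrix}\right\}$, $k\in\mathrm{GL}_d(\mathbb{R})$, $k'\in\mathrm{GL}_{n-d}(\mathbb{R})$, and $\chi_Q=|\det k|^\mu$. It is realized on the Hilbert space $\mathcal{H}^L_\mu$ which is the completion, for the norm $\|F\|^2=\int_{S_{n,d}}|F(v)|^2d\sigma(v)$, of the space of smooth $F:\mathrm{M}^\circ_{n,d}(\mathbb{R})\to\mathbb{C}$ with $F(yk)=|\det k|^{-\mu}F(y)$ for all $k\in\mathrm{GL}_d(\mathbb{R})$; the action is $(\pi^L_\mu(a)F)(y)=F(a^{-1}y)$. *)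

(* Defs.v *)
From HB Require Import structures.
From mathcomp Require Import all_boot all_order all_algebra.
From mathcomp Require Import all_classical all_reals all_analysis.
From mathcomp Require Import complex.

Set Implicit Arguments.
Unset Strict Implicit.
Unset Printing Implicit Defensive.

Import Order.TTheory GRing.Theory Num.Theory.
Import numFieldTopology.Exports numFieldNormedType.Exports.

Local Open Scope classical_set_scope.
Local Open Scope ring_scope.
Local Open Scope complex_scope.

Section ComplexValued.
Variable R : realType.

Definition cabs2 (w : R[i]) : R := complex.Re w ^+ 2 + complex.Im w ^+ 2.

(* x ^ s for x >= 0 and s complex. At x = 0 it is 0, except that 0 ^ 0 = 1;
   this agrees with the real power [powR] of the library. *)
Definition cpow (x : R) (s : R[i]) : R[i] :=
  if x == 0 then (s == 0)%:R
  else (x `^ complex.Re s * cos (complex.Im s * ln x))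
    +i* (x `^ complex.Re s * sin (complex.Im s * ln x)).

Definition cmeasurable d (T : measurableType d) (D : set T) (f : T -> R[i]) :=
  measurable_fun D (fun t => complex.Re (f t)) /\
  measurable_fun D (fun t => complex.Im (f t)).

Definition cintegrable d (T : measurableType d) (m : set T -> \bar R)
    (D : set T) (f : T -> R[i]) :=
  m.-integrable D (fun t => (complex.Re (f t))%:E) /\
  m.-integrable D (fun t => (complex.Im (f t))%:E).

Definition cintegral d (T : measurableType d) (m : set T -> \bar R)
    (D : set T) (f : T -> R[i]) : R[i] :=
  fine (\int[m]_(t in D) (complex.Re (f t))%:E)
  +i* fine (\int[m]_(t in D) (complex.Im (f t))%:E).

(* C^oo on an open set U: all iterated directional derivatives exist and are
   continuous at every point of U. Values outside U are irrelevant. *)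
Definition iter_derive (V : normedModType R) (f : V -> R) (vs : seq V) : V -> R :=
  foldr (fun v g => 'D_v g) f vs.

Definition smooth_on (V : normedModType R) (U : set V) (f : V -> R) :=
  forall (vs : seq V) (x : V), U x ->
    {for x, continuous (iter_derive f vs)} /\
    (forall v, derivable (iter_derive f vs) x v).

Definition csmooth_on (V : normedModType R) (U : set V) (f : V -> R[i]) :=
  smooth_on U (fun x => complex.Re (f x)) /\
  smooth_on U (fun x => complex.Im (f x)).

End ComplexValued.

Section Spaces.
Variable R : realType.

Definition borelMx (m n : nat) := g_sigma_algebraType (@open 'M[R]_(m, n)).
HB.instance Definition _ (m n : nat) := Measurable.on (borelMx m n).

(* M^o_{n,d}(R) *)
Definition fullRank (n d : nat) : set 'M[R]_(n, d) :=
  [set y | \rank y = d].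

Definition Stiefel (n d : nat) : set 'M[R]_(n, d) :=
  [set y | fullRank y /\ y^T *m y = 1%:M].

Definition Sym (n : nat) : set 'M[R]_n := [set z | z^T = z].

Fixpoint lebesgue_tuple (N : nat) : set (N.-tuple (measurableTypeR R)) -> \bar R :=
  match N with
  | 0 => \d_ [tuple]
  | N'.+1 => pushforward (@lebesgue_measure R \x @lebesgue_tuple N')%E
               (fun p => cons_tuple p.1 p.2)
  end.

(* Coordinates on Sym_n: the lower triangle read row by row, so that the entry
   (j, i) with i <= j sits at position 0 + 1 + ... + j + i = 'C(j.+1, 2) + i. *)
Definition sym_of_tuple (n : nat) (t : 'C(n.+1, 2).-tuple (measurableTypeR R)) :
    borelMx n n :=
  \matrix_(i < n, j < n) nth 0 (t : seq R) ('C((maxn i j).+1, 2) + minn i j).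

(* The measure dz, as a measure on n x n matrices carried by Sym_n. *)
Definition lebesgue_Sym (n : nat) : set (borelMx n n) -> \bar R :=
  pushforward (@lebesgue_tuple 'C(n.+1, 2)) (@sym_of_tuple n).

(* sigma is meant to be a finite Borel measure on n x d matrices: the conditions
   then say that it is carried by S_{n,d}, nonzero and O(n)-invariant, which
   determines it up to a positive scalar. *)
Definition Stiefel_measure (n d : nat) (sigma : set (borelMx n d) -> \bar R) :=
  [/\ sigma (~` @Stiefel n d) = 0%E,
      sigma [set: borelMx n d] != 0%E &
      forall (g : 'M[R]_n) (A : set (borelMx n d)),
        g^T *m g = 1%:M -> measurable A ->
        sigma [set g *m y | y in A] = sigma A].

End Spaces.

Section Representations.
Variables (R : realType) (n d : nat).
Variable sigma : set (borelMx R n d) -> \bar R.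

(* For invertible z this is |det z|^alpha |det(y^T z^-1 y)|^beta. *)
Definition kernelK (alpha beta : R[i]) (z : 'M[R]_n) (y : 'M[R]_(n, d)) : R[i] :=
  cpow `|\det z| (alpha - beta)
  * cpow `|\det (block_mx z y y^T (0 : 'M[R]_d))| beta.

Definition normG2 (nu : R[i]) (f : 'M[R]_n -> R[i]) : \bar R :=
  (\int[@lebesgue_Sym R n]_(z in (@Sym R n : set (borelMx R n n)))
     (cabs2 (f z) *
      (\det (1%:M + z *m z)) `^ (complex.Re nu - n.+1%:R / 2))%:E)%E.

(* Elements of H^G_nu are represented by square integrable functions, of which
   only the values on Sym_n matter; equality is [eqG]. *)
Definition HG (nu : R[i]) (f : 'M[R]_n -> R[i]) :=
  cmeasurable (@Sym R n : set (borelMx R n n)) f /\ (normG2 nu f < +oo)%E.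

Definition eqG (f g : 'M[R]_n -> R[i]) :=
  {ae @lebesgue_Sym R n, forall z, Sym z -> f z = g z}.

Definition piG (nu : R[i]) (a : 'M[R]_n) (f : 'M[R]_n -> R[i]) :
    'M[R]_n -> R[i] :=
  fun z => cpow `|\det a| (- nu) * f (invmx a *m z *m invmx a^T).

Definition normL2 (F : 'M[R]_(n, d) -> R[i]) : \bar R :=
  (\int[sigma]_(y in (@Stiefel R n d : set (borelMx R n d))) (cabs2 (F y))%:E)%E.

Definition homogeneousL (mu : R[i]) (F : 'M[R]_(n, d) -> R[i]) :=
  forall (y : 'M[R]_(n, d)) (k : 'M[R]_d), fullRank y -> k \in unitmx ->
    F (y *m k) = cpow `|\det k| (- mu) * F y.

(* The completion H^L_mu is realized inside L^2(S_{n,d}): its elements are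
   represented by measurable homogeneous functions on M^o_{n,d} that are square
   integrable on S_{n,d} and limits, in this norm, of smooth ones. *)
Definition HL (mu : R[i]) (F : 'M[R]_(n, d) -> R[i]) :=
  [/\ homogeneousL mu F,
      cmeasurable (@fullRank R n d : set (borelMx R n d)) F,
      (normL2 F < +oo)%E &
      exists Fs : nat -> 'M[R]_(n, d) -> R[i],
        (forall k, homogeneousL mu (Fs k) /\ csmooth_on (@fullRank R n d) (Fs k)) /\
        (normL2 (fun y => Fs k y - F y)) @[k --> \oo] --> 0%E].

Definition piL (a : 'M[R]_n) (F : 'M[R]_(n, d) -> R[i]) : 'M[R]_(n, d) -> R[i] :=
  fun y => F (invmx a *m y).

Definition opQ (alpha beta : R[i]) (F : 'M[R]_(n, d) -> R[i]) :
    'M[R]_n -> R[i] :=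
  fun z => cintegral sigma (@Stiefel R n d : set (borelMx R n d))
             (fun y => F y * kernelK alpha beta z y).

(* T induces a bounded linear map from H^L_mu to H^G_nu that intertwines pi^L_mu
   with the restriction of pi^G_nu to GL_n(R). Compatibility with equality of
   classes follows from linearity and boundedness. *)
Definition L_intertwiner (nu mu : R[i])
    (T : ('M[R]_(n, d) -> R[i]) -> ('M[R]_n -> R[i])) :=
  [/\ forall F, HL mu F -> HG nu (T F),
      forall (c : R[i]) F1 F2, HL mu F1 -> HL mu F2 ->
        eqG (T (fun y => c * F1 y + F2 y)) (fun z => c * T F1 z + T F2 z),
      exists C : R, forall F, HL mu F -> (normG2 nu (T F) <= C%:E * normL2 F)%E &
      forall a : 'M[R]_n, a \in unitmx -> forall F, HL mu F ->
        eqG (T (piL a F)) (piG nu a (T F))].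

End Representations.

(* Main.v *)
From HB Require Import structures.
From mathcomp Require Import all_boot all_order all_algebra.
From mathcomp Require Import all_classical all_reals all_analysis.
From mathcomp Require Import perm measurable_realfun complex ring lra.
Require Import Defs.

(** Write K for the kernel, S for the Stiefel manifold and |F| for the norm of
    H^L_mu. The theorem rests on a pointwise bound of K, on one integrability
    statement over symmetric matrices, and on the transformation law of sigma
    under GL_n.

    Pointwise bound. If z is symmetric and y is in S, then the squares of det z
    and of the determinant of the bordered matrix (z, y; y^T, 0) are at most
    det(1 + z^2) ([det_sqr_le_1Dsqr], [det_block_sqr_le]): after normalisation
    by the square root of a positive definite matrix, both are determinants of
    contractions ([det_contraction]). The inequalities on the parameters say that
    alpha - beta and beta have nonnegative real part, so that
    |K(z, y)|^2 <= det(1 + z^2)^(Re alpha) ([cabs2_kernelK_le]). As sigma is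
    finite, F K(z, .) is square integrable on S, hence integrable, and the
    Cauchy-Schwarz inequality gives
    |QF(z)|^2 <= C det(1 + z^2)^(Re alpha) |F|^2 ([cabs2_opQ_le]).

    Integrability. The norm of QF is therefore bounded by that of F as soon as
    det(1 + z^2)^(-e) is integrable over Sym_n for e = (n + 1)/2 - Re alpha - Re nu.
    The hypotheses give nu0 <= -d, hence 2 e >= n + 2. Integrability
    ([detpow_integral_lty]) is proved by induction on n: if z is w bordered by a
    row x and a corner t, then
    det(1 + z^2) = det(1 + w^2) ((1 + q(x))^2 + (t - r(x))^2) with
    q(x) = x (1 + w^2)^-1 x^T ([det_1Dsqr_bordered]), and the integral over t and x
    costs only a factor det(1 + w^2)^(1/2).

    Equivariance. One has K(z, a y) = |det a|^(2 alpha) K(a^-1 z a^-T, y), and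
    y |-> F(y) K(z, a y) is homogeneous of degree -n under the right action of
    GL_d. So the intertwining property reduces to the identity
      int_S h(a^-1 y) dsigma(y) = |det a|^d int_S h dsigma
    for h of degree -n ([Stiefel_transform]). Since sigma is only known to be
    O(n)-invariant, it is compared with Lebesgue measure on n x d matrices:
    transitivity of O(n) on S and Fubini show that the invariant integral on S is
    unique up to a scalar ([orbit_unique]), hence int_S h dsigma is a multiple of
    the Lebesgue integral of h over an O(n)-invariant shell around S
    ([integral_shell]). For h of degree -n this shell may be replaced by its image
    under a, as one sees by averaging over GL_d acting on the right
    ([homogeneous_shell]), and the linear substitution y -> a y in Lebesgue
    measure produces the factor |det a|^d. *)

Set Implicit Arguments.
Unset Strict Implicit.
Unset Printing Implicit Defensive.

Import Order.TTheory GRing.Theory Num.Theory.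
Import numFieldTopology.Exports numFieldNormedType.Exports.

Local Open Scope classical_set_scope.
Local Open Scope ring_scope.

(** * Sigma-finite measures and the Borel structure of matrices *)

(** A pushforward of a sigma-finite measure need not be sigma-finite; a
    measurable left inverse [g] of [f] carries an exhaustion of the source to one
    of the target. Stated as an existence, so that the measure comes bundled with
    its sigma-finiteness. *)
Lemma pushforward_sigma_finite d d' (T : measurableType d)
    (T' : measurableType d') (R : realType)
    (m : {sigma_finite_measure set T -> \bar R}) (f : T -> T') (g : T' -> T) :
  measurable_fun setT f -> measurable_fun setT g -> cancel f g ->
  exists m' : {sigma_finite_measure set T' -> \bar R},
    (m' : set T' -> \bar R) = pushforward m f.
Proof.
move=> mf mg fK.
pose p : {measure set T' -> \bar R} :=
  measure_function_pushforward__canonical__measure_function_Measure m mf.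
have sf : sigma_finite setT p.
  have [F TF Foo] := sigma_finiteT m.
  exists (fun k => g @^-1` F k).
    by rewrite -preimage_bigcup -TF preimage_setT.
  move=> k; have [mFk Fk] := Foo k; split.
    by rewrite -[_ @^-1` _]setTI; exact: mg.
  rewrite /p/= /pushforward/= -comp_preimage.
  by rewrite (_ : g \o f = id) // funeqE => x /=; rewrite fK.
pose sfb := Measure_isSigmaFinite.Build _ _ _ (p : set T' -> \bar R) sf.
pose m' : {sigma_finite_measure set T' -> \bar R} := HB.pack (p : set T' -> \bar R) p sfb.
by exists m'.
Qed.

(** With increasing exhaustions, the squares [F k `*` G k] already cover. *)
Lemma product_sigma_finite d1 d2 (T1 : measurableType d1)
    (T2 : measurableType d2) (R : realType)
    (m1 : {sigma_finite_measure set T1 -> \bar R})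
    (m2 : {sigma_finite_measure set T2 -> \bar R}) :
  exists m : {sigma_finite_measure set (T1 * T2)%type -> \bar R},
    (m : set _ -> \bar R) = (m1 \x m2)%E.
Proof.
pose p : {measure set (T1 * T2)%type -> \bar R} := (m1 \x m2)%E.
have sf : sigma_finite setT p.
  have /sigma_finiteP[F [TF ndF Foo]] := sigma_finiteT m1.
  have /sigma_finiteP[G [TG ndG Goo]] := sigma_finiteT m2.
  exists (fun k => F k `*` G k).
    apply/seteqP; split=> [[x y] _|//].
    have [i _ Fx] : (\bigcup_k F k) x by rewrite -TF.
    have [j _ Gy] : (\bigcup_k G k) y by rewrite -TG.
    exists (maxn i j) => //; split=> /=.
      by move: Fx; exact/subsetPset/ndF/leq_maxl.
    by move: Gy; exact/subsetPset/ndG/leq_maxr.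
  move=> k; have [mF Fk] := Foo k; have [mG Gk] := Goo k.
  split; first exact: measurableX.
  by rewrite /p/= product_measure1E // lte_mul_pinfty // ge0_fin_numE.
pose sfb := Measure_isSigmaFinite.Build _ _ _ (p : set _ -> \bar R) sf.
pose m : {sigma_finite_measure set (T1 * T2)%type -> \bar R} :=
  HB.pack (p : set _ -> \bar R) p sfb.
by exists m.
Qed.

Section Borel.
Variable R : realType.

Lemma measurable_entry m n (i : 'I_m) (j : 'I_n) :
  measurable_fun setT (fun y : borelMx R m n => y i j).
Proof.
apply: (measurability _ (RGenOpens.measurableE R)).
move=> _ [_ [a [b ->]] <-]; rewrite setTI; apply: sub_sigma_algebra.
have /continuousP := @coord_continuous R m n i j; apply.
exact: interval_open.
Qed.

(** An open set of matrices is the countable union of the boxes with rational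
    centre and radius [1 / k.+1] that it contains, so the Borel sigma-algebra is
    generated by the entries. *)
Lemma measurable_mx d (T : measurableType d) m n (f : T -> borelMx R m n) :
  (forall i j, measurable_fun setT (fun t => f t i j)) -> measurable_fun setT f.
Proof.
move=> mf; apply: (@measurability _ _ T (borelMx R m n) setT f (@open 'M[R]_(m, n))) => // _ [U oU <-].
pose box (p : 'M[rat]_(m, n) * nat) : set 'M[R]_(m, n) :=
  [set y | forall i j, `|ratr (p.1 i j) - y i j| < p.2.+1%:R^-1].
have -> : U = \bigcup_p (if `[< box p `<=` U >] then box p else set0).
  apply/seteqP; split=> [y Uy|y [p _]]; last by case: asboolP => // + /[dup] _; apply.
  have /nbhs_ballP[e /= e0 eU] : nbhs y U by apply: open_nbhs_nbhs.
  have [k ke] : exists k, k.+1%:R^-1 < e / 2.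
    have /ltr_add_invr[k] : 0 < e / 2 by rewrite divr_gt0.
    by rewrite add0r => ?; exists k.
  have k0 : 0 < k.+1%:R^-1 :> R by rewrite invr_gt0.
  have hq i j : exists q : rat, `|ratr q - y i j| < k.+1%:R^-1.
    have /rat_in_itvoo[q] : y i j - k.+1%:R^-1 < y i j + k.+1%:R^-1.
      by rewrite ltrD2l gtrN.
    by rewrite in_itv/= => /andP[q1 q2]; exists q; rewrite ltr_distl q1 q2.
  exists (\matrix_(i, j) projT1 (cid (hq i j)), k) => //.
  have -> : `[< box (\matrix_(i, j) projT1 (cid (hq i j)), k) `<=` U >] = true.
    apply/asboolP => z bz; apply: eU; split=> // i j; rewrite -ball_normE /ball_/=.
    have := bz i j; rewrite /= !mxE; case: cid => q /= hq1 hq2.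
    have -> : y i j - z i j = - (ratr q - y i j) + (ratr q - z i j) by ring.
    apply: le_lt_trans (ler_normD _ _) _; rewrite normrN.
    apply: lt_trans (ltrD hq1 hq2) _.
    by rewrite [ltRHS]splitr; exact: (ltrD ke ke).
  by move=> i j /=; rewrite mxE; case: cid.
rewrite setTI preimage_bigcup; apply: countable_bigcupT_measurable => // p.
case: asboolP => _; last by rewrite preimage_set0.
rewrite (_ : _ @^-1` _ = \bigcap_(ij in [set: 'I_m * 'I_n])
   ((fun t => f t ij.1 ij.2) @^-1` [set x | `|ratr (p.1 ij.1 ij.2) - x| < p.2.+1%:R^-1])); last first.
  apply/seteqP; split=> t /=; first by move=> h [i j] _ /=; exact: h.
  by move=> h i j; exact: (h (i, j)).
apply: fin_bigcap_measurable => // -[i j] _ /=.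
rewrite -[_ @^-1` _]setTI; apply: mf => //.
rewrite (_ : [set x | _] =
  `](ratr (p.1 i j) - p.2.+1%:R^-1), (ratr (p.1 i j) + p.2.+1%:R^-1)[%classic).
  exact: measurable_itv.
by apply/seteqP; split=> x /=; rewrite in_itv/= ltr_distlC.
Qed.

End Borel.

Section OneDim.
Variable R : realType.
Local Notation mu := (@lebesgue_measure R).
Local Open Scope ereal_scope.

(** For [c > 0], the image of Lebesgue measure under [x |-> c * x + b], rescaled
    by [c], agrees with Lebesgue measure on intervals, hence everywhere; a negative
    [c] is reduced to this case by reflection. *)
Lemma ge0_integral_affine (c b : R) (f : R -> \bar R) : c != 0%R ->
  measurable_fun [set: R] f -> (forall x, 0 <= f x) ->
  \int[mu]_x f (c * x + b)%R = (`|c|^-1)%:E * \int[mu]_x f x.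
Proof.
move=> c0 mf f0.
have maff (k l : R) : measurable_fun [set: R] (fun x : R => k * x + l)%R.
  by apply: measurable_funD => //; exact: mulrl_measurable.
wlog cp : c f c0 mf f0 / (0 < c)%R => [hw|].
  have [|cn] := ltP 0%R c; first exact: hw.
  have {}cn : (0 < - c)%R by rewrite oppr_gt0 lt_neqAle c0.
  have := hw (- c)%R f; rewrite oppr_eq0 normrN => <- //.
  have mN : measurable_fun setT (-%R : measurableTypeR R -> measurableTypeR R).
    by [].
  transitivity (\int[pushforward mu (-%R : measurableTypeR R -> measurableTypeR R)]_x f (- c * x + b)%R).
    rewrite ge0_integral_pushforward //=.
      by rewrite preimage_setT; apply: eq_integral => x _; rewrite /= mulrNN.
    exact: measurableT_comp (maff _ _).
  by apply: eq_measure_integral => A mA _; exact: lebesgue_measureN.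
have mphi : measurable_fun setT (fun x : measurableTypeR R => (c * x + b)%R : measurableTypeR R).
  exact: maff.
have knn : (0 <= `|c|^-1)%R by rewrite invr_ge0.
rewrite -(ge0_integral_mscale mu measurableT (NngNum knn)) //.
transitivity (\int[pushforward mu (fun x : measurableTypeR R => (c * x + b)%R : measurableTypeR R)]_x f x).
  by rewrite ge0_integral_pushforward // preimage_setT.
have H : forall A, measurable A -> mu A =
   mscale (NngNum (ltW cp)) (measure_function_pushforward__canonical__measure_function_Measure mu mphi) A.
  apply: lebesgue_measure_unique => _ [[x y] _ <-] /=.
  rewrite /mscale/= /pushforward.
  have -> : (fun x0 : R => c * x0 + b)%R @^-1` `]x, y] = `]((x - b) / c)%R, ((y - b) / c)%R]%classic.
    apply/seteqP; split=> t /=; rewrite !in_itv/= ltr_pdivrMr // ler_pdivlMr //.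
      by move=> /andP[? ?]; apply/andP; split; lra.
    by move=> /andP[? ?]; apply/andP; split; lra.
  rewrite !lebesgue_measure_itv/= !lte_fin ltr_pM2r ?invr_gt0 // ltrD2r.
  case: ifP => _; last by rewrite mule0.
  by rewrite -!EFinB -EFinM -mulrBl mulrC divfK //; congr (_%:E); ring.
apply: eq_measure_integral => A mA _ /=; rewrite /mscale/= (H _ mA) /mscale/=.
by rewrite muleA -EFinM gtr0_norm // mulVf // mul1e.
Qed.

Lemma integral_oneDsqrV_lty : \int[mu]_x ((1 + x ^+ 2)^-1)%:E < +oo.
Proof.
have /= := @ge0_symfun_integralT R (fun x => (oneDsqr x)^-1)%R _ _ _.
rewrite /oneDsqr => ->.
- rewrite -set_itvcy (integral0y_oneDsqr R) -EFinM; exact: ltry.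
- by move=> x; rewrite invr_ge0 addr_ge0 ?sqr_ge0.
- exact: continuous_oneDsqrV.
- by move=> x /=; rewrite /oneDsqr sqrrN.
Qed.

End OneDim.

(** * Measurability of matrix operations *)

(** The convention [0^-1 = 0] makes inversion Borel on the whole line. *)
Lemma measurable_invr (R : realType) : measurable_fun [set: R] (fun x : R => x^-1).
Proof.
rewrite (_ : (fun x => _) = fun x : R => x * (x ^+ 2) `^ (-1)).
  apply: measurable_funM => //.
  exact: (measurableT_comp (measurable_powR (-1)) (@exprn_measurable R setT 2)).
apply/funext => x; have [->|x0] := eqVneq x 0; first by rewrite invr0 mul0r.
by rewrite powR_inv1 ?sqr_ge0 // expr2 invfM mulrA divff // mul1r.
Qed.

Section MeasurableMatrix.
Variables (R : realType) (d0 : measure_display) (T : measurableType d0).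

Lemma measurable_coord m n (f : T -> borelMx R m n) i j :
  measurable_fun setT f -> measurable_fun setT (fun t => f t i j).
Proof.
by move=> mf; apply: (measurableT_comp (measurable_entry i j) mf).
Qed.

Lemma measurable_mulmx m n p (f : T -> borelMx R m n) (g : T -> borelMx R n p) :
  measurable_fun setT f -> measurable_fun setT g ->
  measurable_fun setT (fun t => f t *m g t : borelMx R m p).
Proof.
move=> mf mg; apply: measurable_mx => i j.
under eq_fun do rewrite mxE.
apply: measurable_sum => k; apply: measurable_funM; exact: measurable_coord.
Qed.

Lemma measurable_addmx m n (f g : T -> borelMx R m n) :
  measurable_fun setT f -> measurable_fun setT g ->
  measurable_fun setT (fun t => f t + g t : borelMx R m n).
Proof.
move=> mf mg; apply: measurable_mx => i j; under eq_fun do rewrite mxE.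
by apply: measurable_funD; exact: measurable_coord.
Qed.

Lemma measurable_trmx m n (f : T -> borelMx R m n) :
  measurable_fun setT f -> measurable_fun setT (fun t => (f t)^T : borelMx R n m).
Proof.
move=> mf; apply: measurable_mx => i j; under eq_fun do rewrite mxE.
exact: measurable_coord.
Qed.

Lemma measurable_scalemx m n (c : T -> R) (f : T -> borelMx R m n) :
  measurable_fun setT c -> measurable_fun setT f ->
  measurable_fun setT (fun t => c t *: f t : borelMx R m n).
Proof.
move=> mc mf; apply: measurable_mx => i j; under eq_fun do rewrite mxE.
by apply: measurable_funM => //; exact: measurable_coord.
Qed.

Lemma measurable_det n (f : T -> borelMx R n n) :
  measurable_fun setT f -> measurable_fun setT (fun t => \det (f t)).
Proof.
move=> mf; rewrite /determinant.
apply: measurable_sum => s; apply: measurable_funM => //.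
apply: measurable_prod => i _; exact: measurable_coord.
Qed.

(** The cofactor formula is Borel on all matrices and agrees with the inverse on
    the invertible ones. *)
Lemma measurable_ginv n (f : T -> borelMx R n n) :
  measurable_fun setT f ->
  measurable_fun setT (fun t => (\det (f t))^-1 *: \adj (f t) : borelMx R n n).
Proof.
move=> mf; apply: measurable_scalemx.
  apply: measurableT_comp; first exact: measurable_invr.
  exact: measurable_det.
apply: measurable_mx => i j; under eq_fun do rewrite mxE /cofactor.
apply: measurable_funM => //; apply: measurable_det.
apply: measurable_mx => k l; under eq_fun do rewrite !mxE.
exact: measurable_coord.
Qed.

Lemma measurable_col_mx m n p (f : T -> borelMx R m p) (g : T -> borelMx R n p) :
  measurable_fun setT f -> measurable_fun setT g ->
  measurable_fun setT (fun t => col_mx (f t) (g t) : borelMx R (m + n) p).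
Proof.
move=> mf mg; apply: measurable_mx => i j; case: (split_ordP i) => k ->.
  by under eq_fun do rewrite col_mxEu; exact: measurable_coord.
by under eq_fun do rewrite col_mxEd; exact: measurable_coord.
Qed.

Lemma measurable_row_mx m n p (f : T -> borelMx R p m) (g : T -> borelMx R p n) :
  measurable_fun setT f -> measurable_fun setT g ->
  measurable_fun setT (fun t => row_mx (f t) (g t) : borelMx R p (m + n)).
Proof.
move=> mf mg; apply: measurable_mx => i j; case: (split_ordP j) => k ->.
  by under eq_fun do rewrite row_mxEl; exact: measurable_coord.
by under eq_fun do rewrite row_mxEr; exact: measurable_coord.
Qed.

End MeasurableMatrix.

Section Substitution.
Variable R : realType.
Notation bmx m n := (borelMx R m n).

Lemma measurable_lmul m n p (a : 'M[R]_(m, n)) :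
  measurable_fun setT (fun y : bmx n p => a *m (y : 'M[R]_(n, p)) : bmx m p).
Proof. by apply: measurable_mulmx => //; exact: measurable_cst. Qed.

Lemma measurable_rmul m n p (a : 'M[R]_(n, p)) :
  measurable_fun setT (fun y : bmx m n => (y : 'M[R]_(m, n)) *m a : bmx m p).
Proof. by apply: measurable_mulmx => //; exact: measurable_cst. Qed.

Lemma measurable_shift m n (a : 'M[R]_(m, n)) :
  measurable_fun setT (fun y : bmx m n => (y : 'M[R]_(m, n)) + a : bmx m n).
Proof. by apply: measurable_addmx => //; exact: measurable_cst. Qed.

Lemma measurable_scale m n (c : R) :
  measurable_fun setT (fun y : bmx m n => c *: (y : 'M[R]_(m, n)) : bmx m n).
Proof. by apply: measurable_scalemx => //; exact: measurable_cst. Qed.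

Lemma measurable_cmx d0 (T : measurableType d0) n p (f : T -> bmx 1 p) (g : T -> bmx n p) :
  measurable_fun setT f -> measurable_fun setT g ->
  measurable_fun setT (fun t => col_mx (f t) (g t) : bmx n.+1 p).
Proof. exact: (@measurable_col_mx R _ _ 1 n p). Qed.

End Substitution.

(** * Powers of a measure on rows *)

Section Power.
Variables (R : realType) (d : nat).
Local Open Scope ereal_scope.

Notation bmx m n := (borelMx R m n).

(** The product measure transported by stacking a row on a matrix. The
    characterisation by iterated integrals is Tonelli's theorem. *)
Lemma colmx_measure n (mu : {sigma_finite_measure set (bmx 1 d) -> \bar R})
    (m : {sigma_finite_measure set (bmx n d) -> \bar R}) :
  exists m' : {sigma_finite_measure set (bmx n.+1 d) -> \bar R},
    forall f : bmx n.+1 d -> \bar R, measurable_fun setT f -> (forall y, 0 <= f y) ->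
    \int[m']_y f y = \int[mu]_r \int[m]_y f (col_mx (r : 'M[R]_(1, d)) (y : 'M[R]_(n, d))).
Proof.
pose phi (p : bmx 1 d * bmx n d) : bmx (1 + n) d := col_mx (p.1 : 'M[R]_(1, d)) p.2.
pose psi (y : bmx (1 + n) d) : bmx 1 d * bmx n d := (usubmx y, dsubmx y).
have mphi : measurable_fun setT phi by exact: measurable_col_mx.
have mpsi : measurable_fun setT psi.
  apply: measurable_fun_pair; apply: measurable_mx => i j;
    under eq_fun do rewrite mxE; exact: measurable_coord.
have phiK : cancel phi psi by case=> r y; rewrite /phi /psi col_mxKu col_mxKd.
have [pm pmE] := product_sigma_finite mu m.
have [m' m'E] := @pushforward_sigma_finite _ _ _ (bmx (1 + n) d) _ pm phi psi mphi mpsi phiK.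
exists m' => f mf f0; rewrite m'E pmE ge0_integral_pushforward // preimage_setT.
rewrite fubini_tonelli1 //.
  exact: (@measurableT_comp _ _ _ _ _ _ f _ phi).
by move=> p; exact: f0.
Qed.

Definition rows_measure_step n mu (m : {sigma_finite_measure set (bmx n d) -> \bar R}) :=
  projT1 (cid (colmx_measure mu m)).

Fixpoint rows_measure mu n : {sigma_finite_measure set (bmx n d) -> \bar R} :=
  match n with
  | 0 => \d_ (0%R : bmx 0 d)
  | n'.+1 => rows_measure_step mu (rows_measure mu n')
  end.

Variable mu : {sigma_finite_measure set (bmx 1 d) -> \bar R}.

Lemma integral_rows_measureS n (f : bmx n.+1 d -> \bar R) :
  measurable_fun setT f -> (forall y, 0 <= f y) ->
  \int[rows_measure mu n.+1]_y f y =
  \int[mu]_r \int[rows_measure mu n]_y f (col_mx (r : 'M[R]_(1, d)) (y : 'M[R]_(n, d))).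
Proof. by move=> mf f0; rewrite /= /rows_measure_step; case: cid => m' /= ->. Qed.

Lemma integral_rows_measure0 (f : bmx 0 d -> \bar R) :
  measurable_fun setT f ->
  \int[rows_measure mu 0]_y f y = f 0%R.
Proof. by move=> mf; rewrite /= integral_dirac //= diracT mul1e. Qed.

Lemma integral_rows_measureS_swap n (f : bmx n.+1 d -> \bar R) :
  measurable_fun setT f -> (forall y, 0 <= f y) ->
  \int[rows_measure mu n.+1]_y f y =
  \int[rows_measure mu n]_y \int[mu]_r f (col_mx (r : 'M[R]_(1, d)) (y : 'M[R]_(n, d))).
Proof.
move=> mf f0; rewrite integral_rows_measureS //.
have mg : measurable_fun setT (fun p : bmx 1 d * bmx n d => f (col_mx (p.1 : 'M[R]_(1, d)) p.2)).
  exact: (measurableT_comp mf (measurable_cmx measurable_fst measurable_snd)).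
exact: (fubini_tonelli _ mg (fun p => f0 _)).
Qed.

End Power.

Section Invariance.
Variables (R : realType) (d : nat).
Local Open Scope ereal_scope.
Notation bmx m n := (borelMx R m n).
Variable mu : {sigma_finite_measure set (bmx 1 d) -> \bar R}.

Lemma measurable_integral_col_mx n (f : bmx n.+1 d -> \bar R) :
  measurable_fun setT f -> (forall y, 0 <= f y) ->
  measurable_fun setT (fun y : bmx n d =>
    \int[mu]_r f (col_mx (r : 'M[R]_(1, d)) (y : 'M[R]_(n, d)))).
Proof.
move=> mf f0.
have mg : measurable_fun setT
    (fun p : bmx 1 d * bmx n d => f (col_mx (p.1 : 'M[R]_(1, d)) p.2)).
  exact: (measurableT_comp mf (measurable_cmx measurable_fst measurable_snd)).
exact: (measurable_fun_fubini_tonelli_G _ mg (fun p => f0 _)).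
Qed.

Lemma measurable_col_mxl n (f : bmx n.+1 d -> \bar R) (y : 'M[R]_(n, d)) :
  measurable_fun setT f ->
  measurable_fun setT (fun r : bmx 1 d => f (col_mx (r : 'M[R]_(1, d)) y)).
Proof.
move=> mf; apply: (measurableT_comp mf).
by apply: measurable_cmx => //; exact: measurable_cst.
Qed.

Lemma measurable_col_mxr n (f : bmx n.+1 d -> \bar R) (r : 'M[R]_(1, d)) :
  measurable_fun setT f ->
  measurable_fun setT (fun y : bmx n d => f (col_mx r (y : 'M[R]_(n, d)))).
Proof.
move=> mf; apply: (measurableT_comp mf).
by apply: measurable_cmx => //; exact: measurable_cst.
Qed.

(** Right multiplication acts on each row separately, so its Jacobian is a power
    of the Jacobian on one row. *)
Lemma rows_measure_rmul n (k : 'M[R]_d) :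
  (forall f : bmx 1 d -> \bar R, measurable_fun setT f -> (forall y, 0 <= f y) ->
     \int[mu]_r f ((r : 'M[R]_(1, d)) *m k) = (`|\det k|^-1)%:E * \int[mu]_r f r) ->
  forall f : bmx n d -> \bar R, measurable_fun setT f -> (forall y, 0 <= f y) ->
    \int[rows_measure mu n]_y f ((y : 'M[R]_(n, d)) *m k) =
    (`|\det k|^-1 ^+ n)%:E * \int[rows_measure mu n]_y f y.
Proof.
move=> muk; elim: n => [|n IH] f mf f0.
  rewrite !integral_rows_measure0 ?mul0mx ?expr0 ?mul1e //.
  exact: (measurableT_comp mf (measurable_rmul k)).
have mfk : measurable_fun setT (fun y : bmx n.+1 d => f ((y : 'M[R]_(n.+1, d)) *m k)).
  exact: (measurableT_comp mf (measurable_rmul k)).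
rewrite !integral_rows_measureS_swap //.
pose G (y : bmx n d) := \int[mu]_r f (col_mx (r : 'M[R]_(1, d)) (y : 'M[R]_(n, d))).
have mG : measurable_fun setT G by exact: measurable_integral_col_mx.
have G0 y : 0 <= G y by exact: integral_ge0.
transitivity (\int[rows_measure mu n]_y ((`|\det k|^-1)%:E * G ((y : 'M[R]_(n, d)) *m k))).
  apply: eq_integral => y _; rewrite -muk //.
    by apply: eq_integral => r _; congr f; exact: (mul_col_mx (r : 'M[R]_(1, d))).
  exact: measurable_col_mxl.
rewrite ge0_integralZl //; last first.
  exact: (measurableT_comp mG (measurable_rmul k)).
by rewrite IH // muleA -EFinM -exprS.
Qed.

Hypothesis mu_shift : forall (a : 'M[R]_(1, d)) (f : bmx 1 d -> \bar R),
  measurable_fun setT f -> (forall y, 0 <= f y) ->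
  \int[mu]_r f ((r : 'M[R]_(1, d)) + a)%R = \int[mu]_r f r.

Lemma rows_measure_shift n (a : 'M[R]_(n, d)) (f : bmx n d -> \bar R) :
  measurable_fun setT f -> (forall y, 0 <= f y) ->
  \int[rows_measure mu n]_y f ((y : 'M[R]_(n, d)) + a)%R = \int[rows_measure mu n]_y f y.
Proof.
elim: n => [|n IH] in a f * => mf f0.
  rewrite !integral_rows_measure0 //; first by congr f; rewrite [LHS]flatmx0.
  exact: (measurableT_comp mf (measurable_shift a)).
have mfk : measurable_fun setT (fun y : bmx n.+1 d => f ((y : 'M[R]_(n.+1, d)) + a)%R).
  exact: (measurableT_comp mf (measurable_shift a)).
rewrite !integral_rows_measureS_swap //.
pose G (y : bmx n d) := \int[mu]_r f (col_mx (r : 'M[R]_(1, d)) (y : 'M[R]_(n, d))).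
have mG : measurable_fun setT G by exact: measurable_integral_col_mx.
have G0 y : 0 <= G y by exact: integral_ge0.
rewrite -[RHS](IH (dsubmx (a : 'M[R]_(1 + n, d))) G) //.
apply: eq_integral => y _; rewrite /G.
rewrite -[RHS](mu_shift (usubmx (a : 'M[R]_(1 + n, d)))) //; last exact: measurable_col_mxl.
apply: eq_integral => r _; congr f.
by rewrite -[in LHS](vsubmxK (a : 'M[R]_(1 + n, d))); exact: (add_col_mx (r : 'M[R]_(1, d)) (y : 'M[R]_(n, d))).
Qed.

Hypothesis mu_scale : forall (c : R) (f : bmx 1 d -> \bar R), c != 0%R ->
  measurable_fun setT f -> (forall y, 0 <= f y) ->
  \int[mu]_r f (c *: (r : 'M[R]_(1, d)))%R = (`|c|^-1 ^+ d)%:E * \int[mu]_r f r.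

Let lmul_inv n (a : 'M[R]_n) := forall f : bmx n d -> \bar R,
  measurable_fun setT f -> (forall y, 0 <= f y) ->
  \int[rows_measure mu n]_y f (a *m (y : 'M[R]_(n, d))) =
  (`|\det a|^-1 ^+ d)%:E * \int[rows_measure mu n]_y f y.

Let lmul_invM n (a b : 'M[R]_n) : lmul_inv a -> lmul_inv b -> lmul_inv (a *m b).
Proof.
move=> ia ib f mf f0.
under eq_integral do rewrite -mulmxA.
rewrite (ib (fun y => f (a *m (y : 'M[R]_(n, d))))) //; last first.
  exact: (measurableT_comp mf (measurable_lmul a)).
by rewrite ia // muleA -EFinM det_mulmx normrM invfM exprMn mulrC.
Qed.

Let lmul_inv_lower n (c : 'M[R]_(n, 1)) :
  @lmul_inv n.+1 (block_mx 1%:M 0 c 1%:M : 'M[R]_(1 + n)).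
Proof.
move=> f mf f0.
rewrite (det_lblock (1%:M : 'M[R]_1)) !det1 mulr1 normr1 invr1 expr1n mul1e.
rewrite !integral_rows_measureS //; last exact: (measurableT_comp mf (measurable_lmul _)).
apply: eq_integral => r _.
rewrite -[RHS](rows_measure_shift (c *m (r : 'M[R]_(1, d)))) //; last exact: measurable_col_mxr.
apply: eq_integral => y _; congr f.
by rewrite [LHS](mul_block_col (1%:M : 'M[R]_1) 0%R c 1%:M (r : 'M[R]_(1, d)) (y : 'M[R]_(n, d))) !mul1mx mul0mx addr0 addrC.
Qed.

Let lmul_inv_upper n (b : 'M[R]_(1, n)) :
  @lmul_inv n.+1 (block_mx 1%:M b 0 1%:M : 'M[R]_(1 + n)).
Proof.
move=> f mf f0.
rewrite (det_ublock (1%:M : 'M[R]_1)) !det1 mulr1 normr1 invr1 expr1n mul1e.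
rewrite !integral_rows_measureS_swap //; last exact: (measurableT_comp mf (measurable_lmul _)).
apply: eq_integral => y _.
rewrite -[RHS](mu_shift (b *m (y : 'M[R]_(n, d)))) //; last exact: measurable_col_mxl.
apply: eq_integral => r _; congr f.
by rewrite [LHS](mul_block_col (1%:M : 'M[R]_1) b 0%R 1%:M (r : 'M[R]_(1, d)) (y : 'M[R]_(n, d))) !mul1mx mul0mx add0r.
Qed.

Let lmul_inv_diag n (c : R) (a : 'M[R]_n) : c != 0%R -> lmul_inv a ->
  @lmul_inv n.+1 (block_mx c%:M 0 0 a : 'M[R]_(1 + n)).
Proof.
move=> c0 ia f mf f0.
rewrite (det_ublock (c%:M : 'M[R]_1)) det_scalar1.
rewrite !integral_rows_measureS_swap //; last exact: (measurableT_comp mf (measurable_lmul _)).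
pose G (y : bmx n d) := \int[mu]_r f (col_mx (r : 'M[R]_(1, d)) (y : 'M[R]_(n, d))).
have mG : measurable_fun setT G by exact: measurable_integral_col_mx.
have G0 y : 0 <= G y by exact: integral_ge0.
transitivity (\int[rows_measure mu n]_y ((`|c|^-1 ^+ d)%:E * G (a *m (y : 'M[R]_(n, d))))).
  apply: eq_integral => y _; rewrite -mu_scale //; last exact: measurable_col_mxl.
  apply: eq_integral => r _; congr f.
  rewrite [LHS](mul_block_col (c%:M : 'M[R]_1) 0%R 0%R a (r : 'M[R]_(1, d)) (y : 'M[R]_(n, d))).
  by rewrite !mul0mx addr0 add0r mul_scalar_mx.
rewrite ge0_integralZl ?lee_fin ?exprn_ge0 ?invr_ge0 //; last first.
  exact: (measurableT_comp mG (measurable_lmul a)).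
by rewrite ia // muleA -EFinM normrM invfM exprMn.
Qed.

(** Gaussian elimination: a matrix with nonzero corner is the product of a lower
    unipotent, a block diagonal and an upper unipotent matrix, the lower diagonal
    block being the Schur complement. A unipotent factor translates the rows that
    it changes by expressions in the other rows, which [mu_shift] allows; the
    block diagonal factor is treated by [mu_scale] and induction. *)
Lemma rows_measure_lmul n (a : 'M[R]_n) : a \in unitmx -> lmul_inv a.
Proof.
elim: n => [|n IH] in a * => ua.
  move=> f mf f0; rewrite !integral_rows_measure0 //.
    by rewrite det_mx00 normr1 invr1 expr1n mul1e mulmx0.
  exact: (measurableT_comp mf (measurable_lmul _)).
pose corner (b : 'M[R]_n.+1) := b ord0 ord0.
wlog c0 : a ua / corner a != 0%R => [hw|].
  have [c0|] := eqVneq (corner a) 0%R; last exact: hw.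
  pose v := dlsubmx (a : 'M[R]_(1 + n)).
  (* Another entry of the first column is nonzero; adding its row to the first one
     makes the corner nonzero. *)
  have [i vi] : exists i, v i ord0 != 0%R.
    apply/existsP; apply: contraLR ua => /existsPn v0.
    rewrite unitmxE unitfE negbK; apply/eqP.
    rewrite (expand_det_col _ ord0) big1 // => i _.
    suff -> : a i ord0 = 0%R by rewrite mul0r.
    case: (split_ordP (i : 'I_(1 + n))) => k ->.
      by rewrite ord1; move: c0; rewrite /corner; congr (a _ _ = _); apply/val_inj.
    have /negPn/eqP := v0 k; rewrite /v !mxE => <-.
    by congr (a _ _); apply/val_inj.
  pose U b : 'M[R]_(1 + n) := block_mx 1%:M b 0 1%:M.
  have UK (b : 'M[R]_(1, n)) : (U (- b) *m U b = 1%:M)%R.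
    rewrite /U mulmx_block !mul1mx !mulmx1 !mul0mx !mulmx0 !addr0 !add0r.
    by rewrite subrr -scalar_mx_block.
  pose b : 'M[R]_(1, n) := delta_mx ord0 i.
  have -> : a = (U (- b) *m (U b *m a))%R by rewrite mulmxA UK mul1mx.
  apply: lmul_invM; first exact: lmul_inv_upper.
  apply: hw.
    rewrite unitmx_mul ua andbT unitmxE (det_ublock (1%:M : 'M[R]_1)) !det1.
    by rewrite mulr1 unitr1.
  have Ub j : U b ord0 (rshift 1 j) = b ord0 j.
    rewrite (_ : (ord0 : 'I_(1 + n)) = lshift n ord0) ?block_mxEur //.
    exact/val_inj.
  have rl j : lift ord0 j = rshift 1 j :> 'I_(1 + n) by exact/val_inj.
  rewrite /corner mxE big_ord_recl (_ : a ord0 ord0 = 0%R) // mulr0 add0r.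
  rewrite (bigD1 i) //= big1 => [|j ji].
    rewrite rl Ub /b !mxE !eqxx mul1r addr0; move: vi; rewrite /v !mxE.
    by congr (a _ _ != _); apply/val_inj.
  by rewrite rl Ub /b !mxE (negbTE ji) andbF mul0r.
pose A : 'M[R]_(1 + n) := a.
pose al := corner a.
have al0 : al != 0%R by [].
have ulE : ulsubmx A = al%:M.
  rewrite [ulsubmx A]mx11_scalar; congr (_%:M).
  by rewrite !mxE /al /corner /A; congr (a _ _); apply/val_inj.
pose S := (drsubmx A - al^-1 *: (dlsubmx A *m ursubmx A))%R.
have AE : A = (block_mx 1%:M 0 (al^-1 *: dlsubmx A) 1%:M *m
   (block_mx al%:M 0 0 S *m block_mx 1%:M (al^-1 *: ursubmx A) 0 1%:M))%R.
  rewrite !mulmx_block !mul1mx !mulmx1 !mul0mx !mulmx0 !addr0 !add0r.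
  have -> : al%:M *m (al^-1 *: ursubmx A) = ursubmx A.
    by rewrite mul_scalar_mx scalerA mulfV // scale1r.
  have -> : al^-1 *: dlsubmx A *m al%:M = dlsubmx A.
    by rewrite mul_mx_scalar scalerA mulfV // scale1r.
  rewrite -scalemxAl addrC.
  by rewrite -[LHS]submxK ulE /S subrK.
have uS : S \in unitmx.
  move: ua; rewrite -[a]/A AE !unitmx_mul => /and3P[_ + _].
  by rewrite !unitmxE (det_ublock (al%:M : 'M[R]_1)) unitrM => /andP[].
rewrite -[a]/A AE; apply: lmul_invM; first exact: lmul_inv_lower.
apply: lmul_invM; last exact: lmul_inv_upper.
exact: lmul_inv_diag al0 (IH _ uS).
Qed.

End Invariance.

(** * Lebesgue measure on matrices *)

Section LebesgueMatrix.
Variable R : realType.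
Local Open Scope ereal_scope.
Notation bmx m n := (borelMx R m n).

Lemma measurable_scalar : measurable_fun [set: R] (fun x : R => (x%:M)%R : bmx 1 1).
Proof.
apply: measurable_mx => i j; rewrite !ord1.
by rewrite (_ : (fun t => _) = id) //; apply/funext => t; rewrite mxE eqxx mulr1n.
Qed.

Lemma leb1_exists : exists m : {sigma_finite_measure set (bmx 1 1) -> \bar R},
  forall f : bmx 1 1 -> \bar R, measurable_fun setT f -> (forall y, 0 <= f y) ->
  \int[m]_y f y = \int[lebesgue_measure]_(x in [set: R]) f (x%:M)%R.
Proof.
pose phi (x : measurableTypeR R) : bmx 1 1 := (x%:M)%R.
pose psi (y : bmx 1 1) : measurableTypeR R := y ord0 ord0.
have mphi : measurable_fun setT phi by exact: measurable_scalar.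
have mpsi : measurable_fun setT psi by exact: measurable_entry.
have phiK : cancel phi psi by move=> x; rewrite /phi /psi mxE.
have [m mE] := pushforward_sigma_finite lebesgue_measure mphi mpsi phiK.
exists m => f mf f0; rewrite mE ge0_integral_pushforward // preimage_setT.
Qed.

Definition leb1 := projT1 (cid leb1_exists).

Lemma integral_leb1 (f : bmx 1 1 -> \bar R) :
  measurable_fun setT f -> (forall y, 0 <= f y) ->
  \int[leb1]_y f y = \int[lebesgue_measure]_(x in [set: R]) f (x%:M)%R.
Proof. by rewrite /leb1; case: cid => m /= H mf f0; exact: H. Qed.

Lemma leb1_affine (c : R) (a : 'M[R]_(1, 1)) (f : bmx 1 1 -> \bar R) : c != 0%R ->
  measurable_fun setT f -> (forall y, 0 <= f y) ->
  \int[leb1]_r f (c *: (r : 'M[R]_(1, 1)) + a)%R = (`|c|^-1)%:E * \int[leb1]_r f r.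
Proof.
move=> c0 mf f0; rewrite !integral_leb1 //; last first.
  apply: (measurableT_comp mf); apply: measurable_addmx; last exact: measurable_cst.
  exact: measurable_scale.
rewrite -(ge0_integral_affine (a ord0 ord0) (f := fun x => f (x%:M)%R)) //.
  apply: eq_integral => x _; congr f; apply/matrixP => i j.
  by rewrite !ord1 !mxE eqxx.
exact: (measurableT_comp mf measurable_scalar).
Qed.

Lemma leb1_shift (a : 'M[R]_(1, 1)) (f : bmx 1 1 -> \bar R) :
  measurable_fun setT f -> (forall y, 0 <= f y) ->
  \int[leb1]_r f ((r : 'M[R]_(1, 1)) + a)%R = \int[leb1]_r f r.
Proof.
move=> mf f0; rewrite -[RHS]mul1e.
have := @leb1_affine 1 a f (oner_neq0 _) mf f0; rewrite normr1 invr1 => <-.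
by under [RHS]eq_integral do rewrite scale1r.
Qed.

Lemma leb1_scale (c : R) (f : bmx 1 1 -> \bar R) : c != 0%R ->
  measurable_fun setT f -> (forall y, 0 <= f y) ->
  \int[leb1]_r f (c *: (r : 'M[R]_(1, 1)))%R = (`|c|^-1 ^+ 1)%:E * \int[leb1]_r f r.
Proof.
move=> c0 mf f0; rewrite expr1 -(leb1_affine 0%R c0 mf f0).
by under [RHS]eq_integral do rewrite addr0.
Qed.

Definition lebcol n := rows_measure leb1 n.

Lemma lebrow_exists d : exists m : {sigma_finite_measure set (bmx 1 d) -> \bar R},
  forall f : bmx 1 d -> \bar R, measurable_fun setT f -> (forall y, 0 <= f y) ->
  \int[m]_y f y = \int[lebcol d]_y f (y : 'M[R]_(d, 1))^T%R.
Proof.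
pose phi (y : bmx d 1) : bmx 1 d := ((y : 'M[R]_(d, 1))^T)%R.
pose psi (y : bmx 1 d) : bmx d 1 := ((y : 'M[R]_(1, d))^T)%R.
have mphi : measurable_fun setT phi by exact: measurable_trmx.
have mpsi : measurable_fun setT psi by exact: measurable_trmx.
have phiK : cancel phi psi by move=> x; rewrite /phi /psi trmxK.
have [m mE] := pushforward_sigma_finite (lebcol d) mphi mpsi phiK.
by exists m => f mf f0; rewrite mE ge0_integral_pushforward // preimage_setT.
Qed.

(** Rows carry the transposed measure of columns, and columns are powers of a
    one-by-one measure: right multiplication of a row by [k] is then left
    multiplication of a column, to which [rows_measure_lmul] applies. *)
Definition lebrow d := projT1 (cid (lebrow_exists d)).

Lemma integral_lebrow d (f : bmx 1 d -> \bar R) :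
  measurable_fun setT f -> (forall y, 0 <= f y) ->
  \int[lebrow d]_y f y = \int[lebcol d]_y f (y : 'M[R]_(d, 1))^T%R.
Proof. by rewrite /lebrow; case: cid => m /= H mf f0; exact: H. Qed.

Lemma measurable_tr m n : measurable_fun setT (fun y : bmx m n => (y : 'M[R]_(m, n))^T%R : bmx n m).
Proof. exact: measurable_trmx. Qed.

Lemma lebrow_rmul d (k : 'M[R]_d) (f : bmx 1 d -> \bar R) : k \in unitmx ->
  measurable_fun setT f -> (forall y, 0 <= f y) ->
  \int[lebrow d]_r f ((r : 'M[R]_(1, d)) *m k) = (`|\det k|^-1)%:E * \int[lebrow d]_r f r.
Proof.
move=> uk mf f0; rewrite !integral_lebrow //; last first.
  exact: (measurableT_comp mf (measurable_rmul k)).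
have mg : measurable_fun setT (fun y : bmx d 1 => f (y : 'M[R]_(d, 1))^T%R).
  exact: (measurableT_comp mf (@measurable_tr d 1)).
have uk' : k^T \in unitmx by rewrite unitmx_tr.
have := rows_measure_lmul leb1_shift leb1_scale uk' mg (fun y => f0 _).
rewrite det_tr expr1 => <-.
by apply: eq_integral => y _; rewrite trmx_mul trmxK.
Qed.

Lemma lebrow_shift d (a : 'M[R]_(1, d)) (f : bmx 1 d -> \bar R) :
  measurable_fun setT f -> (forall y, 0 <= f y) ->
  \int[lebrow d]_r f ((r : 'M[R]_(1, d)) + a)%R = \int[lebrow d]_r f r.
Proof.
move=> mf f0; rewrite !integral_lebrow //; last first.
  exact: (measurableT_comp mf (measurable_shift a)).
have mg : measurable_fun setT (fun y : bmx d 1 => f (y : 'M[R]_(d, 1))^T%R).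
  exact: (measurableT_comp mf (@measurable_tr d 1)).
rewrite -[RHS](rows_measure_shift leb1_shift a^T mg (fun y => f0 _)).
by apply: eq_integral => y _; rewrite linearD /= trmxK.
Qed.

Lemma lebrow_scale d (c : R) (f : bmx 1 d -> \bar R) : c != 0%R ->
  measurable_fun setT f -> (forall y, 0 <= f y) ->
  \int[lebrow d]_r f (c *: (r : 'M[R]_(1, d)))%R = (`|c|^-1 ^+ d)%:E * \int[lebrow d]_r f r.
Proof.
move=> c0 mf f0; have uc : (c%:M : 'M[R]_d) \in unitmx.
  by rewrite unitmxE det_scalar unitfE expf_neq0.
rewrite exprVn -normrX -det_scalar -(lebrow_rmul uc mf f0).
by under [RHS]eq_integral do rewrite mul_mx_scalar.
Qed.

Definition lebmx n d := rows_measure (lebrow d) n.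

Lemma lebmx_lmul n d (a : 'M[R]_n) (f : bmx n d -> \bar R) : a \in unitmx ->
  measurable_fun setT f -> (forall y, 0 <= f y) ->
  \int[lebmx n d]_y f (a *m (y : 'M[R]_(n, d))) =
  (`|\det a|^-1 ^+ d)%:E * \int[lebmx n d]_y f y.
Proof.
move=> ua mf f0.
exact: (rows_measure_lmul (@lebrow_shift d) (@lebrow_scale d) ua mf f0).
Qed.

Lemma lebmx_rmul n d (k : 'M[R]_d) (f : bmx n d -> \bar R) : k \in unitmx ->
  measurable_fun setT f -> (forall y, 0 <= f y) ->
  \int[lebmx n d]_y f ((y : 'M[R]_(n, d)) *m k) =
  (`|\det k|^-1 ^+ n)%:E * \int[lebmx n d]_y f y.
Proof. by move=> uk; apply: rows_measure_rmul => g mg g0; exact: lebrow_rmul. Qed.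

(** Boxes have an explicit positive and finite measure; they serve to show that
    open sets are not negligible and that bounded sets have finite measure. *)
Definition box m n (a : 'M[R]_(m, n)) (e : R) : set (bmx m n) :=
  [set y | forall i j, (`|y i j - a i j| < e)%R].

Lemma measurable_box m n (a : 'M[R]_(m, n)) e : measurable (box a e).
Proof.
rewrite (_ : box a e = \bigcap_(ij in [set: 'I_m * 'I_n])
   ((fun y : bmx m n => (`|y ij.1 ij.2 - a ij.1 ij.2| < e)%R) @^-1` [set true])).
  apply: fin_bigcap_measurable => // -[i j] _ /=.
  rewrite -[X in measurable X]setTI.
  apply: (measurable_fun_ltr (f := fun y : bmx m n => `|y i j - a i j|%R)) => //.
  apply: measurableT_comp => //; apply: measurable_funB => //.
  exact: measurable_entry.
by apply/seteqP; split=> y /= h; [move=> [i j] _ /=; exact: h|move=> i j; exact: (h (i, j))].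
Qed.

Lemma rows_measure_box n d (mu : {sigma_finite_measure set (bmx 1 d) -> \bar R}) (e v : R) :
  (0 <= v)%R -> (forall b : 'M[R]_(1, d), mu (box b e) = v%:E) ->
  forall a : 'M[R]_(n, d), rows_measure mu n (box a e) = (v ^+ n)%:E.
Proof.
move=> v0 hv; elim: n => [|n IH] a.
  have -> : box a e = setT by apply/seteqP; split=> // y _ [].
  by rewrite /= diracT expr0.
have mboxE m (b : 'M[R]_(m, d)) (nu : {sigma_finite_measure set (bmx m d) -> \bar R}) :
    nu (box b e) = \int[nu]_y (\1_(box b e) y)%:E.
  by rewrite integral_indic ?setIT //; exact: measurable_box.
have mind m (b : 'M[R]_(m, d)) : measurable_fun setT (fun y : bmx m d => (\1_(box b e) y)%:E).
  by apply/measurable_EFinP; apply: measurable_indic; exact: measurable_box.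
rewrite [LHS](mboxE _ a (rows_measure mu n.+1)) integral_rows_measureS //.
pose a1 := usubmx (a : 'M[R]_(1 + n, d)); pose a2 := dsubmx (a : 'M[R]_(1 + n, d)).
have ucE (r : 'M[R]_(1, d)) (y : 'M[R]_(n, d)) : 
    (\1_(box a e) (col_mx r y) = \1_(box a1 e) r * \1_(box a2 e) y :> R)%R.
  rewrite !indicE -natrM mulnb; congr (_%:R); congr nat_of_bool.
  apply/idP/andP; rewrite !inE.
    move=> h; split=> i j.
      by have := h (lshift n i) j; rewrite (col_mxEu r y) /a1 mxE.
    by have := h (rshift 1 i) j; rewrite (col_mxEd r y) /a2 mxE.
  move=> -[h1 h2] i j; case: (split_ordP (i : 'I_(1 + n))) => k ->.
    by have := h1 k j; rewrite (col_mxEu r y) /a1 mxE.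
  by have := h2 k j; rewrite (col_mxEd r y) /a2 mxE.
transitivity (\int[mu]_r ((v ^+ n)%:E * (\1_(box a1 e) r)%:E)).
  apply: eq_integral => r _.
  under eq_integral do rewrite ucE EFinM.
  rewrite ge0_integralZl ?lee_fin //.
  by rewrite -(mboxE _ _ (rows_measure mu n)) IH muleC.
rewrite ge0_integralZl ?lee_fin ?exprn_ge0 //.
by rewrite -(mboxE _ _ mu) hv -EFinM exprSr.
Qed.

Lemma leb1_box (b : 'M[R]_(1, 1)) (e : R) : (0 < e)%R ->
  leb1 (box b e) = (e *+ 2)%:E.
Proof.
move=> e0; have mb := measurable_box b e.
transitivity (\int[leb1]_y (\1_(box b e) y)%:E).
  by rewrite integral_indic ?setIT.
rewrite integral_leb1 //; last first.
  by apply/measurable_EFinP; exact: measurable_indic.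
rewrite (_ : (fun x => _) = fun x => (\1_(ball (b ord0 ord0) e) x)%:E); last first.
  apply/funext => x; rewrite !indicE; congr (_%:R%:E); congr nat_of_bool.
  apply/idP/idP; rewrite !inE.
    by move=> /(_ ord0 ord0); rewrite mxE eqxx mulr1n -ball_normE /ball_/= distrC.
  by rewrite -ball_normE /ball_/= => h i j; rewrite !ord1 mxE eqxx mulr1n distrC.
rewrite integral_indic ?setIT //; last exact: measurable_ball.
by apply: lebesgue_measure_ball; exact: ltW.
Qed.

Lemma lebmx_box n d (a : 'M[R]_(n, d)) (e : R) : (0 < e)%R ->
  lebmx n d (box a e) = (((e *+ 2) ^+ d) ^+ n)%:E.
Proof.
move=> e0; have e2 : (0 <= e *+ 2)%R by rewrite mulrn_wge0 // ltW.
apply: rows_measure_box => [|b]; first by rewrite exprn_ge0.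
have mb := measurable_box b e.
transitivity (\int[lebrow d]_y (\1_(box b e) y)%:E).
  by rewrite integral_indic ?setIT.
rewrite integral_lebrow //; last first.
  by apply/measurable_EFinP; exact: measurable_indic.
rewrite (_ : (fun x => _) = fun x => (\1_(box b^T e) x)%:E); last first.
  apply/funext => x; rewrite !indicE; congr (_%:R%:E); congr nat_of_bool.
  by apply/idP/idP; rewrite !inE => h i j; have := h j i; rewrite !mxE.
rewrite integral_indic ?setIT //; last exact: measurable_box.
by apply: rows_measure_box => // c; exact: leb1_box.
Qed.

Lemma lebmx_open_gt0 n d (U : set (bmx n d)) :
  @open 'M[R]_(n, d) U -> U !=set0 -> 0 < lebmx n d U.
Proof.
move=> oU [a Ua].
have /nbhs_ballP[e /= e0 eU] : nbhs (a : 'M[R]_(n, d)) U by apply: open_nbhs_nbhs.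
have bU : box a e `<=` U.
  move=> y h; apply: eU; split=> // i j; rewrite -ball_normE /ball_/= distrC.
  exact: h.
have mb : box a e \in measurable by rewrite inE; exact: measurable_box.
have mU : U \in (measurable : set (set (bmx n d))).
  by rewrite inE; apply: sub_sigma_algebra.
apply: lt_le_trans (le_measure (lebmx n d) mb mU bU).
by rewrite [X in _ < X](lebmx_box a e0) lte_fin !exprn_gt0 // mulrn_wgt0.
Qed.

End LebesgueMatrix.

(** * Positive definite matrices and contractions *)

Section Posdef.
Variable R : realType.

Definition sqnorm n (x : 'rV[R]_n) : R := (x *m x^T) ord0 ord0.

Lemma sqnormE n (x : 'rV[R]_n) : sqnorm x = \sum_i x ord0 i ^+ 2.
Proof. by rewrite /sqnorm mxE; apply: eq_bigr => i _; rewrite mxE expr2. Qed.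

Lemma sqnorm_ge0 n (x : 'rV[R]_n) : 0 <= sqnorm x.
Proof. by rewrite sqnormE sumr_ge0 // => i _; exact: sqr_ge0. Qed.

Lemma sqnorm_eq0 n (x : 'rV[R]_n) : (sqnorm x == 0) = (x == 0).
Proof.
apply/eqP/eqP => [|->]; last by rewrite /sqnorm mul0mx mxE.
rewrite sqnormE => /eqP; rewrite psumr_eq0; last by move=> i _; exact: sqr_ge0.
move=> /allP h; apply/rowP => i; rewrite mxE.
by have := h i; rewrite mem_index_enum => /(_ isT); rewrite sqrf_eq0 => /eqP.
Qed.

Lemma sqnorm_gt0 n (x : 'rV[R]_n) : x != 0 -> 0 < sqnorm x.
Proof. by move=> x0; rewrite lt_neqAle sqnorm_ge0 andbT eq_sym sqnorm_eq0. Qed.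

Lemma sqnorm_mul n m (x : 'rV[R]_n) (A : 'M[R]_(n, m)) :
  sqnorm (x *m A) = (x *m (A *m A^T) *m x^T) ord0 ord0.
Proof. by rewrite /sqnorm trmx_mul !mulmxA. Qed.

Lemma ler_sqnorm_entry n (x : 'rV[R]_n) i : x ord0 i ^+ 2 <= sqnorm x.
Proof.
rewrite sqnormE (bigD1 i) //= lerDl sumr_ge0 // => j _; exact: sqr_ge0.
Qed.

Definition posdef n (B : 'M[R]_n) := B^T = B /\
  forall x : 'rV[R]_n, x != 0 -> 0 < (x *m B *m x^T) ord0 ord0.

Lemma posdef_unit n (B : 'M[R]_n) : posdef B -> B \in unitmx.
Proof.
move=> [_ pB]; rewrite -row_free_unit; apply/row_freeP.
have : kermx B = 0.
  apply/eqP; apply: contraT => /rowV0Pn[x /sub_kermxP xB x0].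
  by have := pB x x0; rewrite xB mul0mx mxE ltxx.
move=> /eqP; rewrite kermx_eq0 => /row_freeP[C BC]; by exists C.
Qed.

(** The upper triangular factor of the Cholesky decomposition, by Schur
    complements. This square root of a positive definite matrix is an explicit
    algorithm, hence a Borel function of the matrix. *)
Fixpoint chol n : 'M[R]_n -> 'M[R]_n :=
  match n with
  | 0 => id
  | n'.+1 => fun B : 'M[R]_(1 + n') =>
     let b := B ord0 ord0 in
     block_mx (Num.sqrt b)%:M ((Num.sqrt b)^-1 *: ursubmx B) 0
       (chol (drsubmx B - b^-1 *: (dlsubmx B *m ursubmx B)))
  end.

(** The Schur complement of a positive definite matrix is positive definite: its
    quadratic form at [y] is the minimum over [t] of the original form at
    [row_mx t y]. *)
Lemma cholP n (B : 'M[R]_n) : posdef B -> (chol B)^T *m chol B = B.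
Proof.
elim: n => [|n IH] in B * => pB; first by rewrite [LHS]flatmx0 [RHS]flatmx0.
have [sB qB] := pB.
pose A : 'M[R]_(1 + n) := B; pose b := A ord0 ord0.
pose c := ursubmx A; pose D := drsubmx A.
have b0 : 0 < b.
  have := qB (delta_mx ord0 ord0); rewrite -rowE trmx_delta -colE !mxE; apply.
  by apply/eqP => /matrixP /(_ ord0 ord0) /eqP; rewrite !mxE !eqxx oner_eq0.
have dlE : dlsubmx A = c^T by rewrite trmx_ursub [A^T]sB.
have ulE : ulsubmx A = b%:M.
  rewrite [LHS]mx11_scalar; congr (_%:M); rewrite !mxE /b.
  by congr (A _ _); apply/val_inj.
have AE : A = block_mx b%:M c c^T D by rewrite -[LHS]submxK ulE dlE.
pose S := D - b^-1 *: (c^T *m c).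
have pS : posdef S.
  split.
    by rewrite /S linearB linearZ /= trmx_mul trmxK trmx_drsub [A^T]sB.
  (* The minimiser of the form of B at row_mx t y. *)
  move=> y y0; pose t := - (b^-1 *: (y *m c^T)).
  have X0 : row_mx t y != 0 :> 'rV_(1 + n).
    by apply: contra_neq y0 => X0; rewrite -[y](row_mxKr t) X0 linear0.
  have := qB (row_mx t y) X0.
  suff <- : row_mx t y *m A *m (row_mx t y)^T = y *m S *m y^T by [].
  rewrite AE mul_row_block tr_row_mx mul_row_col.
  rewrite mul_mx_scalar /t scalerN scalerA divff ?gt_eqF // scale1r addNr mul0mx add0r.
  by rewrite /S mulmxBr -scalemxAr mulNmx -scalemxAl mulmxA addrC.
rewrite -[B in RHS]/A [in RHS]AE.
rewrite [chol B](_ : _ = block_mx (Num.sqrt b)%:M ((Num.sqrt b)^-1 *: c) 0 (chol S)); last first.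
  by rewrite /= -/A -/b -/c dlE.
have sb0 : Num.sqrt b != 0 by rewrite gt_eqF // sqrtr_gt0.
have sb : Num.sqrt b * Num.sqrt b = b by rewrite -expr2 sqr_sqrtr // ltW.
rewrite [LHS](_ : _ = (block_mx (Num.sqrt b)%:M ((Num.sqrt b)^-1 *: c) 0 (chol S))^T *m
   block_mx (Num.sqrt b)%:M ((Num.sqrt b)^-1 *: c) 0 (chol S)) //.
rewrite tr_block_mx mulmx_block !trmx0 !mul0mx !mulmx0 !addr0 tr_scalar_mx.
apply: (f_equal4 (@block_mx R 1 n 1 n)).
- by rewrite -scalar_mxM sb.
- by rewrite mul_scalar_mx scalerA divff // scale1r.
- by rewrite mul_mx_scalar linearZ /= scalerA divff // scale1r.
rewrite (IH _ pS) [(_ *: c)^T]linearZ -scalemxAl -scalemxAr scalerA -invfM sb /S.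
by rewrite addrC subrK.
Qed.

Lemma chol_unit n (B : 'M[R]_n) : posdef B -> chol B \in unitmx.
Proof.
move=> pB; have := posdef_unit pB; rewrite -{1}(cholP pB) unitmx_mul.
by case/andP.
Qed.

Lemma det_chol n (B : 'M[R]_n) : posdef B -> \det (chol B) ^+ 2 = \det B.
Proof. by move=> pB; rewrite -{2}(cholP pB) det_mulmx det_tr expr2. Qed.

Lemma posdef_det_gt0 n (B : 'M[R]_n) : posdef B -> 0 < \det B.
Proof.
move=> pB; rewrite -det_chol // exprn_even_gt0 //= -unitfE -unitmxE.
exact: chol_unit.
Qed.

Lemma posdef_gram n d (y : 'M[R]_(n, d)) : \rank y = d -> posdef (y^T *m y).
Proof.
move=> ry; split; first by rewrite trmx_mul trmxK.
move=> x x0; rewrite !mulmxA -mulmxA -[X in _ *m X]trmxK trmx_mul trmxK.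
apply: (@sqnorm_gt0 n (x *m y^T)).
have fy : row_free y^T by rewrite /row_free mxrank_tr ry.
apply: contra_neq x0 => xy.
by apply: (row_free_inj fy); rewrite xy mul0mx.
Qed.

Lemma gram_det_neq0 n d (y : 'M[R]_(n, d)) :
  (\det (y^T *m y) != 0) = (\rank y == d).
Proof.
apply/idP/eqP => [|ry].
  rewrite -unitfE -unitmxE -row_free_unit /row_free => /eqP rd.
  apply/eqP; rewrite eqn_leq rank_leq_col /= -[leqLHS]rd.
  exact: mxrankM_maxr.
by rewrite gt_eqF // posdef_det_gt0 //; exact: posdef_gram.
Qed.

(** All powers of a contraction are contractions, so their entries are bounded by
    1 and their determinants by the number of permutations; but
    [\det (C ^ k) = \det C ^ k] would be unbounded if [\det C] exceeded 1. *)
Lemma det_contraction n (C : 'M[R]_n) :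
  (forall x : 'rV[R]_n, sqnorm (x *m C) <= sqnorm x) -> `|\det C| <= 1.
Proof.
move=> hC.
have hk k : exists M : 'M[R]_n, (forall x : 'rV[R]_n, sqnorm (x *m M) <= sqnorm x) /\
    \det M = \det C ^+ k.
  elim: k => [|k [M [hM dM]]]; first by exists 1%:M; split=> [x|]; rewrite ?mulmx1 ?det1.
  exists (C *m M); split=> [x|]; last by rewrite det_mulmx dM exprS.
  by rewrite mulmxA; exact: le_trans (hM _) (hC _).
have bound k : `|\det C| ^+ k <= #|{perm 'I_n}|%:R.
  have [M [hM dM]] := hk k; rewrite -normrX -dM.
  have eM i j : `|M i j| <= 1.
    rewrite -(@ler_pXn2r _ 2) ?nnegrE // expr1n real_normK ?num_real //.
    have := ler_sqnorm_entry (delta_mx ord0 i *m M) j.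
    rewrite -rowE mxE => /le_trans; apply; rewrite rowE.
    apply: le_trans (hM _) _; rewrite sqnormE (bigD1 i) //= big1 ?mxE ?eqxx ?addr0 ?expr1n //.
    by move=> l li; rewrite mxE (negbTE li) andbF expr0n.
  rewrite /determinant; apply: le_trans (ler_norm_sum _ _ _) _.
  rewrite -sumr_const; apply: ler_sum => s _.
  rewrite normrM normrX normrN1 expr1n mul1r normr_prod.
  by apply: prodr_ile1 => i _; rewrite normr_ge0 eM.
rewrite leNgt; apply/negP => c1.
pose h := `|\det C| - 1; have h0 : 0 < h by rewrite subr_gt0.
(* Bernoulli: the powers of a number above 1 grow at least linearly. *)
have bern k : 1 + k%:R * h <= `|\det C| ^+ k.
  elim: k => [|k IHk]; first by rewrite mul0r addr0 expr0.
  rewrite exprS (_ : `|\det C| = 1 + h) in IHk *; last by rewrite /h; ring.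
  have : (1 + h) * (1 + k%:R * h) <= (1 + h) * (1 + h) ^+ k.
    by rewrite ler_pM2l //; lra.
  apply: le_trans; rewrite -natr1.
  have : 0 <= k%:R * h ^+ 2 by rewrite mulr_ge0 // sqr_ge0.
  by lra.
pose N : R := #|{perm 'I_n}|%:R.
have := unstable.ltr_bound (N / h).
set k := Num.bound _; rewrite ltr_pdivrMr // => Nk.
have := le_trans (bern k) (bound k); rewrite -/N; lra.
Qed.

(** If [b] is the Cholesky factor of [B], then [b^-T *m N] is a contraction. *)
Lemma det_sqr_le n (B N : 'M[R]_n) : posdef B ->
  (forall x : 'rV[R]_n, sqnorm (x *m N) <= (x *m B *m x^T) ord0 ord0) ->
  \det N ^+ 2 <= \det B.
Proof.
move=> pB hN; have ub := chol_unit pB.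
have ubT : (chol B)^T \in unitmx by rewrite unitmx_tr.
have := @det_contraction _ (invmx (chol B)^T *m N).
rewrite det_mulmx det_inv det_tr => /(_ _) H.
have {}H : `|(\det (chol B))^-1 * \det N| <= 1.
  apply: H => x; rewrite mulmxA; apply: le_trans (hN _) _.
  move: (chol B) ub ubT (cholP pB) => b ub ubT <-.
  rewrite trmx_mul trmx_inv trmxK /sqnorm !mulmxA mulmxKV //.
  by rewrite mulmxK.
have d0 : \det (chol B) != 0 by rewrite -unitfE -unitmxE.
rewrite -(det_chol pB) -[leLHS]real_normK ?num_real // -[leRHS]real_normK ?num_real //.
rewrite ler_pXn2r ?nnegrE //.
by move: H; rewrite normrM normfV mulrC ler_pdivrMr ?normr_gt0 // mul1r.
Qed.

End Posdef.

Section CholMeasurable.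
Variables (R : realType) (d0 : measure_display) (T : measurableType d0).
Notation bmx m n := (borelMx R m n).

Lemma measurable_sqrt : measurable_fun [set: R] (@Num.sqrt R).
Proof.
rewrite (_ : Num.sqrt = (fun x : R => Num.max x 0 `^ 2^-1)).
  apply: (measurableT_comp (measurable_powR 2^-1) (g := fun x : R => Num.max x 0)).
  by apply: measurable_maxr => //; exact: measurable_cst.
apply/funext => x; rewrite powR12_sqrt ?le_max ?lexx ?orbT //.
by case: leP => // x0; rewrite sqrtr0 ler0_sqrtr.
Qed.

Lemma measurable_chol n (f : T -> bmx n n) :
  measurable_fun setT f -> measurable_fun setT (fun t => chol (f t) : bmx n n).
Proof.
elim: n => [|n IH] in f * => mf; first by [].
have mb : measurable_fun setT (fun t => f t ord0 ord0) by exact: measurable_coord.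
have ms : measurable_fun setT (fun t => Num.sqrt (f t ord0 ord0)).
  exact: (measurableT_comp measurable_sqrt mb).
have mur : measurable_fun setT (fun t => ursubmx (f t : 'M[R]_(1 + n)) : bmx 1 n).
  apply: measurable_mx => i j; under eq_fun do rewrite !mxE; exact: measurable_coord.
have mdl : measurable_fun setT (fun t => dlsubmx (f t : 'M[R]_(1 + n)) : bmx n 1).
  apply: measurable_mx => i j; under eq_fun do rewrite !mxE; exact: measurable_coord.
have mdr : measurable_fun setT (fun t => drsubmx (f t : 'M[R]_(1 + n)) : bmx n n).
  apply: measurable_mx => i j; under eq_fun do rewrite !mxE; exact: measurable_coord.
apply: (@measurable_col_mx R _ _ 1 n (1 + n)); apply: measurable_row_mx.
- apply: measurable_mx => i j; rewrite !ord1.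
  by under eq_fun do rewrite mxE eqxx mulr1n.
- apply: measurable_scalemx => //.
  exact: (measurableT_comp (@measurable_invr R) ms).
- exact: measurable_cst.
apply: IH; apply: measurable_addmx => //.
under eq_fun do rewrite -scaleNr.
apply: measurable_scalemx; last exact: measurable_mulmx.
apply: measurableT_comp => //.
exact: (measurableT_comp (@measurable_invr R) mb).
Qed.

End CholMeasurable.

(** * The determinants in the kernel *)

Section KernelBound.
Variable R : realType.

Lemma sqnormD n (a b : 'rV[R]_n) : a *m b^T = 0 -> sqnorm (a + b) = sqnorm a + sqnorm b.
Proof.
move=> ab; have ba : b *m a^T = 0 by rewrite -[LHS]trmxK trmx_mul trmxK ab trmx0.
by rewrite /sqnorm linearD /= mulmxDl !mulmxDr ab ba addr0 add0r mxE.
Qed.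

Lemma sqnorm_row_mx n m (a : 'rV[R]_n) (b : 'rV[R]_m) : sqnorm (row_mx a b) = sqnorm a + sqnorm b.
Proof. by rewrite /sqnorm tr_row_mx mul_row_col mxE. Qed.

Lemma sqnorm_Stiefel n d (y : 'M[R]_(n, d)) (x : 'rV[R]_d) : y^T *m y = 1%:M ->
  sqnorm (x *m y^T) = sqnorm x.
Proof. by move=> yy; rewrite sqnorm_mul trmxK yy mulmx1. Qed.

(** Pythagoras: [y *m y^T] is the orthogonal projection onto the columns of
    [y]. *)
Lemma sqnorm_split n d (y : 'M[R]_(n, d)) (x : 'rV[R]_n) : y^T *m y = 1%:M ->
  sqnorm x = sqnorm (x *m (1%:M - y *m y^T)) + sqnorm (x *m y).
Proof.
move=> yy; rewrite -(sqnorm_Stiefel (x *m y) yy) -sqnormD.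
  by rewrite mulmxBr mulmx1 !mulmxA subrK.
have Py : (1%:M - y *m y^T) *m y = 0.
  by rewrite mulmxBl mul1mx -mulmxA yy mulmx1 subrr.
by rewrite !trmx_mul trmxK !mulmxA -(mulmxA x) Py mulmx0 !mul0mx.
Qed.

Lemma posdef_1Dsqr n (z : 'M[R]_n) : z^T = z -> posdef (1%:M + z *m z).
Proof.
move=> sz; split; first by rewrite linearD /= trmx1 trmx_mul sz.
move=> x x0; rewrite mulmxDr mulmx1 mulmxDl mxE.
have := sqnorm_mul x z; rewrite sz => <-.
by rewrite ltr_pwDl ?sqnorm_ge0 //; exact: sqnorm_gt0.
Qed.

Lemma quad_1Dsqr n (z : 'M[R]_n) (x : 'rV[R]_n) : z^T = z ->
  (x *m (1%:M + z *m z) *m x^T) ord0 ord0 = sqnorm x + sqnorm (x *m z).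
Proof. by move=> sz; rewrite sqnorm_mul sz mulmxDr mulmx1 mulmxDl mxE. Qed.

Lemma det_1Dsqr_ge1 n (z : 'M[R]_n) : z^T = z -> 1 <= \det (1%:M + z *m z).
Proof.
move=> sz; have := det_sqr_le (N := 1%:M) (posdef_1Dsqr sz).
rewrite det1 expr1n; apply.
by move=> x; rewrite quad_1Dsqr // mulmx1 lerDl sqnorm_ge0.
Qed.

Lemma det_sqr_le_1Dsqr n (z : 'M[R]_n) : z^T = z ->
  \det z ^+ 2 <= \det (1%:M + z *m z).
Proof.
move=> sz; apply: det_sqr_le; first exact: posdef_1Dsqr.
by move=> x; rewrite quad_1Dsqr // lerDr sqnorm_ge0.
Qed.

(** A row operation replaces [z] by [z *m P], where [P] is the projection
    orthogonal to the columns of [y]. The new matrix sends [row_mx x1 x2] to the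
    row with blocks [x1 *m z *m P + x2 *m y^T] and [x1 *m y], whose squared norm is
    at most that of [x1], plus that of [x1 *m z], plus that of [x2], by
    orthogonality: the quadratic form of the block diagonal matrix with blocks
    [1 + z *m z] and [1]. *)
Lemma det_block_sqr_le n d (z : 'M[R]_n) (y : 'M[R]_(n, d)) :
  z^T = z -> y^T *m y = 1%:M ->
  \det (block_mx z y y^T (0 : 'M[R]_d)) ^+ 2 <= \det (1%:M + z *m z).
Proof.
move=> sz yy; pose P := 1%:M - y *m y^T.
pose M : 'M[R]_(n + d) := block_mx (z *m P) y y^T 0.
(* Subtract z *m y times the last d rows from the first n. *)
have -> : \det (block_mx z y y^T (0 : 'M[R]_d)) = \det M.
  rewrite -[LHS]mul1r -(_ : \det (block_mx 1%:M (- (z *m y)) 0 1%:M : 'M[R]_(n + d)) = 1).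
    rewrite -det_mulmx mulmx_block !mul1mx !mul0mx !mulmx0 !addr0 !add0r.
    by rewrite /M /P mulmxBr mulmx1 mulNmx mulmxA.
  by rewrite det_ublock !det1 mulr1.
have Bq (x : 'rV[R]_(n + d)) (x1 := lsubmx x) (x2 := rsubmx x) :
    (x *m (block_mx (1%:M + z *m z) 0 0 1%:M : 'M[R]_(n + d)) *m x^T) ord0 ord0 =
    sqnorm x1 + sqnorm (x1 *m z) + sqnorm x2.
  rewrite -[x]hsubmxK -/x1 -/x2 mul_row_block tr_row_mx mul_row_col !mulmx0 addr0 add0r mulmx1.
  by rewrite mxE quad_1Dsqr.
have <- : \det (block_mx (1%:M + z *m z) 0 0 1%:M : 'M[R]_(n + d)) = \det (1%:M + z *m z).
  by rewrite det_ublock det1 mulr1.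
apply: det_sqr_le.
  split; first by rewrite tr_block_mx !trmx0 trmx1 (posdef_1Dsqr sz).1.
  move=> x x0; rewrite Bq.
  have [x10|x10] := eqVneq (lsubmx x) 0; last first.
    by rewrite -addrA ltr_pwDl ?sqnorm_gt0 // addr_ge0 // sqnorm_ge0.
  rewrite ltr_wpDl ?addr_ge0 ?sqnorm_ge0 // sqnorm_gt0 //.
  by apply: contra_neq x0 => x20; rewrite -[x]hsubmxK x10 x20 row_mx0.
move=> x; rewrite Bq -[x in leLHS]hsubmxK.
move: (lsubmx x) (rsubmx x) => x1 x2.
rewrite mul_row_block mulmx0 addr0 sqnorm_row_mx.
have Py : P *m y = 0 by rewrite /P mulmxBl mul1mx -mulmxA yy mulmx1 subrr.
rewrite sqnormD; last first.
  by rewrite trmx_mul trmxK !mulmxA -(mulmxA _ P) Py mulmx0 mul0mx.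
rewrite sqnorm_Stiefel // mulmxA (sqnorm_split (x1 *m z) yy) -/P (sqnorm_split x1 yy).
have := sqnorm_ge0 (x1 *m P); have := sqnorm_ge0 (x1 *m z *m y).
by lra.
Qed.

End KernelBound.

(** * Transitivity of the orthogonal group on the Stiefel manifold *)

Section StiefelTransitive.
Variable R : realType.

Lemma orthogonal_square k n (Y : 'M[R]_(k, n)) : k = n ->
  Y *m Y^T = 1%:M -> Y^T *m Y = 1%:M.
Proof. by move=> kn; subst k; exact: mulmx1C. Qed.

(** The rows of [c] are an orthonormal basis of the orthogonal complement of the
    columns of [v]: a basis of the kernel, orthonormalised by the Cholesky factor
    of its Gram matrix. *)
Lemma Stiefel_complement n d (v : 'M[R]_(n, d)) : v^T *m v = 1%:M ->
  exists c : 'M[R]_(n - d, n), v *m v^T + c^T *m c = 1%:M /\ c *m c^T = 1%:M /\ c *m v = 0.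
Proof.
move=> vv.
have dn : (d <= n)%N.
  rewrite -[leqLHS](mxrank1 R) -vv; apply: leq_trans (mxrankM_maxl _ _) _.
  exact: rank_leq_col.
have rv : \rank v = d.
  apply/eqP; rewrite eqn_leq rank_leq_col /= -[leqLHS](mxrank1 R) -vv.
  exact: mxrankM_maxr.
have [c0 [rc c0v]] : exists c0 : 'M[R]_(n - d, n), \rank c0 = (n - d)%N /\ c0 *m v = 0.
  have rk : \rank (kermx v) = (n - d)%N by rewrite mxrank_ker rv.
  move: (row_base (kermx v)) (eq_row_base (kermx v)) => K KE.
  have rK : \rank K = \rank (kermx v) by rewrite KE.
  have Kv : K *m v = 0 by apply/sub_kermxP; rewrite KE.
  by move: K KE rK Kv; rewrite rk => K _ rK Kv; exists K.
pose B := c0 *m c0^T.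
have pB : posdef B.
  by have := @posdef_gram R _ _ c0^T; rewrite trmxK mxrank_tr; apply.
have ub := chol_unit pB.
pose c := invmx (chol B)^T *m c0.
have cv : c *m v = 0 by rewrite /c -mulmxA c0v mulmx0.
have cc : c *m c^T = 1%:M.
  rewrite /c trmx_mul trmx_inv trmxK mulmxA -(mulmxA _ c0) -/B.
  rewrite -[X in _ *m X *m _](cholP pB) mulmxA mulVmx ?unitmx_tr // mul1mx.
  by rewrite mulmxV.
exists c; split; last by [].
have vc : v^T *m c^T = 0 by rewrite -trmx_mul cv trmx0.
have := @orthogonal_square _ _ (col_mx v^T c) (subnKC dn).
rewrite tr_col_mx trmxK mul_col_row mul_row_col vv cc cv vc -scalar_mx_block.
exact.
Qed.

(** The matrix [w *m v^T + e^T *m c] sends the frame [v] to [w] and an orthonormal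
    basis of the complement of [v] to one of the complement of [w]. *)
Lemma Stiefel_transitive n d (v w : 'M[R]_(n, d)) :
  v^T *m v = 1%:M -> w^T *m w = 1%:M ->
  exists q : 'M[R]_n, q^T *m q = 1%:M /\ w = q *m v.
Proof.
move=> vv ww.
have [c [cs [cc cv]]] := Stiefel_complement vv.
have [e [es [ee ew]]] := Stiefel_complement ww.
exists (w *m v^T + e^T *m c); split.
  have we : w^T *m e^T = 0 by rewrite -trmx_mul ew trmx0.
  rewrite [X in X *m _](_ : _ = v *m w^T + c^T *m e); last first.
    by rewrite [LHS]linearD /= !trmx_mul !trmxK.
  rewrite mulmxDl !mulmxDr.
  rewrite !mulmxA -(mulmxA v) ww mulmx1 -(mulmxA v) we mulmx0 mul0mx addr0.
  by rewrite -(mulmxA c^T) ew mulmx0 mul0mx add0r -(mulmxA c^T) ee mulmx1.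
by rewrite mulmxDl -!mulmxA vv cv mulmx1 mulmx0 addr0.
Qed.

End StiefelTransitive.

(** * An invariant shell around the Stiefel manifold *)

Section Shell.
Variable R : realType.
Notation bmx m n := (borelMx R m n).

Definition gram n d (y : 'M[R]_(n, d)) : 'M[R]_d := y^T *m y.

Lemma gram_lmul n d (q : 'M[R]_n) (y : 'M[R]_(n, d)) : q^T *m q = 1%:M ->
  gram (q *m y) = gram y.
Proof. by move=> qq; rewrite /gram trmx_mul mulmxA -(mulmxA y^T) qq mulmx1. Qed.

Lemma gram_rmul n d (y : 'M[R]_(n, d)) (k : 'M[R]_d) : \rank y = d ->
  gram (y *m k) = gram (chol (gram y) *m k).
Proof.
move=> ry; rewrite /gram !trmx_mul !mulmxA -!(mulmxA k^T).
by rewrite cholP //; exact: posdef_gram.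
Qed.

(** An O(n)-invariant open set containing the Stiefel manifold, as [gram y = 1] has
    trace [d] and determinant 1. The bound on the trace makes it bounded, and those
    on the determinant keep it away from the matrices of smaller rank. *)
Definition shell n d : set (bmx n d) :=
  [set y | [/\ \tr (gram y) < d.+1%:R, 2^-1 < \det (gram y) & \det (gram y) < 2]].

Lemma shell_rank n d (y : bmx n d) : shell y -> \rank (y : 'M[R]_(n, d)) = d.
Proof.
by move=> [_ h _]; apply/eqP; rewrite -gram_det_neq0 gt_eqF // (lt_trans _ h) // invr_gt0.
Qed.

Lemma shell_gram n m d (y : bmx n d) (y' : bmx m d) :
  gram y = gram y' -> shell y = shell y'.
Proof. by rewrite /shell/= => ->. Qed.

Lemma measurable_gram n d : measurable_fun setT (fun y : bmx n d => gram y : bmx d d).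
Proof. by apply: measurable_mulmx => //; exact: measurable_trmx. Qed.

Lemma measurable_det_gram n d : measurable_fun setT (fun y : bmx n d => \det (gram y)).
Proof. exact: (measurable_det (@measurable_gram n d)). Qed.

Lemma measurable_shell n d : measurable (@shell n d).
Proof.
have mt : measurable_fun setT (fun y : bmx n d => \tr (gram y)).
  by apply: measurable_sum => i; exact: (measurable_coord i i (@measurable_gram n d)).
have md := @measurable_det_gram n d.
rewrite (_ : @shell n d = (fun y : bmx n d => \tr (gram y) < d.+1%:R) @^-1` [set true] `&`
  ((fun y : bmx n d => 2^-1 < \det (gram y)) @^-1` [set true] `&`
   (fun y : bmx n d => \det (gram y) < 2) @^-1` [set true])); last first.
  by apply/seteqP; split=> y /=; [move=> [-> -> ->]|move=> [? [? ?]]].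
have mlt (f g : bmx n d -> R) : measurable_fun setT f -> measurable_fun setT g ->
    measurable ((fun y => f y < g y) @^-1` [set true]).
  by move=> mf mg; rewrite -[X in measurable X]setTI; exact: measurable_fun_ltr.
by apply: measurableI; [|apply: measurableI]; apply: mlt => //; exact: measurable_cst.
Qed.

Lemma continuous_sum_fun (T : topologicalType) (I : Type) (s : seq I) (f : I -> T -> R) :
  (forall i, continuous (f i)) -> continuous (fun x => \sum_(i <- s) f i x).
Proof.
move=> cf x; elim: s => [|i s IH].
  rewrite (_ : (fun x => _) = cst 0); first exact: cvg_cst.
  by apply/funext => y; rewrite big_nil.
rewrite (_ : (fun x => _) = fun x => f i x + \sum_(j <- s) f j x).
  by apply: cvgD => //; exact: cf.
by apply/funext => y; rewrite big_cons.
Qed.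

Lemma continuous_prod_fun (T : topologicalType) (I : Type) (s : seq I) (f : I -> T -> R) :
  (forall i, continuous (f i)) -> continuous (fun x => \prod_(i <- s) f i x).
Proof.
move=> cf x; elim: s => [|i s IH].
  rewrite (_ : (fun x => _) = cst 1); first exact: cvg_cst.
  by apply/funext => y; rewrite big_nil.
rewrite (_ : (fun x => _) = fun x => f i x * \prod_(j <- s) f j x).
  by apply: cvgM => //; exact: cf.
by apply/funext => y; rewrite big_cons.
Qed.

Lemma continuous_gram n d i j : continuous (fun y : 'M[R]_(n, d) => gram y i j).
Proof.
rewrite (_ : (fun y => _) = fun y : 'M[R]_(n, d) => \sum_k (y k i * y k j)).
  apply: continuous_sum_fun => k y.
  by apply: (@continuousM R _ (fun y : 'M[R]_(n, d) => y k i) (fun y : 'M[R]_(n, d) => y k j)); exact: coord_continuous.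
by apply/funext => y; rewrite /gram mxE; apply: eq_bigr => k _; rewrite mxE.
Qed.

Lemma open_shell n d : @open 'M[R]_(n, d) (@shell n d).
Proof.
have ct : continuous (fun y : 'M[R]_(n, d) => \tr (gram y)).
  by apply: continuous_sum_fun => i; exact: continuous_gram.
have cd : continuous (fun y : 'M[R]_(n, d) => \det (gram y)).
  apply: continuous_sum_fun => s y.
  apply: (@continuousM R _ (cst _) (fun y : 'M[R]_(n, d) => \prod_i gram y i (s i))).
    exact: cst_continuous.
  by apply: continuous_prod_fun => i; exact: continuous_gram.
rewrite (_ : @shell n d = (fun y : 'M[R]_(n, d) => \tr (gram y)) @^-1` [set x | x < d.+1%:R] `&`
  ((fun y : 'M[R]_(n, d) => \det (gram y)) @^-1` [set x | 2^-1 < x] `&`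
   (fun y : 'M[R]_(n, d) => \det (gram y)) @^-1` [set x | x < 2])); last first.
  by apply/seteqP; split=> y /=; [move=> [? ? ?]|move=> [? [? ?]]].
apply: openI; first by apply: open_comp; [move=> y _; exact: ct|exact: open_lt].
apply: openI; apply: open_comp; try (by move=> y _; exact: cd).
  exact: open_gt.
exact: open_lt.
Qed.

Lemma Stiefel_pid n d : (d <= n)%N -> gram (pid_mx d : 'M[R]_(n, d)) = 1%:M.
Proof.
move=> dn; rewrite /gram tr_pid_mx pid_mx_id //.
exact: pid_mx_1.
Qed.

Lemma lebmx_shell_gt0 n d : (d <= n)%N -> (0 < lebmx R n d (@shell n d))%E.
Proof.
move=> dn; apply: lebmx_open_gt0; first exact: open_shell.
exists (pid_mx d); rewrite /shell/= Stiefel_pid // mxtrace1 det1 ltr_nat ltnS leqnn.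
by split=> //; lra.
Qed.

Lemma lebmx_shell_lty n d : (lebmx R n d (@shell n d) < +oo)%E.
Proof.
have d1 : (0 < d.+1%:R :> R) by [].
apply: le_lt_trans (_ : lebmx R n d (box 0 d.+1%:R) < +oo)%E; last first.
  by rewrite lebmx_box // ltry.
apply: le_measure; rewrite ?inE; [exact: measurable_shell|exact: measurable_box|].
move=> y [h _ _] i j; rewrite mxE subr0.
have : `|y i j| ^+ 2 <= \tr (gram y).
  rewrite real_normK ?num_real // /mxtrace (bigD1 j) //= /gram mxE (bigD1 i) //= !mxE -expr2.
  rewrite -addrA lerDl addr_ge0 // sumr_ge0 // => k _.
    by rewrite !mxE -expr2 sqr_ge0.
  by rewrite mxE sumr_ge0 // => l _; rewrite mxE -expr2 sqr_ge0.
move=> /le_lt_trans /(_ h) hh; rewrite ltNge; apply/negP => ge.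
have : d.+1%:R * d.+1%:R <= `|y i j| ^+ 2 by rewrite expr2 ler_pM.
move=> /le_lt_trans /(_ hh); rewrite -subr_gt0 -[X in X - _]mulr1 -mulrBr pmulr_rgt0 //.
by rewrite subr_gt0 ltNge ler1n.
Qed.

End Shell.

Section Orth.
Variable R : realType.
Notation bmx m n := (borelMx R m n).

Definition ginv n (b : 'M[R]_n) : 'M[R]_n := (\det b)^-1 *: \adj b.

Lemma ginvE n (b : 'M[R]_n) : b \in unitmx -> ginv b = invmx b.
Proof. by move=> ub; rewrite /ginv /invmx ub. Qed.

(** Gram-Schmidt orthonormalisation of the columns. *)
Definition orth n d (y : 'M[R]_(n, d)) : 'M[R]_(n, d) := y *m ginv (chol (gram y)).

(** The volume of the parallelotope spanned by the columns, that is, the square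
    root of [\det (gram y)]. *)
Definition colvol n d (y : 'M[R]_(n, d)) : R := `|\det (chol (gram y))|.

Lemma orthE n d (y : 'M[R]_(n, d)) : \rank y = d ->
  orth y = y *m invmx (chol (gram y)).
Proof. by move=> ry; rewrite /orth ginvE //; exact/chol_unit/posdef_gram. Qed.

Lemma gram_orth n d (y : 'M[R]_(n, d)) : \rank y = d -> gram (orth y) = 1%:M.
Proof.
move=> ry; rewrite orthE //; have pg := posdef_gram ry.
rewrite /gram trmx_mul trmx_inv mulmxA -(mulmxA _ y^T).
have := cholP pg; have := chol_unit pg; rewrite -/(gram y).
move: (chol (gram y)) => b ub <-.
by rewrite mulmxA mulVmx ?unitmx_tr // mul1mx mulmxV.
Qed.

Lemma orth_lmul n d (q : 'M[R]_n) (y : 'M[R]_(n, d)) : q^T *m q = 1%:M ->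
  orth (q *m y) = q *m orth y.
Proof. by move=> qq; rewrite /orth gram_lmul // mulmxA. Qed.

Lemma measurable_orth n d : measurable_fun setT (fun y : bmx n d => orth y : bmx n d).
Proof.
apply: measurable_mulmx => //; apply: measurable_ginv; apply: measurable_chol.
exact: measurable_gram.
Qed.

Lemma measurable_colvol n d : measurable_fun setT (fun y : bmx n d => colvol y).
Proof.
exact: (measurableT_comp (@normr_measurable R setT)
  (measurable_det (measurable_chol (@measurable_gram R n d)))).
Qed.

Lemma colvol_sqr n d (y : 'M[R]_(n, d)) : \rank y = d -> colvol y ^+ 2 = \det (gram y).
Proof.
by move=> ry; rewrite /colvol real_normK ?num_real // det_chol //; exact: posdef_gram.
Qed.

Lemma shell_colvol n d (y : bmx n d) : shell y -> 2^-1 <= colvol y <= 2.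
Proof.
move=> sy; have ry := shell_rank sy; case: (sy) => _.
rewrite -colvol_sqr // => h1 h2; have : 0 <= colvol y by exact: normr_ge0.
by move=> h0; apply/andP; split; nra.
Qed.

(** The exponent [n] is chosen so that [H (orth y) * shell_weight y = H y] on the shell when
    [H] is homogeneous of degree [- n]. *)
Definition shell_weight n d (y : bmx n d) : \bar R := (\1_(@shell R n d) y * (colvol y ^+ n)^-1)%:E.

Lemma measurable_shell_weight n d : measurable_fun setT (@shell_weight n d).
Proof.
apply/measurable_EFinP; apply: measurable_funM.
  by apply: measurable_indic; exact: measurable_shell.
apply: (measurableT_comp (@measurable_invr R)); apply: measurable_funX.
exact: measurable_colvol.
Qed.

Lemma shell_weight_ge0 n d (y : bmx n d) : (0 <= shell_weight y)%E.
Proof. by rewrite lee_fin mulr_ge0 // invr_ge0 exprn_ge0 // normr_ge0. Qed.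

Lemma shell_weight_neq0 n d (y : bmx n d) : shell_weight y != 0%E -> shell y.
Proof.
rewrite /shell_weight indicE; have [|_] := boolP (y \in _); first by rewrite inE.
by rewrite mul0r eqxx.
Qed.

Lemma shell_weight_lmul n d (q : 'M[R]_n) (y : 'M[R]_(n, d)) : q^T *m q = 1%:M ->
  shell_weight (q *m y : bmx n d) = shell_weight (y : bmx n d).
Proof.
move=> qq; rewrite /shell_weight /colvol gram_lmul // !indicE.
congr ((nat_of_bool _)%:R * _)%:E.
by apply/idP/idP; rewrite !inE (@shell_gram _ _ _ _ (q *m y) y) // gram_lmul.
Qed.

Lemma shell_integral_bounds n d m (c : bmx n d -> R) :
  measurable_fun setT c -> (d <= n)%N ->
  (forall y, @shell R n d y -> 2^-1 <= c y <= 2) ->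
  (0 < \int[lebmx R n d]_y (\1_(@shell R n d) y * (c y ^+ m)^-1)%:E < +oo)%E.
Proof.
move=> mc dn hc; have msh := @measurable_shell R n d.
have mi : measurable_fun setT (fun y : bmx n d => (\1_(@shell R n d) y)%:E : \bar R).
  by apply/measurable_EFinP; exact: measurable_indic.
have mci : measurable_fun setT (fun y : bmx n d => (\1_(@shell R n d) y * (c y ^+ m)^-1)%:E).
  apply/measurable_EFinP; apply: measurable_funM; first exact: measurable_indic.
  by apply: (measurableT_comp (@measurable_invr R)); exact: measurable_funX.
have bnd (y : bmx n d) : (2 ^+ m)^-1 * \1_(@shell R n d) y <=
    \1_(@shell R n d) y * (c y ^+ m)^-1 <= 2 ^+ m * \1_(@shell R n d) y.
  rewrite indicE; have [|_] := boolP (y \in _); last by rewrite !(mul0r, mulr0) lexx.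
  rewrite inE => /hc /andP[h1 h2]; rewrite mulr1 mul1r mulr1 -!exprVn.
  have c0 : 0 < c y by apply: lt_le_trans h1; rewrite invr_gt0.
  have h3 : 2^-1 <= (c y)^-1 by rewrite lef_pV2 ?posrE.
  have h4 : (c y)^-1 <= 2 by rewrite -[leRHS]invrK lef_pV2 ?posrE // invr_gt0.
  have h5 : 0 <= (c y)^-1 by rewrite invr_ge0 ltW.
  by apply/andP; split; apply: lerXn2r; rewrite ?nnegrE ?invr_ge0 // ltW.
have iE : (\int[lebmx R n d]_y (\1_(@shell R n d) y)%:E = lebmx R n d (@shell R n d))%E.
  by rewrite integral_indic ?setIT.
apply/andP; split.
  apply: (@lt_le_trans _ _ (\int[lebmx R n d]_y ((2 ^+ m)^-1%:E * (\1_(@shell R n d) y)%:E))%E).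
    rewrite ge0_integralZl // ?lee_fin ?invr_ge0 ?exprn_ge0 //.
    by rewrite iE mule_gt0 ?lebmx_shell_gt0 // lte_fin invr_gt0 exprn_gt0.
  apply: ge0_le_integral => //.
  - by apply: measurable_funeM.
  - move=> y _; rewrite -EFinM lee_fin; by have /andP[] := bnd y.
apply: (@le_lt_trans _ _ (\int[lebmx R n d]_y ((2 ^+ m)%:E * (\1_(@shell R n d) y)%:E))%E).
  apply: ge0_le_integral => //.
  - move=> y _; rewrite lee_fin; have /andP[+ _] := bnd y; apply: le_trans.
    by rewrite mulr_ge0 // invr_ge0 exprn_ge0.
  - exact: measurable_funeM.
  - move=> y _; rewrite -EFinM lee_fin; by have /andP[] := bnd y.
rewrite ge0_integralZl // ?lee_fin ?exprn_ge0 //.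
by rewrite iE lte_mul_pinfty ?lebmx_shell_lty // lee_fin exprn_ge0.
Qed.

Lemma integral_shell_weight n d : (d <= n)%N ->
  (0 < \int[lebmx R n d]_y shell_weight y < +oo)%E.
Proof.
move=> dn; apply: shell_integral_bounds => //; first exact: measurable_colvol.
exact: shell_colvol.
Qed.

End Orth.

(** * Uniqueness of the invariant integral on the Stiefel manifold *)

Section Averaging.
Variable R : realType.
Notation bmx m n := (borelMx R m n).
Local Open Scope ereal_scope.

Lemma mule_cancel (c x y : \bar R) : 0 < c -> c < +oo -> c * x = c * y -> x = y.
Proof.
move=> c0 coo; have cf : c \is a fin_num by rewrite ge0_fin_numE // ltW.
have f0 : fine c != 0%R by rewrite gt_eqF // fine_gt0 // c0.
rewrite -(fineK cf) => /(congr1 (fun t => (fine c)^-1%:E * t)).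
by rewrite !muleA -EFinM mulVf // !mul1e.
Qed.

(** An O(n)-invariant measure [mu] on matrices, an equivariant map [u] into the
    Stiefel manifold and an invariant weight [r]: together they define the
    O(n)-invariant measure [u_* (r mu)] on the Stiefel manifold. This covers both
    an invariant measure already carried by it, with [u] the identity, and Lebesgue
    measure, with [u := orth]. *)
Definition orbit_system n d (mu : {sigma_finite_measure set (bmx n d) -> \bar R})
    (u : bmx n d -> bmx n d) (r : bmx n d -> \bar R) : Prop :=
  [/\ measurable_fun setT u,
      measurable_fun setT r /\ (forall y, 0 <= r y),
      forall q : 'M[R]_n, (q^T *m q = 1%:M)%R ->
        forall f : bmx n d -> \bar R, measurable_fun setT f -> (forall y, 0 <= f y) ->
        \int[mu]_y f (q *m (y : 'M[R]_(n, d))) = \int[mu]_y f y,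
      forall (q : 'M[R]_n) (y : 'M[R]_(n, d)), (q^T *m q = 1%:M)%R ->
        u (q *m y) = q *m (u y : 'M[R]_(n, d)) /\ r (q *m y) = r y &
      forall y, r y != 0 -> gram (u y) = 1%:M%R].

Lemma orbit_system_lmul n d mu u r (q : 'M[R]_n) (f : bmx n d -> \bar R) :
  @orbit_system n d mu u r -> (q^T *m q = 1%:M)%R ->
  measurable_fun setT f -> (forall y, 0 <= f y) ->
  \int[mu]_y (f (q *m (u y : 'M[R]_(n, d))) * r y) = \int[mu]_y (f (u y) * r y).
Proof.
move=> [mu_ [mr r0] inv ur _] qq mf f0.
rewrite -[RHS](inv q qq) //.
- by apply: eq_integral => y _; have [-> ->] := ur q y qq.
- apply: emeasurable_funM => //; exact: (measurableT_comp mf mu_).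
- by move=> y; rewrite mule_ge0.
Qed.

(** Integrate [f (v g^T *m u y) * r y * s g] over both variables. For fixed [g], the
    matrix [v g] is orthogonal and the invariance of [mu] removes it; for fixed
    [y], transitivity writes [u y] as [q *m e] with [q] orthogonal, and the
    invariance of [nu] removes [q]. So the system on n x n matrices plays the part
    of Haar measure on O(n). *)
Lemma orbit_comparison n d mu u r nu v s (e : 'M[R]_(n, d)) (f : bmx n d -> \bar R) :
  @orbit_system n d mu u r -> @orbit_system n n nu v s ->
  gram e = 1%:M%R ->
  measurable_fun setT f -> (forall y, 0 <= f y) ->
  (\int[nu]_g s g) * (\int[mu]_y (f (u y) * r y)) =
  (\int[mu]_y r y) * (\int[nu]_g (f ((v g : 'M[R]_n)^T *m e) * s g)).
Proof.
move=> U V ee mf f0.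
have [mu_ [mr r0] inv ur uS] := U; have [mv [ms s0] inv' vs vS] := V.
have vO g : s g != 0 -> ((v g)^T^T *m (v g)^T = 1%:M)%R.
  by move=> /vS; rewrite trmxK; exact: mulmx1C.
pose Phi (p : bmx n n * bmx n d) :=
  f ((v p.1 : 'M[R]_n)^T *m (u p.2 : 'M[R]_(n, d))) * r p.2 * s p.1.
have mPhi : measurable_fun setT Phi.
  apply: emeasurable_funM; last exact: (measurableT_comp ms measurable_fst).
  apply: emeasurable_funM; last exact: (measurableT_comp mr measurable_snd).
  apply: (measurableT_comp mf); apply: measurable_mulmx.
    apply: measurable_trmx; exact: (measurableT_comp mv measurable_fst).
  exact: (measurableT_comp mu_ measurable_snd).
have Phi0 p : 0 <= Phi p by rewrite !mule_ge0.
have I0 : 0 <= \int[mu]_y (f (u y) * r y).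
  by apply: integral_ge0 => y _; rewrite mule_ge0.
have K0 : 0 <= \int[nu]_g (f ((v g : 'M[R]_n)^T *m e) * s g).
  by apply: integral_ge0 => g _; rewrite mule_ge0.
have mfq (q : 'M[R]_n) : measurable_fun setT (fun y : bmx n d => f (q *m (y : 'M[R]_(n, d)))).
  exact: (measurableT_comp mf (measurable_lmul q)).
transitivity (\int[nu]_g \int[mu]_y Phi (g, y)).
  rewrite muleC -ge0_integralZl //.
  apply: eq_integral => g _; rewrite /Phi/=.
  have [->|sg] := eqVneq (s g) 0.
    by rewrite mule0 integral0_eq // => y _; rewrite mule0.
  rewrite ge0_integralZr //; last 2 first.
  - apply: emeasurable_funM => //; exact: (measurableT_comp (mfq _) mu_).
  - by move=> y _; rewrite mule_ge0.
  by congr (_ * _); rewrite (orbit_system_lmul U (vO g sg)).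
rewrite (fubini_tonelli _ mPhi Phi0) muleC -ge0_integralZl //.
apply: eq_integral => y _; rewrite /Phi/=.
have [->|ry] := eqVneq (r y) 0.
  by rewrite mule0 integral0_eq // => g _; rewrite mule0 mul0e.
have [q [qq uqe]] := Stiefel_transitive ee (uS y ry).
have qqT : (q^T^T *m q^T = 1%:M)%R by rewrite trmxK; exact: mulmx1C.
have mfe : measurable_fun setT (fun g : bmx n n => f ((g : 'M[R]_n)^T *m e)).
  apply: (measurableT_comp mf); apply: measurable_mulmx; last exact: measurable_cst.
  exact: measurable_trmx.
rewrite -(orbit_system_lmul V qqT mfe (fun g => f0 _)).
under [LHS]eq_integral do rewrite -muleA [r y * s _]muleC muleA.
rewrite ge0_integralZr //.
- congr (_ * _); apply: eq_integral => g _; congr (f _ * _).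
  by rewrite uqe trmx_mul trmxK mulmxA.
- apply: emeasurable_funM => //; apply: (measurableT_comp mf).
  apply: measurable_mulmx; last exact: measurable_cst.
  exact: measurable_trmx.
- by move=> g _; rewrite mule_ge0.
Qed.

Lemma orbit_system_leb n d : orbit_system (lebmx R n d)
  (fun y => orth (y : 'M[R]_(n, d))) (@shell_weight R n d).
Proof.
split.
- exact: measurable_orth.
- by split; [exact: measurable_shell_weight|move=> y; exact: shell_weight_ge0].
- move=> q qq f mf f0; rewrite lebmx_lmul //; last exact: (mulmx1_unit qq).2.
  have dq : (`|\det q| = 1)%R.
    have : (\det q ^+ 2 = 1)%R by rewrite expr2 -[X in (X * _)%R]det_tr -det_mulmx qq det1.
    by move=> /eqP; rewrite sqrf_eq1 => /orP[]/eqP ->; rewrite ?normrN normr1.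
  by rewrite dq invr1 expr1n mul1e.
- by move=> q y qq; split; [exact: orth_lmul|exact: shell_weight_lmul].
- by move=> y /shell_weight_neq0 /shell_rank ry; exact: gram_orth.
Qed.

(** Both integrals are proportional to the average of [f] over O(n). *)
Lemma orbit_unique n d mu u r mu' u' r' (f : bmx n d -> \bar R) : (d <= n)%N ->
  @orbit_system n d mu u r -> @orbit_system n d mu' u' r' ->
  measurable_fun setT f -> (forall y, 0 <= f y) ->
  (\int[mu']_y r' y) * (\int[mu]_y (f (u y) * r y)) =
  (\int[mu]_y r y) * (\int[mu']_y (f (u' y) * r' y)).
Proof.
move=> dn U U' mf f0.
have E := orbit_comparison U (orbit_system_leb n n) (Stiefel_pid R dn) mf f0.
have E' := orbit_comparison U' (orbit_system_leb n n) (Stiefel_pid R dn) mf f0.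
have /andP[c0 coo] := integral_shell_weight R (leqnn n).
move: E E' c0 coo; set c := \int[_]_g shell_weight g; set K := \int[_]_g _.
move=> E E' c0 coo.
apply: (mule_cancel c0 coo).
by rewrite muleCA E muleCA [RHS]muleCA E' muleCA.
Qed.

End Averaging.

(** * Averaging over the right action of GL_d *)

Section RightAveraging.
Variables (R : realType) (n d : nat).
Hypotheses (dn : (d <= n)%N) (d0 : (0 < d)%N).
Notation bmx m n := (borelMx R m n).
Local Open Scope ereal_scope.

(** The degree [- n] compensates the Jacobian of [y |-> y *m k], which is
    [`|\det k| ^+ n]. *)
Definition homogeneous (H : bmx n d -> \bar R) :=
  forall (y : 'M[R]_(n, d)) (k : 'M[R]_d), \rank y = d -> k \in unitmx ->
    H (y *m k) = ((`|\det k| ^+ n)^-1)%:E * H y.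

Let shl (m : nat) (y : 'M[R]_(m, d)) : \bar R := (\1_(@shell R m d) (y : bmx m d))%:E.
(** The density of the Haar measure of GL_d. *)
Let w (k : 'M[R]_d) : \bar R := ((`|\det k| ^+ d)^-1)%:E.

Let shl_ge0 m (y : 'M[R]_(m, d)) : 0 <= shl y. Proof. by rewrite lee_fin. Qed.
Let w_ge0 k : 0 <= w k. Proof. by rewrite lee_fin invr_ge0 exprn_ge0. Qed.

Let shl_gram m m' (y : 'M[R]_(m, d)) (y' : 'M[R]_(m', d)) : gram y = gram y' -> shl y = shl y'.
Proof.
move=> yy; rewrite /shl !indicE; congr (nat_of_bool _)%:R%:E.
by apply/idP/idP; rewrite !inE (@shell_gram _ _ _ _ y y').
Qed.

Let shl_rank m (y : 'M[R]_(m, d)) : \rank y <> d -> shl y = 0.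
Proof.
move=> ry; rewrite /shl indicE; case: (boolP (_ \in _)) => //.
by rewrite inE => /shell_rank.
Qed.

Let mis m : measurable_fun setT (fun y : bmx m d => shl y).
Proof. by apply/measurable_EFinP; apply: measurable_indic; exact: measurable_shell. Qed.

Let mw : measurable_fun setT (fun k : bmx d d => w k).
Proof.
apply/measurable_EFinP; apply: (measurableT_comp (@measurable_invr R)).
apply: measurable_funX; apply: (measurableT_comp (@normr_measurable R setT)).
exact: measurable_det.
Qed.

Let wM (b k : 'M[R]_d) : w (b *m k) = w b * w k.
Proof. by rewrite /w det_mulmx normrM exprMn invfM EFinM. Qed.

Let wK (b : 'M[R]_d) : b \in unitmx -> (`|\det b| ^+ d)%:E * w b = 1.
Proof.
move=> ub; rewrite /w -EFinM mulfV // expf_neq0 // normr_eq0.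
by rewrite -unitfE -unitmxE.
Qed.

Let w_nunit k : k \notin unitmx -> w k = 0.
Proof.
by rewrite unitmxE unitfE negbK => /eqP k0; rewrite /w k0 normr0 expr0n gtn_eqF // invr0.
Qed.

Let C : \bar R := \int[lebmx R d d]_k (shl k * w k).

Let C_bounds : 0 < C < +oo.
Proof.
have := @shell_integral_bounds R d d d (fun k : bmx d d => `|\det (k : 'M[R]_d)|%R) _ (leqnn d) _.
have -> : \int[lebmx R d d]_y (\1_(@shell R d d) y * (`|\det (y : 'M[R]_d)| ^+ d)^-1)%:E = C.
  by apply: eq_integral => k _; rewrite EFinM.
apply.
  by apply: (measurableT_comp (@normr_measurable R setT)); exact: measurable_det.
move=> k [_]; rewrite /gram det_mulmx det_tr -expr2 -[(_ ^+ 2)%R]real_normK ?num_real //.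
have := normr_ge0 (\det (k : 'M[R]_d)); move: (`|_|)%R => t t0 h1 h2.
by apply/andP; split; nra.
Qed.

(** Membership in the shell depends only on the Gram matrix, so [y] may be replaced
    by its Cholesky factor, which the invariance of Haar measure absorbs. *)
Let integral_shl_right (y : 'M[R]_(n, d)) : \rank y = d ->
  \int[lebmx R d d]_k (shl (y *m (k : 'M[R]_d)) * w k) = C.
Proof.
move=> ry; pose b := chol (gram y); have ub : b \in unitmx.
  exact/chol_unit/posdef_gram.
have db : (`|\det b| ^+ d != 0)%R by rewrite expf_neq0 // normr_eq0 -unitfE -unitmxE.
have mf : measurable_fun setT (fun k : bmx d d => shl k * w k).
  exact: emeasurable_funM.
have f0 (k : bmx d d) : 0 <= shl k * w k by rewrite mule_ge0.
have := lebmx_lmul ub mf f0; rewrite -/C => E.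
rewrite -[RHS]mul1e -(mulfV db) EFinM -muleA -exprVn -E -ge0_integralZl //; last first.
  exact: (measurableT_comp mf (measurable_lmul b)).
apply: eq_integral => k _; rewrite wM.
transitivity (shl (b *m (k : 'M[R]_d)) * (((`|\det b| ^+ d)%:E * w b) * w k)).
  rewrite wK // mul1e; congr (_ * _).
  by apply: shl_gram; exact: gram_rmul.
by rewrite -[_ * w b * w k]muleA; exact: muleCA.
Qed.

Let Ct : \bar R := \int[lebmx R d d]_k (shl (ginv (k : 'M[R]_d)) * w k).

Let mginv : measurable_fun setT (fun k : bmx d d => ginv (k : 'M[R]_d) : bmx d d).
Proof. exact: measurable_ginv. Qed.

Let integral_shl_left (y : 'M[R]_(n, d)) : \rank y = d ->
  \int[lebmx R d d]_k (shl (y *m ginv (k : 'M[R]_d)) * w k) = Ct.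
Proof.
move=> ry; pose b := chol (gram y); have ub : b \in unitmx.
  exact/chol_unit/posdef_gram.
have db : (`|\det b| ^+ d != 0)%R by rewrite expf_neq0 // normr_eq0 -unitfE -unitmxE.
pose f (k : bmx d d) := shl (y *m ginv (k : 'M[R]_d)) * w k.
have mf : measurable_fun setT f.
  apply: emeasurable_funM => //; apply: (measurableT_comp (@mis n)).
  exact: (measurableT_comp (measurable_lmul y) mginv).
have f0 (k : bmx d d) : 0 <= f k by rewrite mule_ge0.
have := lebmx_rmul ub mf f0 => E.
rewrite -[LHS]mul1e -(mulfV db) EFinM -muleA -exprVn -E -ge0_integralZl //; last first.
  exact: (measurableT_comp mf (measurable_rmul b)).
apply: eq_integral => k _; rewrite /f wM.
have [uk|nuk] := boolP ((k : 'M[R]_d) \in unitmx); last first.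
  by rewrite w_nunit // mul0e !mule0.
rewrite [w k * w b]muleC (muleCA (shl _)) [LHS]muleA wK // mul1e; congr (_ * _).
apply: shl_gram.
rewrite gram_rmul // -/b !ginvE ?unitmx_mul ?uk ?ub //.
have -> : invmx ((k : 'M[R]_d) *m b) = invmx b *m invmx k.
  apply: (can_inj (mulKmx (_ : k *m b \in unitmx))); first by rewrite unitmx_mul uk.
  by rewrite mulmxV ?unitmx_mul ?uk // mulmxA mulmxK // mulmxV.
by rewrite mulKVmx.
Qed.

(** Insert the constant [C], the Haar measure of the [k] with [y *m k] in the shell,
    and apply Fubini. By homogeneity the substitution [y -> y *m k^-1] preserves
    [H y dy]; it moves the condition on [y *m k] to [y], and that on [a *m y] to
    [a *m y *m k^-1], whose Haar measure in [k] is the constant [Ct]. *)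
Lemma homogeneous_average (H : bmx n d -> \bar R) (a : 'M[R]_n) :
  homogeneous H -> measurable_fun setT H -> (forall y, 0 <= H y) ->
  a \in unitmx ->
  (\int[lebmx R n d]_y (H y * shl (a *m (y : 'M[R]_(n, d))))) * C =
  Ct * \int[lebmx R n d]_y (H y * shl (y : 'M[R]_(n, d))).
Proof.
move=> hH mH H0 ua.
have ra (y : 'M[R]_(n, d)) : \rank (a *m y) = \rank y.
  have fa : row_full a by rewrite row_full_unit.
  by rewrite (eqmxMfull y fa).
have misa : measurable_fun setT (fun y : bmx n d => shl (a *m (y : 'M[R]_(n, d)))).
  exact: (measurableT_comp (@mis n) (measurable_lmul a)).
have C0 : 0 <= C by apply: integral_ge0 => k _; rewrite mule_ge0.
have Ct0 : 0 <= Ct by apply: integral_ge0 => k _; rewrite mule_ge0.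
pose Phi (p : bmx n d * bmx d d) :=
  H p.1 * shl (a *m (p.1 : 'M[R]_(n, d))) * (shl ((p.1 : 'M[R]_(n, d)) *m (p.2 : 'M[R]_d)) * w p.2).
pose Psi (p : bmx n d * bmx d d) :=
  H p.1 * shl (p.1 : 'M[R]_(n, d)) * (shl (a *m (p.1 : 'M[R]_(n, d)) *m ginv (p.2 : 'M[R]_d)) * w p.2).
have mH1 : measurable_fun setT (fun p : bmx n d * bmx d d => H p.1).
  exact: (measurableT_comp mH measurable_fst).
have mw2 : measurable_fun setT (fun p : bmx n d * bmx d d => w p.2).
  exact: (measurableT_comp mw measurable_snd).
have mPhi : measurable_fun setT Phi.
  apply: emeasurable_funM; apply: emeasurable_funM => //.
    exact: (measurableT_comp misa measurable_fst).
  apply: (measurableT_comp (@mis n)).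
  exact: measurable_mulmx measurable_fst measurable_snd.
have mPsi : measurable_fun setT Psi.
  apply: emeasurable_funM; apply: emeasurable_funM => //.
    exact: (measurableT_comp (@mis n) measurable_fst).
  apply: (measurableT_comp (@mis n)); apply: measurable_mulmx.
    exact: (measurableT_comp (measurable_lmul a) measurable_fst).
  exact: (measurableT_comp mginv measurable_snd).
have Phi0 p : 0 <= Phi p by rewrite !mule_ge0.
have Psi0 p : 0 <= Psi p by rewrite !mule_ge0.
transitivity (\int[lebmx R n d]_y \int[lebmx R d d]_k Phi (y, k)).
  rewrite muleC -ge0_integralZl //; last 2 first.
  - exact: emeasurable_funM.
  - by move=> y _; rewrite mule_ge0.
  apply: eq_integral => y _; rewrite /Phi/=.
  have [ry|ry] := eqVneq (\rank (y : 'M[R]_(n, d))) d; last first.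
    rewrite [shl (a *m _)]shl_rank ?mule0 ?mul0e; last by rewrite ra; exact/eqP.
    by rewrite integral0_eq // => k _; rewrite mul0e.
  rewrite ge0_integralZl ?mule_ge0 //.
  - by rewrite integral_shl_right // muleC.
  - apply: emeasurable_funM => //; apply: (measurableT_comp (@mis n)).
    exact: measurable_lmul.
  - by move=> k _; rewrite mule_ge0.
rewrite (fubini_tonelli _ mPhi Phi0).
transitivity (\int[lebmx R d d]_k \int[lebmx R n d]_y Psi (y, k)).
  apply: eq_integral => k _.
  have [uk|nuk] := boolP ((k : 'M[R]_d) \in unitmx); last first.
    by rewrite !integral0_eq // => y _; rewrite /Phi /Psi/= w_nunit // !mule0.
  have mPk : measurable_fun setT (fun y : bmx n d => Phi (y, k)).
    exact: (measurableT_comp mPhi (measurable_pair2 k)).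
  have uk' : invmx k \in unitmx by rewrite unitmx_inv.
  have dk : (`|\det (k : 'M[R]_d)| ^+ n != 0)%R by rewrite expf_neq0 // normr_eq0 -unitfE -unitmxE.
  have E := lebmx_rmul uk' mPk (fun y => Phi0 _).
  rewrite -[LHS]mul1e -(mulVf dk) EFinM -muleA.
  move: E; rewrite det_inv normfV invrK => <-.
  rewrite -ge0_integralZl //; last first.
    exact: (measurableT_comp mPk (measurable_rmul _)).
  apply: eq_integral => y _; rewrite /Phi /Psi/= mulmxKV //.
  have [ry|ry] := eqVneq (\rank (y : 'M[R]_(n, d))) d; last first.
    by rewrite [shl y]shl_rank ?mul0e ?mule0 ?mul0e ?mule0 //; exact/eqP.
  rewrite hH // det_inv normfV exprVn invrK ginvE // mulmxA.
  rewrite !muleA -EFinM mulVf // mul1e.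
  by rewrite -!muleA; congr (_ * _); rewrite muleCA.
rewrite -(fubini_tonelli _ mPsi Psi0) -ge0_integralZl //; last 2 first.
- exact: emeasurable_funM.
- by move=> y _; rewrite mule_ge0.
apply: eq_integral => y _; rewrite /Psi/=.
have [ry|ry] := eqVneq (\rank (y : 'M[R]_(n, d))) d; last first.
  rewrite [shl y]shl_rank ?mule0 ?mul0e; last exact/eqP.
  by rewrite integral0_eq // => k _; rewrite mul0e.
rewrite ge0_integralZl ?mule_ge0 //.
- by rewrite integral_shl_left ?ra // muleC.
- apply: emeasurable_funM => //; apply: (measurableT_comp (@mis n)).
  exact: (measurableT_comp (measurable_lmul _) mginv).
- by move=> k _; rewrite mule_ge0.
Qed.

(** The right-hand side of [homogeneous_average] does not depend on [a]; compare
    with [a := 1]. *)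
Lemma homogeneous_shell (H : bmx n d -> \bar R) (a : 'M[R]_n) :
  homogeneous H -> measurable_fun setT H -> (forall y, 0 <= H y) ->
  a \in unitmx ->
  \int[lebmx R n d]_y (H y * (\1_(@shell R n d) (a *m (y : 'M[R]_(n, d)) : bmx n d))%:E) =
  \int[lebmx R n d]_y (H y * (\1_(@shell R n d) y)%:E).
Proof.
move=> hH mH H0 ua; have /andP[C0 Coo] := C_bounds.
apply: (mule_cancel C0 Coo); rewrite muleC (homogeneous_average hH mH H0 ua) muleC.
have := homogeneous_average hH mH H0 (unitmx1 R n).
under eq_integral do rewrite mul1mx.
by rewrite muleC => ->; rewrite muleC.
Qed.

End RightAveraging.

(** * The transformation law of the measure on the Stiefel manifold *)

Section SigmaTransform.
Variables (R : realType) (n d : nat).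
Notation bmx m n := (borelMx R m n).
Local Open Scope ereal_scope.

Lemma StiefelE : @Stiefel R n d = [set y | gram y = 1%:M%R].
Proof.
apply/seteqP; split=> y /=; first by case.
move=> yy; split=> //; rewrite /fullRank/=; apply/eqP.
by rewrite -gram_det_neq0 -/(gram y) yy det1 oner_eq0.
Qed.

Lemma measurable_Stiefel : measurable (@Stiefel R n d : set (bmx n d)).
Proof.
rewrite StiefelE (_ : [set y | _] = \bigcap_(ij in [set: 'I_d * 'I_d])
   ((fun y : bmx n d => (gram y ij.1 ij.2)%R) @^-1` [set (1%:M : 'M[R]_d) ij.1 ij.2])).
  apply: fin_bigcap_measurable => // -[i j] _ /=.
  rewrite -[X in measurable X]setTI.
  exact: (measurable_coord i j (@measurable_gram R n d)).
apply/seteqP; split=> y /=; first by move=> yy [i j] _ /=; rewrite yy.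
by move=> h; apply/matrixP => i j; exact: (h (i, j)).
Qed.

Lemma measurable_fullRank : measurable (@fullRank R n d : set (bmx n d)).
Proof.
rewrite (_ : @fullRank R n d = ~` ((fun y : bmx n d => \det (gram y)) @^-1` [set 0%R])).
  apply: measurableC; rewrite -[X in measurable X]setTI.
  exact: (@measurable_det_gram R n d).
apply/seteqP; split=> y; rewrite /fullRank/=.
  by move=> ry; apply/eqP; rewrite gram_det_neq0; exact/eqP.
by move=> h; apply/eqP; rewrite -gram_det_neq0; exact/eqP.
Qed.

Lemma integral_indicE d0 (T : measurableType d0) (m : {measure set T -> \bar R})
    (D : set T) (f : T -> \bar R) :
  \int[m]_(y in D) f y = \int[m]_y (f y * (\1_D y)%:E).
Proof.
rewrite integral_mkcond; apply: eq_integral => y _.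
by rewrite patchE indicE; case: ifP => _; rewrite ?mule1 ?mule0.
Qed.

Hypotheses (dn : (d <= n)%N) (d0 : (0 < d)%N).
Variable sigma : {finite_measure set (bmx n d) -> \bar R}.
Hypothesis hsigma : Stiefel_measure sigma.

Let iS (y : bmx n d) : \bar R := (\1_(@Stiefel R n d : set (bmx n d)) y)%:E.

Lemma orbit_system_sigma : orbit_system sigma id iS.
Proof.
have [_ _ inv] := hsigma.
split=> //.
- split; last by move=> y; rewrite lee_fin.
  by apply/measurable_EFinP; apply: measurable_indic; exact: measurable_Stiefel.
- move=> q qq f mf f0; have qqT := mulmx1C qq.
  transitivity (\int[pushforward sigma (fun y : bmx n d => q *m (y : 'M[R]_(n, d)) : bmx n d)]_y f y).
    by rewrite ge0_integral_pushforward ?preimage_setT //; exact: measurable_lmul.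
  apply: eq_measure_integral => [|? A mA _]; first exact: measurable_lmul.
  (* The hypothesis on sigma concerns images; the image under q^T is the preimage
     under q. *)
  rewrite /pushforward/=.
  rewrite -(inv q^T A) ?trmxK //; congr (sigma _).
  apply/seteqP; split=> [y /= Ay|_ [y Ay <-]] /=.
    by exists (q *m (y : 'M[R]_(n, d))) => //; rewrite mulmxA qq mul1mx.
  by rewrite mulmxA qqT mul1mx.
- move=> q y qq; split=> //; rewrite /iS !indicE; congr (nat_of_bool _)%:R%:E.
  by apply/idP/idP; rewrite !inE StiefelE /= gram_lmul.
- move=> y; rewrite /iS indicE; case: (boolP (_ \in _)) => [|_]; last by rewrite eqxx.
  by rewrite inE StiefelE.
Qed.

Lemma sigma_total : \int[sigma]_y iS y = sigma setT.
Proof.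
have [s0 _ _] := hsigma; have mS := measurable_Stiefel.
rewrite integral_indic // setIT -(setUv (@Stiefel R n d : set (bmx n d))).
have s0' : sigma (~` (@Stiefel R n d : set (bmx n d))) = 0 := s0.
by rewrite measureU //; [rewrite [X in _ + X]s0' adde0|exact: measurableC|exact: setICr].
Qed.

(** Uniqueness of the invariant integral, applied to [sigma] and to Lebesgue measure
    on the shell. *)
Lemma integral_shell (H : bmx n d -> \bar R) : homogeneous H ->
  measurable_fun setT H -> (forall y, 0 <= H y) ->
  (\int[lebmx R n d]_y shell_weight y) * (\int[sigma]_(y in (@Stiefel R n d : set (bmx n d))) H y) =
  sigma setT * \int[lebmx R n d]_y (H y * (\1_(@shell R n d) y)%:E).
Proof.
move=> hH mH H0; rewrite (integral_indicE _ (@Stiefel R n d : set (bmx n d))) -sigma_total.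
rewrite [LHS](orbit_unique dn orbit_system_sigma (orbit_system_leb R n d) mH H0).
congr (_ * _); apply: eq_integral => y _.
rewrite /shell_weight indicE; case: (boolP (_ \in _)) => [|_]; last by rewrite mul0r !mule0.
rewrite inE => sy; rewrite mul1r mule1; have ry := shell_rank sy.
have ub : chol (gram (y : 'M[R]_(n, d))) \in unitmx by exact/chol_unit/posdef_gram.
have db : (colvol (y : 'M[R]_(n, d)) ^+ n != 0)%R.
  by rewrite expf_neq0 // normr_eq0 -unitfE -unitmxE.
rewrite orthE // hH ?unitmx_inv // det_inv normfV exprVn invrK muleC muleA.
by rewrite -EFinM mulVf // mul1e.
Qed.

(** By [integral_shell] the integrals over [sigma] become Lebesgue integrals over the
    shell, where the substitution [y -> a *m y] gives the Jacobian and moves the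
    shell; [homogeneous_shell] moves it back. *)
Lemma Stiefel_transform (H : bmx n d -> \bar R) (a : 'M[R]_n) : homogeneous H ->
  measurable_fun setT H -> (forall y, 0 <= H y) -> a \in unitmx ->
  \int[sigma]_(y in (@Stiefel R n d : set (bmx n d))) H (invmx a *m (y : 'M[R]_(n, d))) =
  (`|\det a| ^+ d)%:E * \int[sigma]_(y in (@Stiefel R n d : set (bmx n d))) H y.
Proof.
move=> hH mH H0 ua; have /andP[r0 roo] := integral_shell_weight R dn.
have uai : invmx a \in unitmx by rewrite unitmx_inv.
pose Ha (y : bmx n d) := H (invmx a *m (y : 'M[R]_(n, d))).
have mHa : measurable_fun setT Ha by exact: (measurableT_comp mH (measurable_lmul _)).
have hHa : homogeneous Ha.
  move=> y k ry uk; rewrite /Ha mulmxA hH //.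
  have fa : row_full (invmx a) by rewrite row_full_unit.
  by rewrite (eqmxMfull y fa).
apply: (mule_cancel r0 roo).
rewrite [LHS](integral_shell hHa mHa (fun y => H0 _)).
rewrite muleCA (integral_shell hH mH H0) [RHS]muleCA; congr (_ * _).
rewrite -(homogeneous_shell d0 hH mH H0 ua).
pose g (y : bmx n d) := H y * (\1_(@shell R n d) (a *m (y : 'M[R]_(n, d)) : bmx n d))%:E.
have mg : measurable_fun setT g.
  apply: emeasurable_funM => //.
  apply: (measurableT_comp (f := fun y : bmx n d => (\1_(@shell R n d) y)%:E)); last exact: measurable_lmul.
  by apply/measurable_EFinP; apply: measurable_indic; exact: measurable_shell.
have g0 y : 0 <= g y by rewrite mule_ge0 // lee_fin.
have := lebmx_lmul uai mg g0; rewrite det_inv normfV invrK => <-.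
by apply: eq_integral => y _; rewrite /g mulKVmx.
Qed.

Lemma Stiefel_transform_real (h : bmx n d -> R) (a : 'M[R]_n) :
  (forall (y : 'M[R]_(n, d)) (k : 'M[R]_d), \rank y = d -> k \in unitmx ->
     h (y *m k) = (`|\det k| ^+ n)^-1 * h y)%R ->
  measurable_fun setT h -> a \in unitmx ->
  sigma.-integrable (@Stiefel R n d : set (bmx n d)) (EFin \o h) ->
  \int[sigma]_(y in (@Stiefel R n d : set (bmx n d))) (h (invmx a *m (y : 'M[R]_(n, d))))%:E =
  (`|\det a| ^+ d)%:E * \int[sigma]_(y in (@Stiefel R n d : set (bmx n d))) (h y)%:E.
Proof.
move=> hh mh ua ih; have mS := measurable_Stiefel.
pose Hp (y : bmx n d) := (Num.max (h y) 0)%:E.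
pose Hn (y : bmx n d) := (Num.max (- h y) 0)%:E.
have mHp : measurable_fun setT Hp.
  by apply/measurable_EFinP; apply: measurable_maxr => //; exact: measurable_cst.
have mHn : measurable_fun setT Hn.
  apply/measurable_EFinP; apply: measurable_maxr; last exact: measurable_cst.
  exact: measurableT_comp.
have hHp : homogeneous Hp.
  move=> y k ry uk; rewrite /Hp -EFinM hh //; congr _%:E.
  by rewrite maxr_pMr ?invr_ge0 ?exprn_ge0 // mulr0.
have hHn : homogeneous Hn.
  move=> y k ry uk; rewrite /Hn -EFinM hh //; congr _%:E.
  by rewrite maxr_pMr ?invr_ge0 ?exprn_ge0 // mulr0 mulrN.
have Hp0 y : 0 <= Hp y by rewrite lee_fin le_max lexx orbT.
have Hn0 y : 0 <= Hn y by rewrite lee_fin le_max lexx orbT.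
have split_int (m : {measure set (bmx n d) -> \bar R}) (g : bmx n d -> bmx n d) :
    \int[m]_(y in (@Stiefel R n d : set (bmx n d))) (h (g y))%:E =
    \int[m]_(y in (@Stiefel R n d : set (bmx n d))) Hp (g y) -
    \int[m]_(y in (@Stiefel R n d : set (bmx n d))) Hn (g y).
  rewrite integralE; congr (_ - _); apply: eq_integral => y _.
    by rewrite funeposE /Hp EFin_max.
  by rewrite funenegE /Hn EFin_max.
rewrite (split_int _ (fun y => invmx a *m (y : 'M[R]_(n, d)))).
rewrite [X in _ = _ * X](split_int _ id).
rewrite (Stiefel_transform hHp mHp Hp0 ua) (Stiefel_transform hHn mHn Hn0 ua).
have fp : \int[sigma]_(y in (@Stiefel R n d : set (bmx n d))) Hp y \is a fin_num.
  have := integrable_pos_fin_num mS ih; congr (_ \is a fin_num).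
  by apply: eq_integral => y _; rewrite funeposE /Hp /= -EFin_max.
have fn : \int[sigma]_(y in (@Stiefel R n d : set (bmx n d))) Hn y \is a fin_num.
  have := integrable_neg_fin_num mS ih; congr (_ \is a fin_num).
  by apply: eq_integral => y _; rewrite funenegE /Hn EFin_max.
by rewrite [RHS]muleBr // fin_num_adde_defl // fin_numN.
Qed.

End SigmaTransform.

(** * Lebesgue measure on symmetric matrices *)

Section TupleMeasure.
Variable R : realType.
Local Open Scope ereal_scope.
Notation tup N := (N.-tuple (measurableTypeR R)).

Lemma lebesgue_tuple_exists N : exists m : {sigma_finite_measure set (tup N) -> \bar R},
  (m : set (tup N) -> \bar R) = @lebesgue_tuple R N.
Proof.
elim: N => [|N [m mE]].
  by exists (\d_ ([tuple] : tup 0)).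
rewrite /= -mE; have [pm pmE] := product_sigma_finite (@lebesgue_measure R) m.
rewrite -pmE.
apply: (@pushforward_sigma_finite _ _ _ _ _ pm _
  (fun t : tup N.+1 => (thead t, [tuple of behead t]))).
- exact: (measurable_cons measurable_fst measurable_snd).
- by apply: measurable_fun_pair; [exact: measurable_tnth|exact: measurable_behead].
- by move=> [x t] /=; congr pair; apply/val_inj.
Qed.

Definition leb_tuple N := projT1 (cid (lebesgue_tuple_exists N)).

Lemma leb_tupleE N : (leb_tuple N : set (tup N) -> \bar R) = @lebesgue_tuple R N.
Proof. by rewrite /leb_tuple; case: cid. Qed.

(** Integrands are functions of the list of coordinates, so that lists can be split
    and concatenated without casts between tuple types. *)
Definition tuple_measurable (phi : seq R -> \bar R) :=
  (forall N, measurable_fun setT (fun t : tup N => phi t)) /\ (forall s, 0 <= phi s).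

Definition int_tuple N (phi : seq R -> \bar R) := \int[leb_tuple N]_t phi t.

Lemma int_tuple0 phi : tuple_measurable phi -> int_tuple 0 phi = phi [::].
Proof.
move=> [mphi phi0]; rewrite /int_tuple leb_tupleE /=.
by rewrite integral_dirac ?diracT ?mul1e //; exact: (mphi 0%N).
Qed.

Lemma int_tupleS N phi : tuple_measurable phi ->
  int_tuple N.+1 phi = \int[lebesgue_measure]_(x in [set: R]) int_tuple N (fun s => phi (x :: s)).
Proof.
move=> [mphi phi0]; rewrite /int_tuple leb_tupleE /= -leb_tupleE.
have mcons := measurable_cons (@measurable_fst _ _ (measurableTypeR R) (tup N)) measurable_snd.
rewrite ge0_integral_pushforward //; last exact: mphi.
rewrite preimage_setT fubini_tonelli1 //.
exact: (@measurableT_comp _ _ _ _ _ _ (fun t : tup N.+1 => phi t) _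
   (fun p : measurableTypeR R * tup N => [the N.+1.-tuple _ of p.1 :: p.2]) (mphi N.+1)).
by move=> p; exact: phi0.
Qed.

Lemma tuple_measurable_cons x phi : tuple_measurable phi -> tuple_measurable (fun s => phi (x :: s)).
Proof.
move=> [mphi phi0]; split=> // N.
apply: (@measurableT_comp _ _ _ _ _ _ (fun t : tup N.+1 => phi t) _
   (fun t : tup N => [the N.+1.-tuple (measurableTypeR R) of x :: t]) (mphi N.+1)).
by apply: measurable_cons => //; exact: measurable_cst.
Qed.

Lemma measurable_int_tuple d0 (T : measurableType d0) N (phi : T -> seq R -> \bar R) :
  measurable_fun setT (fun p : T * tup N => phi p.1 p.2) ->
  (forall t s, 0 <= phi t s) ->
  measurable_fun setT (fun t => int_tuple N (phi t)).
Proof.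
by move=> mphi phi0; exact: (measurable_fun_fubini_tonelli_F _ mphi).
Qed.

Lemma measurable_nth d0 (T : measurableType d0) N (f : T -> tup N) i :
  measurable_fun setT f -> measurable_fun setT (fun t => nth 0%R (f t : seq R) i).
Proof.
move=> mf; have [iN|Ni] := ltnP i N.
  rewrite (_ : (fun t => _) = fun t => tnth (f t) (Ordinal iN)).
    exact: (measurableT_comp (measurable_tnth (Ordinal iN)) mf).
  by apply/funext => t; rewrite (tnth_nth 0%R).
rewrite (_ : (fun t => _) = cst 0%R); first exact: measurable_cst.
by apply/funext => t; rewrite nth_default // size_tuple.
Qed.

Lemma measurable_cat_tuple N M :
  measurable_fun setT (fun p : tup N * tup M => [tuple of p.1 ++ p.2] : tup (N + M)).
Proof.
apply/measurable_fun_tnthP => i.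
have h : measurable_fun setT (fun p : tup N * tup M =>
    if (i < N)%N then nth 0%R (p.1 : seq R) i else nth 0%R (p.2 : seq R) (i - N)).
  by case: (i < N)%N; apply: measurable_nth.
move: h; congr (measurable_fun _ _); apply/funext => p /=.
by rewrite (tnth_nth 0%R) /= nth_cat size_tuple.
Qed.

Lemma measurable_cat_integrand N M phi : tuple_measurable phi ->
  measurable_fun setT (fun p : tup N * tup M => phi (p.1 ++ p.2)).
Proof.
move=> [mphi _].
exact: (@measurableT_comp _ _ _ _ _ _ (fun t : tup (N + M) => phi t) _
   (fun p : tup N * tup M => [tuple of p.1 ++ p.2] : tup (N + M)) (mphi (N + M)%N)
   (@measurable_cat_tuple N M)).
Qed.

Lemma tuple_measurable_int M phi : tuple_measurable phi -> tuple_measurable (fun s => int_tuple M (fun s' => phi (s ++ s'))).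
Proof.
move=> mp; have [mphi phi0] := mp; split=> [N|s]; last exact: integral_ge0.
apply: (measurable_int_tuple (phi := fun (t : tup N) s' => phi (t ++ s'))) => //.
exact: measurable_cat_integrand.
Qed.

Lemma int_tuple_cat N M phi : tuple_measurable phi ->
  int_tuple (N + M) phi = int_tuple N (fun s => int_tuple M (fun s' => phi (s ++ s'))).
Proof.
elim: N phi => [|N IH] phi mphi.
  by rewrite int_tuple0 //; exact: tuple_measurable_int.
rewrite addSn int_tupleS // int_tupleS; last exact: tuple_measurable_int.
by apply: eq_integral => x _; rewrite IH //; exact: tuple_measurable_cons.
Qed.

Lemma int_tuple_le N phi psi : tuple_measurable phi -> tuple_measurable psi ->
  (forall s, size s = N -> phi s <= psi s) -> int_tuple N phi <= int_tuple N psi.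
Proof.
move=> [mphi phi0] [mpsi psi0] h.
apply: ge0_le_integral => //; [exact: mphi|exact: mpsi|].
by move=> t _; apply: h; rewrite size_tuple.
Qed.

Lemma eq_int_tuple N phi psi : (forall s, size s = N -> phi s = psi s) -> int_tuple N phi = int_tuple N psi.
Proof. by move=> h; apply: eq_integral => t _; rewrite h // size_tuple. Qed.

Definition colv n (s : seq R) : 'M[R]_(n, 1) := (\col_(i < n) nth 0 s i)%R.

Lemma measurable_colv n N : measurable_fun setT (fun t : tup N => colv n t : borelMx R n 1).
Proof.
apply: measurable_mx => i j; under eq_fun do rewrite mxE.
exact: measurable_nth.
Qed.

Lemma tuple_measurable_colv n (f : borelMx R n 1 -> \bar R) : measurable_fun setT f ->
  (forall y, 0 <= f y) -> tuple_measurable (fun s => f (colv n s)).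
Proof.
by move=> mf f0; split=> // N; exact: (measurableT_comp mf (@measurable_colv n N)).
Qed.

Lemma integral_lebcol n (f : borelMx R n 1 -> \bar R) : measurable_fun setT f ->
  (forall y, 0 <= f y) -> \int[lebcol R n]_y f y = int_tuple n (fun s => f (colv n s)).
Proof.
elim: n f => [|n IH] f mf f0.
  rewrite int_tuple0; last exact: tuple_measurable_colv.
  by rewrite integral_rows_measure0 //; congr f; rewrite [RHS]flatmx0.
rewrite integral_rows_measureS // integral_leb1; last 2 first.
- pose g (p : borelMx R 1 1 * borelMx R n 1) := f (col_mx (p.1 : 'M[R]_(1, 1)) (p.2 : 'M[R]_(n, 1))).
  have mg : measurable_fun setT g.
    exact: (measurableT_comp mf (measurable_cmx measurable_fst measurable_snd)).
  exact: (measurable_fun_fubini_tonelli_F g mg (fun p => f0 _)).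
- by move=> r; apply: integral_ge0.
rewrite int_tupleS; last exact: tuple_measurable_colv.
apply: eq_integral => x _; rewrite IH //; last exact: measurable_col_mxr.
apply: eq_int_tuple => s _; congr f; apply/matrixP => i j; rewrite [RHS]mxE.
case: (split_ordP (i : 'I_(1 + n))) => k ->; rewrite ?ord1.
  by rewrite (col_mxEu (x%:M : 'M[R]_1)) mxE eqxx.
by rewrite (col_mxEd (x%:M : 'M[R]_1)) mxE.
Qed.

(** The matrix of [sym_of_tuple] with coordinates read from a list of any
    length. *)
Definition symmx n (s : seq R) : 'M[R]_n :=
  (\matrix_(i < n, j < n) nth 0 s ('C((maxn i j).+1, 2) + minn i j))%R.

Lemma measurable_symmx n N : measurable_fun setT (fun t : tup N => symmx n t : borelMx R n n).
Proof.
apply: measurable_mx => i j; under eq_fun do rewrite mxE.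
exact: measurable_nth.
Qed.

Lemma symmx_sym n s : (symmx n s)^T%R = symmx n s.
Proof. by apply/matrixP => i j; rewrite !mxE maxnC minnC. Qed.

Lemma tuple_measurable_symmx n (f : borelMx R n n -> \bar R) : measurable_fun setT f ->
  (forall y, 0 <= f y) -> tuple_measurable (fun s => f (symmx n s)).
Proof.
by move=> mf f0; split=> // N; exact: (measurableT_comp mf (@measurable_symmx n N)).
Qed.

Lemma lebesgue_Sym_exists n : exists m : {measure set (borelMx R n n) -> \bar R},
  (m : set (borelMx R n n) -> \bar R) = @lebesgue_Sym R n /\
  forall f : borelMx R n n -> \bar R, measurable_fun setT f -> (forall z, 0 <= f z) ->
  \int[m]_z f z = int_tuple 'C(n.+1, 2) (fun s => f (symmx n s)).
Proof.
have ms := @measurable_symmx n 'C(n.+1, 2).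
pose m : {measure set (borelMx R n n) -> \bar R} :=
  measure_function_pushforward__canonical__measure_function_Measure (leb_tuple 'C(n.+1, 2)) ms.
exists m; split; first by rewrite /m /= leb_tupleE.
by move=> f mf f0; rewrite ge0_integral_pushforward // preimage_setT.
Qed.

Lemma triangle_lt n m i : (m < n)%N -> (i <= m)%N -> ('C(m.+1, 2) + i < 'C(n.+1, 2))%N.
Proof.
move=> mn im; apply: (@leq_trans 'C(m.+2, 2)).
  by rewrite [X in (_ < X)%N]binS bin1 ltn_add2l ltnS.
exact: leq_bin2l.
Qed.

(** The lower triangle is read row by row, so the coordinates that follow a full
    triangle form the last row. *)
Lemma symmx_cat n t u : size t = 'C(n.+1, 2) ->
  symmx (n + 1) (t ++ u) =
  block_mx (symmx n t) (colv n u) (colv n u)^T%R (nth 0 u n)%:M%R.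
Proof.
move=> st; have nthu l : nth 0%R (t ++ u) ('C(n.+1, 2) + l) = nth 0%R u l.
  by rewrite nth_cat st ltnNge leq_addr /= addKn.
apply/matrixP => i j; rewrite [LHS]mxE.
case: (split_ordP i) => k ->; case: (split_ordP j) => l ->.
- rewrite block_mxEul mxE /= nth_cat st ifT //.
  apply: triangle_lt; first by rewrite gtn_max !ltn_ord.
  exact: leq_trans (geq_minl _ _) (leq_maxl _ _).
- rewrite block_mxEur mxE ord1 /= addn0.
  have kn : (k <= n)%N by exact: ltnW.
  by rewrite (maxn_idPr kn) (minn_idPl kn) nthu.
- rewrite block_mxEdl !mxE ord1 /= addn0.
  have ln : (l <= n)%N by exact: ltnW.
  by rewrite (maxn_idPl ln) (minn_idPr ln) nthu.
by rewrite block_mxEdr mxE !ord1 /= addn0 maxnn minnn nthu.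
Qed.

Lemma tuple_measurable_cat t phi : tuple_measurable phi -> tuple_measurable (fun s => phi (t ++ s)).
Proof.
by elim: t phi => [//|x t IH] phi mp /=; exact: (IH (fun s => phi (x :: s)) (tuple_measurable_cons x mp)).
Qed.

Lemma integral_lebrow_tuple n (f : borelMx R 1 n -> \bar R) : measurable_fun setT f ->
  (forall y, 0 <= f y) -> \int[lebrow R n]_y f y = int_tuple n (fun s => f (colv n s)^T%R).
Proof.
move=> mf f0; rewrite integral_lebrow // integral_lebcol //.
exact: (measurableT_comp mf (@measurable_tr R n 1)).
Qed.

Lemma measurable_bordered d0 (T : measurableType d0) n (w : 'M[R]_n) (g : T -> borelMx R 1 n)
    (h : T -> R) : measurable_fun setT g -> measurable_fun setT h ->
  measurable_fun setT (fun t => block_mx w (g t)^T (g t) (h t)%:M : borelMx R (n + 1) (n + 1)).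
Proof.
move=> mg mh; apply: measurable_col_mx; apply: measurable_row_mx => //.
- exact: measurable_trmx.
- apply: measurable_mx => i j; rewrite !ord1.
  by under eq_fun do rewrite mxE eqxx mulr1n.
Qed.

Lemma binomial_triangle n : 'C((n + 1).+1, 2) = ('C(n.+1, 2) + (n + 1))%N.
Proof. by rewrite addn1 binS bin1. Qed.

Lemma int_tuple_last_row n (f : borelMx R (n + 1) (n + 1) -> \bar R) t :
  measurable_fun setT f -> (forall z, 0 <= f z) -> size t = 'C(n.+1, 2) ->
  int_tuple (n + 1) (fun s => f (symmx (n + 1) (t ++ s))) =
  \int[lebrow R n]_x \int[lebesgue_measure]_(s in [set: R])
     f (block_mx (symmx n t) (x : 'M[R]_(1, n))^T x s%:M)%R.
Proof.
move=> mf f0 st; have mp := tuple_measurable_symmx mf f0.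
pose w := symmx n t.
pose G (x : borelMx R 1 n) := \int[lebesgue_measure]_(s in [set: R])
     f (block_mx w (x : 'M[R]_(1, n))^T x s%:M)%R.
have mG : measurable_fun setT G.
  pose g (p : borelMx R 1 n * measurableTypeR R) :=
    f (block_mx w (p.1 : 'M[R]_(1, n))^T p.1 p.2%:M)%R.
  have mg : measurable_fun setT g.
    exact: (measurableT_comp mf (measurable_bordered w measurable_fst measurable_snd)).
  exact: (measurable_fun_fubini_tonelli_F g mg (fun p => f0 _)).
rewrite -/w integral_lebrow_tuple //; last by move=> x; exact: integral_ge0.
rewrite int_tuple_cat; last exact: (tuple_measurable_cat t mp).
apply: eq_int_tuple => u su; rewrite /G.
rewrite int_tupleS; last exact: (tuple_measurable_cat u (tuple_measurable_cat t mp)).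
apply: eq_integral => s _.
rewrite int_tuple0; last exact: (tuple_measurable_cons s (tuple_measurable_cat u (tuple_measurable_cat t mp))).
rewrite symmx_cat // trmxK; congr f; congr block_mx.
- by apply/matrixP => i j; rewrite !mxE nth_cat su ltn_ord.
- by apply/matrixP => i j; rewrite !mxE nth_cat su ltn_ord.
- by rewrite nth_cat su ltnn subnn.
Qed.

End TupleMeasure.

(** * The determinant of 1 + z^2 for a bordered matrix *)

Section Bordered.

(** A square root [J] of [-1] factors [1 + z^2] as [(1 + J z) (1 - J z)]. The
    determinant of one factor is a Schur complement, in which the inverse of
    [1 + J w] is [(1 - J w) (1 + w^2)^-1]. *)
Lemma det_1Dimag_bordered (F : fieldType) n (J : F) (w : 'M[F]_n) (x : 'rV[F]_n) (t : F)
    (M := 1%:M + w *m w) :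
  J * J = -1 -> M \in unitmx ->
  \det (1%:M + J *: block_mx w x^T x t%:M : 'M[F]_(n + 1)) =
  \det (1%:M + J *: w) *
  (1 + (x *m invmx M *m x^T) ord0 ord0 + J * (t - (x *m w *m invmx M *m x^T) ord0 ord0)).
Proof.
move=> JJ uM; pose P := 1%:M + J *: w; pose P' := (1%:M - J *: w) *m invmx M.
have EM : (1%:M + J *: w) *m (1%:M - J *: w) = M.
  rewrite mulmxDl mul1mx mulmxBr mulmx1 -scalemxAl -scalemxAr scalerA JJ.
  by rewrite scaleN1r opprK addrA subrK.
have PP' : P *m P' = 1%:M by rewrite /P /P' mulmxA EM mulmxV.
(* The column operation that clears the upper right block. *)
pose V : 'M[F]_(n + 1) := block_mx 1%:M (- J *: (P' *m x^T)) 0 1%:M.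
have dV : \det V = 1 by rewrite det_ublock !det1 mulr1.
have -> : 1%:M + J *: block_mx w x^T x t%:M =
    block_mx P (J *: x^T) (J *: x) (1 + J * t)%:M :> 'M[F]_(n + 1).
  rewrite scalar_mx_block scale_block_mx add_block_mx !add0r -/P.
  by rewrite scale_scalar_mx raddfD.
transitivity (\det (block_mx P (J *: x^T) (J *: x) (1 + J * t)%:M : 'M[F]_(n + 1)) * \det V).
  by rewrite dV mulr1.
rewrite -det_mulmx mulmx_block !mulmx1 !mulmx0 !addr0.
rewrite -scalemxAr mulmxA PP' mul1mx scaleNr addNr det_lblock; congr (_ * _).
have -> : J *: x *m (- J *: (P' *m x^T)) =
    x *m invmx M *m x^T - J *: (x *m w *m invmx M *m x^T).
  rewrite -scalemxAl -scalemxAr scalerA mulrN JJ opprK scale1r /P'.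
  by rewrite !mulmxA mulmxBr mulmx1 !mulmxBl -scalemxAr -!scalemxAl.
by rewrite det_mx11 !mxE mulr1n; ring.
Qed.

(** Over the complex numbers, the product of [det_1Dimag_bordered] for [J = i] and
    [J = - i]. *)
Lemma det_1Dsqr_bordered (R : realType) n (w : 'M[R]_n) (x : 'rV[R]_n) (t : R)
    (M := 1%:M + w *m w) (Z := block_mx w x^T x t%:M : 'M[R]_(n + 1)) :
  w^T = w ->
  \det (1%:M + Z *m Z) = \det M *
  ((1 + (x *m invmx M *m x^T) ord0 ord0) ^+ 2 +
   (t - (x *m w *m invmx M *m x^T) ord0 ord0) ^+ 2).
Proof.
move=> sw; pose f : {rmorphism R -> R[i]} := real_complex R.
have uM : M \in unitmx by apply: posdef_unit; exact: posdef_1Dsqr.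
pose wc := map_mx f w; pose xc := map_mx f x.
have I2 : ('i : R[i])%C * 'i%C = -1 by rewrite -expr2 sqr_i.
have MC : 1%:M + wc *m wc = map_mx f M by rewrite map_mxD map_mx1 map_mxM.
have uMC : 1%:M + wc *m wc \in unitmx by rewrite MC map_unitmx.
have fact k (z : 'M[R]_k) : f (\det (1%:M + z *m z)) =
    \det (1%:M + 'i%C *: map_mx f z) * \det (1%:M + (- 'i%C) *: map_mx f z).
  rewrite -det_map_mx -det_mulmx map_mxD map_mx1 map_mxM; congr (\det _).
  rewrite mulmxDl mul1mx mulmxDr mulmx1 -scalemxAl -scalemxAr scalerA mulrN I2 opprK.
  by rewrite scale1r scaleNr addrA subrK.
apply: (fmorph_inj f); rewrite rmorphM /= fact [in RHS]fact.
have -> : map_mx f Z = block_mx wc xc^T xc (f t)%:M.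
  by rewrite map_block_mx -matrix.map_trmx map_scalar_mx.
rewrite (det_1Dimag_bordered xc (f t) I2 uMC).
rewrite (@det_1Dimag_bordered _ _ (- 'i%C) wc xc (f t)) ?mulrNN //.
rewrite MC -map_invmx matrix.map_trmx -!map_mxM ![map_mx f _ _ _]mxE.
rewrite rmorphD !rmorphXn rmorphB rmorphD [f 1]rmorph1.
move: (f _) (f t) (f _) (\det _) (\det _) => r s q a b.
transitivity (a * b * ((1 + q) ^+ 2 - ('i%C * 'i%C) * (s - r) ^+ 2)); first by ring.
by rewrite I2; ring.
Qed.

End Bordered.

(** * Integrability of powers of det(1 + z^2) *)

Section SymFinite.
Variable R : realType.
Local Open Scope ereal_scope.
Notation bmx m n := (borelMx R m n).

Let c1 : R := fine (\int[lebesgue_measure]_(x in [set: R]) ((1 + x ^+ 2)^-1)%:E).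

Let c1E : \int[lebesgue_measure]_(x in [set: R]) ((1 + x ^+ 2)^-1)%:E = c1%:E.
Proof.
rewrite fineK // ge0_fin_numE ?integral_oneDsqrV_lty //.
by apply: integral_ge0 => x _; rewrite lee_fin invr_ge0 addr_ge0 // sqr_ge0.
Qed.

Let c1_ge0 : (0 <= c1)%R.
Proof.
rewrite -lee_fin -c1E; apply: integral_ge0 => x _.
by rewrite lee_fin invr_ge0 addr_ge0 // sqr_ge0.
Qed.

Let measurable_oneDsqrV : measurable_fun [set: R] (fun x : R => (1 + x ^+ 2)^-1)%R.
Proof.
apply: (measurableT_comp (@measurable_invr R)); apply: measurable_funD => //.
Qed.

(** The product of one-dimensional densities dominates the negative power of
    [1 + sqnorm x] in [integral_sqnorm], and its integral factorises. *)
Let pr n (y : 'M[R]_(n, 1)) : R := (\prod_i (1 + y i ord0 ^+ 2)^-1)%R.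

Let pr_ge0 n y : (0 <= @pr n y)%R.
Proof. by apply: prodr_ge0 => i _; rewrite invr_ge0 addr_ge0 // sqr_ge0. Qed.

Let measurable_pr n : measurable_fun setT (fun y : bmx n 1 => (pr y)%:E).
Proof.
apply/measurable_EFinP; apply: measurable_prod => i _.
exact: (measurableT_comp measurable_oneDsqrV (measurable_entry i ord0)).
Qed.

Let integral_pr n : \int[lebcol R n]_y (pr y)%:E = (c1 ^+ n)%:E.
Proof.
elim: n => [|n IH].
  by rewrite integral_rows_measure0 // /pr big_ord0 expr0.
rewrite integral_rows_measureS //; last by move=> y; rewrite lee_fin.
transitivity (\int[leb1 R]_r (((1 + (r : 'M[R]_1) ord0 ord0 ^+ 2)^-1)%:E * (c1 ^+ n)%:E)).
  apply: eq_integral => r _; rewrite -IH -ge0_integralZl //; last 2 first.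
  - by move=> y _; rewrite lee_fin.
  - by rewrite lee_fin invr_ge0 addr_ge0 // sqr_ge0.
  apply: eq_integral => y _; rewrite -EFinM; congr _%:E.
  rewrite /pr big_ord_recl; congr (_ * _)%R.
    by rewrite -(col_mxEu (r : 'M[R]_1) (y : 'M[R]_(n, 1))); congr (1 + (_ _ _) ^+ 2)^-1%R; exact/val_inj.
  apply: eq_bigr => i _.
  by rewrite -(col_mxEd (r : 'M[R]_1) (y : 'M[R]_(n, 1))); congr (1 + (_ _ _) ^+ 2)^-1%R; exact/val_inj.
have m1 : measurable_fun setT (fun r : bmx 1 1 => ((1 + (r : 'M[R]_1) ord0 ord0 ^+ 2)^-1)%:E : \bar R).
  by apply/measurable_EFinP; exact: (measurableT_comp measurable_oneDsqrV (measurable_entry ord0 ord0)).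
rewrite ge0_integralZr // ?lee_fin ?exprn_ge0 //.
- rewrite integral_leb1 //; last first.
    by move=> y; rewrite lee_fin invr_ge0 addr_ge0 // sqr_ge0.
  under eq_integral do rewrite mxE eqxx mulr1n.
  by rewrite c1E -EFinM exprS.
- by move=> y _; rewrite lee_fin invr_ge0 addr_ge0 // sqr_ge0.
Qed.

Let integral_sqnorm n (m : nat) : (n <= m)%N ->
  \int[lebrow R n]_x (((1 + sqnorm (x : 'M[R]_(1, n))) ^+ m)^-1)%:E <= (c1 ^+ n)%:E.
Proof.
move=> nm; have ms : measurable_fun setT (fun x : bmx 1 n => sqnorm (x : 'M[R]_(1, n))).
  apply: (measurable_coord ord0 ord0); apply: measurable_mulmx => //.
  exact: measurable_trmx.
rewrite -integral_pr integral_lebrow //; last 2 first.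
- apply/measurable_EFinP; apply: (measurableT_comp (@measurable_invr R)).
  by apply: measurable_funX; apply: measurable_funD => //; exact: measurable_cst.
- by move=> x; rewrite lee_fin invr_ge0 exprn_ge0 // addr_ge0 // sqnorm_ge0.
apply: ge0_le_integral => //.
- by move=> y _; rewrite lee_fin invr_ge0 exprn_ge0 // addr_ge0 // sqnorm_ge0.
- apply/measurable_EFinP; apply: (measurableT_comp (@measurable_invr R)).
  apply: measurable_funX; apply: measurable_funD => //.
  exact: (measurableT_comp ms (@measurable_tr R n 1)).
move=> y _; rewrite lee_fin /pr prodfV lef_pV2 ?posrE; last 2 first.
- by rewrite exprn_gt0 // ltr_pwDl // sqnorm_ge0.
- by apply: prodr_gt0 => i _; rewrite ltr_pwDl // sqr_ge0.
have le1 i : (1 + (y : 'M[R]_(n, 1)) i ord0 ^+ 2 <= 1 + sqnorm (y : 'M[R]_(n, 1))^T)%R.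
  rewrite lerD2l; have := ler_sqnorm_entry (y : 'M[R]_(n, 1))^T i.
  by rewrite mxE.
apply: (@le_trans _ _ ((1 + sqnorm (y : 'M[R]_(n, 1))^T) ^+ n)%R).
  rewrite -[X in (_ <= _ ^+ X)%R]card_ord -prodr_const.
  by apply: ler_prod => i _; rewrite le1 addr_ge0 // sqr_ge0.
by rewrite ler_weXn2l // lerDl sqnorm_ge0.
Qed.

Definition detpow (e : R) n (z : 'M[R]_n) : \bar R := (\det (1%:M + z *m z) `^ (- e))%:E.

Lemma detpow_ge0 e n z : 0 <= @detpow e n z.
Proof. by rewrite lee_fin powR_ge0. Qed.

Lemma measurable_det_1Dsqr n : measurable_fun setT (fun z : bmx n n => \det (1%:M + (z : 'M[R]_n) *m z)).
Proof.
have h : measurable_fun setT (fun z : bmx n n => (1%:M + (z : 'M[R]_n) *m (z : 'M[R]_n))%R : bmx n n).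
  by apply: measurable_addmx; [exact: measurable_cst|exact: measurable_mulmx].
exact: (measurable_det h).
Qed.

Lemma measurable_detpow e n : measurable_fun setT (fun z : bmx n n => detpow e (z : 'M[R]_n)).
Proof.
apply/measurable_EFinP.
exact: (measurableT_comp (measurable_powR (- e)%R) (@measurable_det_1Dsqr n)).
Qed.

Let powR_bound (A e : R) (m : nat) : (1 <= A)%R -> (m%:R + 1 <= 2 * e)%R ->
  ((A ^+ 2) `^ (- e) * A <= (A ^+ m)^-1)%R.
Proof.
move=> A1 me; have A0 : (0 < A)%R by exact: lt_le_trans A1.
have -> : (A ^+ m)^-1%R = ((A ^+ m.+1)^-1 * A)%R.
  by rewrite exprSr invfM divfK // gt_eqF.
rewrite ler_pM2r // powRN lef_pV2 ?posrE ?powR_gt0 ?exprn_gt0 //.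
rewrite -!powR_mulrn ?(ltW A0) // -powRrM; apply: ler_powR => //.
by rewrite -natr1.
Qed.

(** Put [A := 1 + q x]. By [det_1Dsqr_bordered] the substitution [s = r + A u] in the
    inner integral yields at most a constant times [\det M ^ (- e) * A ^ (- n)]. If
    [b] is the Cholesky factor of [M], then [q x] is the squared norm of
    [x *m b^-1], and the substitution [x = x' *m b] costs
    [`|\det b| = \det M ^ (1/2)], whence the exponent [e - 1/2]. *)
Lemma integral_bordered_le e n (w : 'M[R]_n) : w^T%R = w -> (n%:R + 3 <= 2 * e)%R ->
  \int[lebrow R n]_x \int[lebesgue_measure]_(s in [set: R])
     detpow e (block_mx w (x : 'M[R]_(1, n))^T x s%:M : 'M[R]_(n + 1))%R <=
  (c1 * c1 ^+ n)%:E * detpow (e - 2^-1) w.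
Proof.
move=> sw ne; pose M := (1%:M + w *m w)%R; pose D := \det M.
have D1 : (1 <= D)%R by exact: det_1Dsqr_ge1.
have D0 : (0 < D)%R by exact: lt_le_trans D1.
have pM : posdef M by exact: posdef_1Dsqr.
pose b := chol M; have ub : b \in unitmx by exact: chol_unit.
pose q (x : 'M[R]_(1, n)) := (x *m invmx M *m x^T)%R ord0 ord0.
have qE x : q x = sqnorm (x *m invmx b).
  rewrite /q /sqnorm trmx_mul !mulmxA; congr (fun_of_matrix (_ *m _) _ _).
  rewrite -!mulmxA; congr (_ *m _); rewrite -(cholP pM) -/b.
  by rewrite trmx_inv; apply: (can_inj (mulmxK (_ : b^T *m b \in unitmx)));
     rewrite ?unitmx_mul ?unitmx_tr ?ub // mulVmx ?unitmx_mul ?unitmx_tr ?ub //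
       -mulmxA (mulmxA (invmx b^T)) mulVmx ?unitmx_tr // mul1mx mulVmx.
have q0 x : (0 <= q x)%R by rewrite qE sqnorm_ge0.
(* So the power - e of 1 + u ^ 2 is dominated by its inverse. *)
have e1 : (1 <= e)%R by have := ler0n R n; lra.
have inner (x : 'M[R]_(1, n)) :
    \int[lebesgue_measure]_(s in [set: R]) detpow e (block_mx w x^T x s%:M : 'M[R]_(n + 1))%R <=
    (c1 * D `^ (- e))%:E * (((1 + sqnorm (x *m invmx b)) ^+ n)^-1)%:E.
  pose A := (1 + q x)%R; pose r := (x *m w *m invmx M *m x^T)%R ord0 ord0.
  have A1 : (1 <= A)%R by rewrite lerDl.
  have A0 : (0 < A)%R by exact: lt_le_trans A1.
  pose k := (D `^ (- e) * (A ^+ 2) `^ (- e))%R.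
  have k0 : (0 <= k)%R by rewrite mulr_ge0 // powR_ge0.
  pose g (y : R) := ((1 + y ^+ 2)^-1)%:E.
  have mg : measurable_fun [set: R] g by apply/measurable_EFinP.
  have g0 y : 0 <= g y by rewrite lee_fin invr_ge0 addr_ge0 // sqr_ge0.
  have ms : measurable_fun [set: R] (fun s : R => detpow e (block_mx w x^T x s%:M : 'M[R]_(n + 1))%R).
    apply: (measurableT_comp (@measurable_detpow e (n + 1))).
    by apply: measurable_bordered => //; exact: measurable_cst.
  have maff : measurable_fun [set: R] (fun s : R => g (A^-1 * s + (- r / A)))%R.
    apply: (measurableT_comp mg); apply: measurable_funD; last exact: measurable_cst.
    exact: mulrl_measurable.
  apply: (@le_trans _ _ (\int[lebesgue_measure]_(s in [set: R]) (k%:E * g (A^-1 * s + (- r / A))%R))).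
    apply: ge0_le_integral => //.
    - by move=> s _; exact: detpow_ge0.
    - exact: measurable_funeM.
    move=> s _; rewrite /detpow /g -EFinM lee_fin det_1Dsqr_bordered // -/M -/D -/(q x) -/A -/r.
    set u := (A^-1 * s + - r / A)%R.
    have -> : (A ^+ 2 + (s - r) ^+ 2 = A ^+ 2 * (1 + u ^+ 2))%R.
      by rewrite /u; field; rewrite gt_eqF.
    have u1 : (1 <= 1 + u ^+ 2)%R by rewrite lerDl sqr_ge0.
    have u0 : (0 <= 1 + u ^+ 2)%R by exact: le_trans u1.
    rewrite (powRM _ (ltW D0) (mulr_ge0 (sqr_ge0 A) u0)).
    rewrite (powRM _ (sqr_ge0 A) u0) mulrA -/k ler_wpM2l //.
    by rewrite -(powR_inv1 u0); apply: ler_powR => //; lra.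
  rewrite ge0_integralZl // ge0_integral_affine ?invr_eq0 ?gt_eqF // c1E.
  rewrite normfV invrK gtr0_norm // -!EFinM lee_fin /k.
  rewrite [leRHS](_ : _ = D `^ (- e) * ((A ^+ n)^-1 * c1))%R; last first.
    by rewrite /A qE; ring.
  rewrite -mulrA ler_wpM2l ?powR_ge0 // mulrA ler_wpM2r //.
  by apply: powR_bound => //; lra.
have mh (m : nat) : measurable_fun setT (fun x : bmx 1 n => (((1 + sqnorm (x : 'M[R]_(1, n))) ^+ m)^-1)%:E : \bar R).
  apply/measurable_EFinP; apply: (measurableT_comp (@measurable_invr R)).
  apply: measurable_funX; apply: measurable_funD; first exact: measurable_cst.
  apply: (measurable_coord ord0 ord0); apply: measurable_mulmx => //.
  exact: measurable_trmx.
have h0 (m : nat) (x : bmx 1 n) : 0 <= (((1 + sqnorm (x : 'M[R]_(1, n))) ^+ m)^-1)%:E.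
  by rewrite lee_fin invr_ge0 exprn_ge0 // addr_ge0 // sqnorm_ge0.
have ubi : invmx b \in unitmx by rewrite unitmx_inv.
have mhb : measurable_fun setT (fun x : bmx 1 n => (((1 + sqnorm ((x : 'M[R]_(1, n)) *m invmx b)) ^+ n)^-1)%:E : \bar R).
  exact: (measurableT_comp (mh n) (measurable_rmul (invmx b))).
apply: le_trans.
  apply: ge0_le_integral; last by move=> x _; exact: inner.
  - by [].
  - by move=> x _; apply: integral_ge0 => s _; exact: detpow_ge0.
  - pose F (p : bmx 1 n * measurableTypeR R) :=
      detpow e (block_mx w (p.1 : 'M[R]_(1, n))^T p.1 p.2%:M : 'M[R]_(n + 1))%R.
    have mF : measurable_fun setT F.
      apply: (measurableT_comp (@measurable_detpow e (n + 1))).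
      exact: (measurable_bordered w measurable_fst measurable_snd).
    exact: (measurable_fun_fubini_tonelli_F F mF (fun p => detpow_ge0 _ _)).
  - exact: measurable_funeM.
rewrite ge0_integralZl ?lee_fin ?mulr_ge0 ?powR_ge0 //.
rewrite (lebrow_rmul ubi (mh n) (h0 n)) det_inv normfV invrK.
apply: (@le_trans _ _ ((c1 * D `^ (- e))%:E * ((`|\det b|)%:E * (c1 ^+ n)%:E))).
  rewrite lee_wpmul2l ?lee_fin ?mulr_ge0 ?powR_ge0 //.
  by rewrite lee_wpmul2l ?lee_fin // integral_sqnorm.
rewrite /detpow -/M -/D -!EFinM lee_fin.
have -> : (`|\det b| = D `^ 2^-1)%R.
  by rewrite (powR12_sqrt (ltW D0)) /D -(det_chol pM) sqrtr_sqr.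
rewrite opprB addrC powRD; last by apply/implyP => _; rewrite gt_eqF.
by rewrite le_eqVlt; apply/orP; left; apply/eqP; ring.
Qed.

(** Integrating out the last row lowers both [n] by 1 and [2 * e] by 1, so the
    hypothesis is preserved. *)
Lemma detpow_integral_lty n e : (n%:R + 2 <= 2 * e)%R ->
  int_tuple 'C(n.+1, 2) (fun s => detpow e (symmx n s)) < +oo.
Proof.
elim: n e => [|n IH] e ne.
  rewrite int_tuple0 ?ltry //; apply: tuple_measurable_symmx; first exact: measurable_detpow.
  by move=> z; exact: detpow_ge0.
have sE (t : seq R) : (symmx n t)^T%R = symmx n t by exact: symmx_sym.
have mp m (e' : R) : tuple_measurable (fun s => detpow e' (symmx m s)).
  by apply: tuple_measurable_symmx => [|z]; [exact: measurable_detpow|exact: detpow_ge0].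
have ne' : (n%:R + 2 <= 2 * (e - 2^-1))%R by move: ne; rewrite -natr1; lra.
rewrite -(addn1 n) binomial_triangle int_tuple_cat //.
apply: (@le_lt_trans _ _ ((c1 * c1 ^+ n)%:E *
    int_tuple 'C(n.+1, 2) (fun s => detpow (e - 2^-1) (symmx n s)))); last first.
  by rewrite lte_mul_pinfty ?lee_fin ?mulr_ge0 ?exprn_ge0 // IH.
have [mq q0] := mp n (e - 2^-1)%R.
rewrite -ge0_integralZl ?lee_fin ?mulr_ge0 ?exprn_ge0 //; last exact: mq.
apply: (@int_tuple_le _ _ _ (fun t => (c1 * c1 ^+ n)%:E * detpow (e - 2^-1) (symmx n t))).
- exact: (tuple_measurable_int (n + 1) (mp (n + 1)%N e)).
- split=> [N|s]; first by apply: measurable_funeM; exact: mq.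
  apply: mule_ge0; last exact: detpow_ge0.
  by rewrite lee_fin mulr_ge0 ?exprn_ge0.
move=> t st; rewrite int_tuple_last_row //.
- by apply: integral_bordered_le => //; move: ne; rewrite -natr1; lra.
- exact: measurable_detpow.
- by move=> z; exact: detpow_ge0.
Qed.

End SymFinite.

(** * Complex-valued functions *)

Section ComplexHelpers.
Variable R : realType.
Local Open Scope complex_scope.
Implicit Types (s w : R[i]) (x y : R).

Lemma cReM w s : complex.Re (w * s) = complex.Re w * complex.Re s - complex.Im w * complex.Im s.
Proof. by case: w s => [a b] [c e]. Qed.

Lemma cImM w s : complex.Im (w * s) = complex.Re w * complex.Im s + complex.Im w * complex.Re s.
Proof. by case: w s => [a b] [c e]. Qed.

Lemma cReD w s : complex.Re (w + s) = complex.Re w + complex.Re s.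
Proof. by case: w s => [a b] [c e]. Qed.

Lemma cImD w s : complex.Im (w + s) = complex.Im w + complex.Im s.
Proof. by case: w s => [a b] [c e]. Qed.

Lemma cReN w : complex.Re (- w) = - complex.Re w.
Proof. by case: w. Qed.

Lemma cImN w : complex.Im (- w) = - complex.Im w.
Proof. by case: w. Qed.

Lemma cRe_scale (r : R) w : complex.Re (Complex r 0 * w) = r * complex.Re w.
Proof. by rewrite cReM mul0r subr0. Qed.

Lemma cIm_scale (r : R) w : complex.Im (Complex r 0 * w) = r * complex.Im w.
Proof. by rewrite cImM mul0r addr0. Qed.

Lemma cRe_nat k : complex.Re (k%:R : R[i]) = k%:R.
Proof. by elim: k => [//|k IH]; rewrite -!natr1 cReD IH. Qed.

Lemma cIm_nat k : complex.Im (k%:R : R[i]) = 0.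
Proof. by elim: k => [//|k IH]; rewrite -natr1 cImD IH addr0. Qed.

Lemma complex_eq w s : complex.Re w = complex.Re s -> complex.Im w = complex.Im s -> w = s.
Proof. by case: w s => [a b] [c e] /= -> ->. Qed.

Lemma cabs2_ge0 w : 0 <= cabs2 w.
Proof. by rewrite addr_ge0 // sqr_ge0. Qed.

Lemma cabs2M w s : cabs2 (w * s) = cabs2 w * cabs2 s.
Proof. by rewrite /cabs2 cReM cImM; ring. Qed.

(** An equality, except at [x = 0] when [s] is nonzero and purely imaginary: then
    the left side is 0 and the right side is 1. *)
Lemma cabs2_cpow x s : 0 <= x -> cabs2 (cpow x s) <= x `^ (2 * complex.Re s).
Proof.
rewrite /cpow le_eqVlt eq_sym => /orP[/eqP ->|x0].
  rewrite eqxx; case: eqP => [->|_]; first by rewrite /= mulr0 powRr0 /cabs2 /= expr1n expr0n addr0.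
  by rewrite /cabs2 /= expr0n addr0 powR_ge0.
rewrite gt_eqF // /cabs2 /= !exprMn -mulrDr cos2Dsin2 mulr1.
by rewrite -powR_mulrn ?powR_ge0 // -powRrM mulrC.
Qed.

Lemma cpow_gt0 x s : 0 < x -> cpow x s =
  (x `^ complex.Re s * cos (complex.Im s * ln x)) +i*
  (x `^ complex.Re s * sin (complex.Im s * ln x)).
Proof. by move=> x0; rewrite /cpow gt_eqF. Qed.

Lemma cpowM x y s : 0 <= x -> 0 < y -> cpow (x * y) s = cpow x s * cpow y s.
Proof.
rewrite le_eqVlt eq_sym => /orP[/eqP -> y0|x0 y0].
  rewrite mul0r /cpow eqxx; case: eqP => [->|_]; last by rewrite mul0r.
  by rewrite mul1r gt_eqF // powRr0 !mul0r cos0 sin0 mulr1 mulr0.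
rewrite !cpow_gt0 ?mulr_gt0 // lnM ?posrE // mulrDr cosD sinD powRM ?ltW //.
by apply: complex_eq; rewrite ?cReM ?cImM /=; ring.
Qed.

Lemma cpowD x s (t : R[i]) : 0 < x -> cpow x (s + t) = cpow x s * cpow x t.
Proof.
move=> x0; rewrite !cpow_gt0 // cReD cImD mulrDl cosD sinD powRD; last first.
  by apply/implyP => _; rewrite gt_eqF.
by apply: complex_eq; rewrite ?cReM ?cImM /=; ring.
Qed.

Lemma cpow_real x (r : R) s : 0 < x -> complex.Re s = r -> complex.Im s = 0 ->
  cpow x s = (x `^ r)%:C.
Proof. by move=> x0 rs is0; rewrite cpow_gt0 // rs is0 mul0r cos0 sin0 mulr1 mulr0. Qed.

Section Meas.
Variables (d0 : measure_display) (T : measurableType d0).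

Lemma cmeasurableM (D : set T) (f g : T -> R[i]) :
  cmeasurable D f -> cmeasurable D g -> cmeasurable D (fun t => f t * g t).
Proof.
move=> [f1 f2] [g1 g2]; split.
  by under eq_fun do rewrite cReM; apply: measurable_funB; apply: measurable_funM.
by under eq_fun do rewrite cImM; apply: measurable_funD; apply: measurable_funM.
Qed.

Lemma cmeasurable_comp d1 (T' : measurableType d1) (f : T -> R[i]) (g : T' -> T) :
  cmeasurable setT f -> measurable_fun setT g -> cmeasurable setT (fun t => f (g t)).
Proof.
by move=> [f1 f2] mg; split; [exact: (measurableT_comp f1 mg)|exact: (measurableT_comp f2 mg)].
Qed.

Lemma cmeasurable_cabs2 (D : set T) (f : T -> R[i]) :
  cmeasurable D f -> measurable_fun D (fun t => cabs2 (f t)).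
Proof. by move=> [f1 f2]; apply: measurable_funD; exact: measurable_funX. Qed.

Lemma cmeasurable_cpow s (c : T -> R) : measurable_fun setT c ->
  cmeasurable setT (fun t => cpow (c t) s).
Proof.
move=> mc; have m0 : measurable_fun setT (fun t => c t == 0).
  by apply: measurable_fun_eqr => //; exact: measurable_cst.
have mang : measurable_fun setT (fun t => complex.Im s * ln (c t)).
  apply: measurable_funM; first exact: measurable_cst.
  exact: (measurableT_comp (@measurable_ln R) mc).
have mpow : measurable_fun setT (fun t => c t `^ complex.Re s).
  exact: (measurableT_comp (measurable_powR _) mc).
split.
- rewrite (_ : (fun t => _) = fun t => if c t == 0 then complex.Re ((s == 0)%:R : R[i])
    else c t `^ complex.Re s * cos (complex.Im s * ln (c t))).
    apply: measurable_fun_ifT => //; apply: measurable_funM => //.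
    exact: (measurableT_comp (continuous_measurable_fun (@continuous_cos R)) mang).
  by apply/funext => t; rewrite /cpow; case: ifP.
- rewrite (_ : (fun t => _) = fun t => if c t == 0 then complex.Im ((s == 0)%:R : R[i])
    else c t `^ complex.Re s * sin (complex.Im s * ln (c t))).
    apply: measurable_fun_ifT => //; apply: measurable_funM => //.
    exact: (measurableT_comp (continuous_measurable_fun (@continuous_sin R)) mang).
  by apply/funext => t; rewrite /cpow; case: ifP.
Qed.

Variable m : {measure set T -> \bar R}.

Lemma cintegral_linear (D : set T) (c : R[i]) (f g : T -> R[i]) : measurable D ->
  cintegrable m D f -> cintegrable m D g ->
  cintegral m D (fun t => c * f t + g t) = c * cintegral m D f + cintegral m D g.
Proof.
move=> mD [f1 f2] [g1 g2].
have Z (k : R) (h : T -> R) : m.-integrable D (EFin \o h) -> m.-integrable D (EFin \o (fun t => k * h t)).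
  by move=> ih; exact: (integrableZl mD k ih).
apply: complex_eq; rewrite ?cReD ?cImD ?cReM ?cImM /=.
- transitivity (\int[m]_(t in D) ((complex.Re c * complex.Re (f t) -
     complex.Im c * complex.Im (f t)) + complex.Re (g t)))%R.
    by apply: eq_Rintegral => t _; rewrite cReD cReM.
  rewrite RintegralD //; last first.
    exact: (integrableB mD (Z _ _ f1) (Z _ _ f2)).
  by rewrite RintegralB ?RintegralZl //; exact: Z.
- transitivity (\int[m]_(t in D) ((complex.Re c * complex.Im (f t) +
     complex.Im c * complex.Re (f t)) + complex.Im (g t)))%R.
    by apply: eq_Rintegral => t _; rewrite cImD cImM.
  rewrite RintegralD //; last first.
    exact: (integrableD mD (Z _ _ f2) (Z _ _ f1)).
  by rewrite RintegralD ?RintegralZl //; exact: Z.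
Qed.

Lemma eq_cintegral (D : set T) (f g : T -> R[i]) : (forall t, D t -> f t = g t) ->
  cintegral m D f = cintegral m D g.
Proof.
move=> fg; rewrite /cintegral.
by congr Complex; congr fine; apply: eq_integral => t /set_mem Dt; rewrite fg.
Qed.

Lemma cintegrableZ (D : set T) (c : R[i]) (f : T -> R[i]) : measurable D ->
  cintegrable m D f -> cintegrable m D (fun t => c * f t).
Proof.
move=> mD [f1 f2].
have Z (k : R) (h : T -> R) : m.-integrable D (EFin \o h) ->
    m.-integrable D (EFin \o (fun t => k * h t)).
  by move=> ih; exact: (integrableZl mD k ih).
split; under eq_fun do rewrite ?cReM ?cImM.
- exact: (integrableB mD (Z _ _ f1) (Z _ _ f2)).
- exact: (integrableD mD (Z _ _ f2) (Z _ _ f1)).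
Qed.

Lemma cintegralZ (D : set T) (c : R[i]) (f : T -> R[i]) : measurable D ->
  cintegrable m D f ->
  cintegral m D (fun t => c * f t) = c * cintegral m D f.
Proof.
move=> mD hf; have h0 : cintegrable m D (fun=> 0 : R[i]).
  by split; exact: integrable0.
have c0 : cintegral m D (fun=> 0 : R[i]) = 0.
  by apply: complex_eq; rewrite /cintegral/= integral0.
rewrite -[RHS]addr0 -c0 -(cintegral_linear c mD hf h0).
by congr cintegral; apply/funext => t; rewrite addr0.
Qed.

End Meas.

End ComplexHelpers.

(** * Bounds and equivariance of the kernel *)

Section Kernel.
Variables (R : realType) (n d : nat).
Notation bmx m n := (borelMx R m n).

Lemma measurable_kernelK d0 (T : measurableType d0) (al be : R[i])
    (f : T -> bmx n n) (g : T -> bmx n d) :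
  measurable_fun setT f -> measurable_fun setT g ->
  cmeasurable setT (fun t => kernelK al be (f t : 'M[R]_n) (g t : 'M[R]_(n, d))).
Proof.
move=> mf mg; apply: cmeasurableM; apply: cmeasurable_cpow;
  apply: (measurableT_comp (@normr_measurable R setT)).
  exact: measurable_det.
have mb : measurable_fun setT (fun t => block_mx (f t : 'M[R]_n) (g t : 'M[R]_(n, d))
    (g t : 'M[R]_(n, d))^T 0 : bmx (n + d) (n + d)).
  apply: measurable_col_mx; apply: measurable_row_mx => //; first exact: measurable_trmx.
exact: (measurable_det mb).
Qed.

Lemma powR_half_le (x D s : R) : 0 <= s -> 0 <= x -> x ^+ 2 <= D ->
  x `^ (2 * s) <= D `^ s.
Proof.
move=> s0 x0 xD; rewrite powRrM powR_mulrn //.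
by rewrite ge0_ler_powR // nnegrE ?sqr_ge0 // (le_trans (sqr_ge0 x)).
Qed.

Lemma cabs2_kernelK_le (al be : R[i]) (z : 'M[R]_n) (y : 'M[R]_(n, d)) :
  0 <= complex.Re (al - be) -> 0 <= complex.Re be ->
  z^T = z -> y^T *m y = 1%:M ->
  cabs2 (kernelK al be z y) <= \det (1%:M + z *m z) `^ complex.Re al.
Proof.
move=> ab0 b0 sz yy; have D1 := det_1Dsqr_ge1 sz.
have -> : complex.Re al = complex.Re (al - be) + complex.Re be.
  by rewrite cReD cReN subrK.
rewrite /kernelK cabs2M powRD; last first.
  by apply/implyP => _; rewrite gt_eqF // (lt_le_trans _ D1).
apply: ler_pM; rewrite ?cabs2_ge0 //; apply: le_trans (cabs2_cpow _ (normr_ge0 _)) _;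
  apply: powR_half_le => //; rewrite real_normK ?num_real //.
  exact: det_sqr_le_1Dsqr.
exact: det_block_sqr_le.
Qed.

Lemma cpow_sqr (x : R) s : 0 < x -> cpow (x * x) s = cpow x (s + s).
Proof. by move=> x0; rewrite cpowM ?ltW // cpowD. Qed.

(** The bordered matrix of [z] and [a *m y] is that of [a^-1 *m z *m a^-T] and [y],
    multiplied on the left by the block diagonal matrix of [a] and [1], and on the
    right by its transpose. *)
Lemma kernelK_lmul (al be : R[i]) (a z : 'M[R]_n) (y : 'M[R]_(n, d)) : a \in unitmx ->
  kernelK al be z (a *m y) =
  cpow `|\det a| (al + al) * kernelK al be (invmx a *m z *m invmx a^T) y.
Proof.
move=> ua; set z' := _ *m _ *m _; set e := `|\det a|.
have e0 : 0 < e by rewrite normr_gt0 -unitfE -unitmxE.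
have zE : z = a *m z' *m a^T.
  by rewrite /z' !mulmxA mulmxV // mul1mx mulmxKV // unitmx_tr.
have d1 : `|\det z| = `|\det z'| * (e * e).
  by rewrite zE !det_mulmx det_tr !normrM -/e mulrAC mulrC.
have d2 : `|\det (block_mx z (a *m y) (a *m y)^T (0 : 'M[R]_d))| =
    `|\det (block_mx z' y y^T (0 : 'M[R]_d))| * (e * e).
  have -> : block_mx z (a *m y) (a *m y)^T (0 : 'M[R]_d) =
      block_mx a 0 0 1%:M *m block_mx z' y y^T 0 *m block_mx a^T 0 0 1%:M.
    rewrite !mulmx_block !mul0mx !mulmx0 !mul1mx !mulmx1 !addr0 !add0r.
    by rewrite -zE trmx_mul.
  rewrite !det_mulmx !det_ublock det_tr det1 !mulr1 !normrM -/e.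
  by rewrite mulrAC mulrC.
rewrite /kernelK d1 d2 (cpowM _ (normr_ge0 (\det z'))) ?mulr_gt0 //.
rewrite (cpowM _ (normr_ge0 (\det (block_mx _ _ _ _)))) ?mulr_gt0 //.
have -> : cpow e (al + al) = cpow (e * e) (al - be) * cpow (e * e) be.
  by rewrite -cpowD ?mulr_gt0 // subrK cpow_sqr.
by rewrite mulrACA mulrC.
Qed.

Lemma kernelK_rmul (al be : R[i]) (z : 'M[R]_n) (y : 'M[R]_(n, d)) (k : 'M[R]_d) :
  k \in unitmx ->
  kernelK al be z (y *m k) = cpow `|\det k| (be + be) * kernelK al be z y.
Proof.
move=> uk; have k0 : 0 < `|\det k| by rewrite normr_gt0 -unitfE -unitmxE.
have d2 : `|\det (block_mx z (y *m k) (y *m k)^T (0 : 'M[R]_d))| =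
    `|\det (block_mx z y y^T (0 : 'M[R]_d))| * (`|\det k| * `|\det k|).
  have -> : block_mx z (y *m k) (y *m k)^T (0 : 'M[R]_d) =
      block_mx 1%:M 0 0 k^T *m block_mx z y y^T 0 *m block_mx 1%:M 0 0 k.
    rewrite !mulmx_block !mul0mx !mulmx0 !mul1mx !mulmx1 !addr0 !add0r.
    by rewrite mul0mx trmx_mul.
  by rewrite !det_mulmx !det_ublock det_tr det1 !mul1r !normrM mulrAC mulrC.
rewrite /kernelK d2 cpowM ?normr_ge0 ?mulr_gt0 // cpow_sqr //.
by rewrite mulrA mulrC.
Qed.

End Kernel.

(** * Square integrable functions for a finite measure *)

Section SquareIntegral.
Variables (R : realType) (d0 : measure_display) (T : measurableType d0).
Variable m : {finite_measure set T -> \bar R}.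
Variables (D : set T) (f : T -> R).
Hypotheses (mD : measurable D) (mf : measurable_fun D f).
Hypothesis f2 : (\int[m]_(t in D) (f t ^+ 2)%:E < +oo)%E.

Lemma integrable_sqr : m.-integrable D (fun t => (f t ^+ 2)%:E).
Proof.
apply/integrableP; split; first by apply/measurable_EFinP; exact: measurable_funX.
rewrite (eq_integral (fun t => (f t ^+ 2)%:E)) // => t _.
by rewrite /= ger0_norm // sqr_ge0.
Qed.

Let i1 : m.-integrable D (EFin \o cst 1%R).
Proof. exact: finite_measure_integrable_cst. Qed.

(** [`|f| <= 1 + f ^ 2], and constants are integrable. *)
Lemma integrable_of_sqr : m.-integrable D (EFin \o f).
Proof.
apply: (le_integrable mD _ _ (integrableD mD i1 integrable_sqr)).
  exact/measurable_EFinP.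
move=> t _ /=; rewrite lee_fin.
rewrite [leRHS]ger0_norm ?addr_ge0 ?sqr_ge0 // -[X in _ <= 1 + X]real_normK ?num_real //.
by have := normr_ge0 (f t); move: `|f t| => x; nra.
Qed.

(** The Cauchy-Schwarz inequality against a constant, from the integral of
    [((m D + 1) * f - I) ^ 2]; adding 1 to the mass avoids a division by zero. *)
Lemma sqr_Rintegral_le :
  (\int[m]_(t in D) f t) ^+ 2 <= (fine (m D) + 1) * \int[m]_(t in D) (f t ^+ 2).
Proof.
set I := \int[m]_(t in D) f t; set N := \int[m]_(t in D) (f t ^+ 2).
set s := fine (m D); have s0 : 0 <= s by rewrite fine_ge0.
have if1 := integrable_of_sqr; have if2 := integrable_sqr.
have : 0 <= \int[m]_(t in D) ((s + 1) * f t - I) ^+ 2.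
  by apply: Rintegral_ge0 => t _; exact: sqr_ge0.
have -> : \int[m]_(t in D) ((s + 1) * f t - I) ^+ 2 =
    (s + 1) ^+ 2 * N - (2 * (s + 1) * I) * I + I ^+ 2 * s.
  transitivity (\int[m]_(t in D) (((s + 1) ^+ 2 * f t ^+ 2 - (2 * (s + 1) * I) * f t)
     + I ^+ 2)).
    by apply: eq_Rintegral => t _; ring.
  have iA := integrableZl mD ((s + 1) ^+ 2) if2.
  have iB := integrableZl mD (2 * (s + 1) * I) if1.
  have iC : m.-integrable D (EFin \o cst (I ^+ 2)).
    by apply: finite_measure_integrable_cst.
  rewrite RintegralD //; last exact: (integrableB mD iA iB).
  rewrite [X in _ + X = _](_ : _ = I ^+ 2 * s); last exact: Rintegral_cst.
  by rewrite RintegralB // !RintegralZl.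
have N0 : 0 <= N by apply: Rintegral_ge0 => t _; exact: sqr_ge0.
move=> h; have h2 : (s + 2) * I ^+ 2 <= (s + 1) ^+ 2 * N by move: h; nra.
have : (s + 2) * I ^+ 2 <= (s + 2) * ((s + 1) * N).
  apply: le_trans h2 _; rewrite expr2 mulrA ler_wpM2r // ; nra.
by rewrite ler_pM2l //; lra.
Qed.

End SquareIntegral.

(** * The integral operator *)

Section ParameterIntegral.
Context d1 d2 (T1 : measurableType d1) (T2 : measurableType d2) (R : realType).
Variable m : {sigma_finite_measure set T2 -> \bar R}.

(** Tonelli's theorem for the positive and negative parts: the conventions for
    [+oo - +oo] and [fine] are Borel, so integrability is not assumed. *)
Lemma measurable_fine_integral (h : T1 * T2 -> R) : measurable_fun setT h ->
  measurable_fun setT (fun x => fine (\int[m]_y (h (x, y))%:E)).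
Proof.
move=> mh; pose hp (p : T1 * T2) := (Num.max (h p) 0)%:E.
pose hn (p : T1 * T2) := (Num.max (- h p) 0)%:E.
have mhp : measurable_fun setT hp.
  by apply/measurable_EFinP; apply: measurable_maxr => //; exact: measurable_cst.
have mhn : measurable_fun setT hn.
  apply/measurable_EFinP; apply: measurable_maxr; last exact: measurable_cst.
  exact: measurableT_comp.
have hp0 p : (0 <= hp p)%E by rewrite lee_fin le_max lexx orbT.
have hn0 p : (0 <= hn p)%E by rewrite lee_fin le_max lexx orbT.
rewrite (_ : (fun x => _) = fine \o (fun x => \int[m]_y hp (x, y) - \int[m]_y hn (x, y))%E).
  apply: measurableT_comp; first exact: fine_measurable.
  apply: emeasurable_funB.
    exact: (measurable_fun_fubini_tonelli_F _ mhp).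
  exact: (measurable_fun_fubini_tonelli_F _ mhn).
apply/funext => x /=; congr fine; rewrite integralE; congr (_ - _)%E; apply: eq_integral => y _.
  by rewrite funeposE /hp EFin_max.
by rewrite funenegE /hn EFin_max.
Qed.

End ParameterIntegral.

Section Operator.
Variables (R : realType) (n d : nat).
Notation bmx m n := (borelMx R m n).
Variable sigma : {finite_measure set (bmx n d) -> \bar R}.
Variables (al be : R[i]).
Hypotheses (ab0 : 0 <= complex.Re (al - be)) (be0 : 0 <= complex.Re be).
Notation S := (@Stiefel R n d : set (bmx n d)).
Notation D z := (\det (1%:M + z *m z)).

Let mS : measurable S := @measurable_Stiefel R n d.

Let SfullRank : S `<=` (@fullRank R n d : set (bmx n d)).
Proof. by move=> y []. Qed.

Let s1 : R := fine (sigma S) + 1.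

Section OneFunction.
Variable F : 'M[R]_(n, d) -> R[i].
Hypothesis mF : cmeasurable (@fullRank R n d : set (bmx n d)) F.
Hypothesis normF : (normL2 sigma F < +oo)%E.

Let mFS : cmeasurable S F.
Proof.
by case: mF => mr mi; split; [apply: measurable_funS mr|apply: measurable_funS mi] => //;
  exact: measurable_fullRank.
Qed.

Let mintegrand (z : 'M[R]_n) : cmeasurable S (fun y => F y * kernelK al be z y).
Proof.
apply: cmeasurableM => //.
have [mr mi] := @measurable_kernelK R n d _ (bmx n d) al be (cst z) id (measurable_cst _) (@measurable_id _ _ _).
by split; apply: measurable_funTS; [exact: mr|exact: mi].
Qed.

Let cabs2_int_le (z : 'M[R]_n) : z^T = z ->
  (\int[sigma]_(y in S) (cabs2 (F y * kernelK al be z y))%:E <=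
   (D z `^ complex.Re al)%:E * normL2 sigma F)%E.
Proof.
move=> sz; rewrite /normL2 -ge0_integralZl //; last 3 first.
- by apply/measurable_EFinP; exact: cmeasurable_cabs2.
- by move=> y _; rewrite lee_fin cabs2_ge0.
- by rewrite lee_fin powR_ge0.
apply: ge0_le_integral => //.
- by move=> y _; rewrite lee_fin cabs2_ge0.
- by apply/measurable_EFinP; apply: cmeasurable_cabs2; exact: mintegrand.
- by apply: measurable_funeM; apply/measurable_EFinP; exact: cmeasurable_cabs2.
move=> y [_ yy]; rewrite -EFinM lee_fin cabs2M mulrC.
by rewrite ler_wpM2r ?cabs2_ge0 // cabs2_kernelK_le.
Qed.

Let cabs2_int_lty (z : 'M[R]_n) : z^T = z ->
  (\int[sigma]_(y in S) (cabs2 (F y * kernelK al be z y))%:E < +oo)%E.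
Proof.
move=> sz; apply: le_lt_trans (cabs2_int_le sz) _.
by rewrite lte_mul_pinfty // lee_fin powR_ge0.
Qed.

Let part_lty (z : 'M[R]_n) (g : R[i] -> R) :
  (forall w, g w ^+ 2 <= cabs2 w) -> z^T = z ->
  measurable_fun S (fun y => g (F y * kernelK al be z y)) ->
  (\int[sigma]_(y in S) (g (F y * kernelK al be z y) ^+ 2)%:E < +oo)%E.
Proof.
move=> hg sz mg; apply: le_lt_trans (cabs2_int_lty sz).
apply: ge0_le_integral => //.
- by move=> y _; rewrite lee_fin sqr_ge0.
- by apply/measurable_EFinP; exact: measurable_funX.
- by apply/measurable_EFinP; apply: cmeasurable_cabs2; exact: mintegrand.
by move=> y _; rewrite lee_fin.
Qed.

Let Re_lty (z : 'M[R]_n) : z^T = z ->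
  (\int[sigma]_(y in S) (complex.Re (F y * kernelK al be z y) ^+ 2)%:E < +oo)%E.
Proof.
move=> sz; apply: part_lty => //; last exact: (mintegrand z).1.
by move=> w; rewrite /cabs2 lerDl sqr_ge0.
Qed.

Let Im_lty (z : 'M[R]_n) : z^T = z ->
  (\int[sigma]_(y in S) (complex.Im (F y * kernelK al be z y) ^+ 2)%:E < +oo)%E.
Proof.
move=> sz; apply: part_lty => //; last exact: (mintegrand z).2.
by move=> w; rewrite /cabs2 lerDr sqr_ge0.
Qed.

Lemma cintegrable_opQ (z : 'M[R]_n) : z^T = z ->
  cintegrable sigma S (fun y => F y * kernelK al be z y).
Proof.
move=> sz; have [mr mi] := mintegrand z; split.
  exact: (integrable_of_sqr mS mr (Re_lty sz)).
exact: (integrable_of_sqr mS mi (Im_lty sz)).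
Qed.

Lemma cabs2_opQ_le (z : 'M[R]_n) : z^T = z ->
  cabs2 (opQ sigma al be F z) <= s1 * (D z `^ complex.Re al * fine (normL2 sigma F)).
Proof.
move=> sz; have [mr mi] := mintegrand z.
have s10 : 0 <= s1 by rewrite addr_ge0 // fine_ge0.
have hr := sqr_Rintegral_le mS mr (Re_lty sz).
have hi := sqr_Rintegral_le mS mi (Im_lty sz).
apply: le_trans (lerD hr hi) _; rewrite -mulrDr ler_wpM2l //.
have ir := integrable_sqr mr (Re_lty sz).
have ii := integrable_sqr mi (Im_lty sz).
rewrite -RintegralD //.
have nF : normL2 sigma F \is a fin_num.
  rewrite ge0_fin_numE //; apply: integral_ge0 => y _.
  by rewrite lee_fin cabs2_ge0.
rewrite -lee_fin EFinM (fineK nF) fineK; first exact: cabs2_int_le.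
rewrite ge0_fin_numE; first exact: cabs2_int_lty.
by apply: integral_ge0 => y _; rewrite lee_fin cabs2_ge0.
Qed.

(** [F] is only constrained on matrices of full rank; extended by zero outside the
    Stiefel manifold, it is a Borel function of all matrices. *)
Let cutoff (y : bmx n d) : R[i] :=
  Complex (patch (fun=> 0) S (fun y => complex.Re (F y)) y)
    (patch (fun=> 0) S (fun y => complex.Im (F y)) y).

Let cutoffE (y : bmx n d) : S y -> cutoff y = F y.
Proof.
move=> Sy; rewrite /cutoff /patch mem_set //=.
by case: (F y).
Qed.

Let cutoff0 (y : bmx n d) : ~ S y -> cutoff y = 0.
Proof. by move=> Sy; rewrite /cutoff /patch memNset. Qed.

Let mcutoff : cmeasurable setT cutoff.
Proof.
case: mFS => mr mi; split.
  by apply/(measurable_restrictT _ mS).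
by apply/(measurable_restrictT _ mS).
Qed.

Lemma cmeasurable_opQ : cmeasurable setT (opQ sigma al be F : bmx n n -> R[i]).
Proof.
pose G (p : bmx n n * bmx n d) := cutoff p.2 * kernelK al be (p.1 : 'M[R]_n) p.2.
have [mGr mGi] : cmeasurable setT G.
  apply: cmeasurableM.
    exact: (cmeasurable_comp mcutoff measurable_snd).
  exact: (measurable_kernelK al be measurable_fst measurable_snd).
have E (g : R[i] -> R) (z : bmx n n) : g 0 = 0 ->
    (\int[sigma]_(y in S) (g (F y * kernelK al be (z : 'M[R]_n) y))%:E =
    \int[sigma]_y (g (G (z, y)))%:E)%E.
  move=> g0; rewrite integral_mkcond; apply: eq_integral => y _; rewrite /patch /G/=.
  case: ifPn => [|]; first by rewrite inE => Sy; rewrite cutoffE.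
  by rewrite notin_setE => Sy; rewrite cutoff0 // mul0r g0.
split.
- rewrite (_ : (fun z => _) = fun z => fine (\int[sigma]_y (complex.Re (G (z, y)))%:E)).
    exact: (@measurable_fine_integral _ _ _ _ R sigma _ mGr).
  by apply/funext => z; rewrite /opQ /cintegral /= (E (@complex.Re R)).
- rewrite (_ : (fun z => _) = fun z => fine (\int[sigma]_y (complex.Im (G (z, y)))%:E)).
    exact: (@measurable_fine_integral _ _ _ _ R sigma _ mGi).
  by apply/funext => z; rewrite /opQ /cintegral /= (E (@complex.Im R)).
Qed.

End OneFunction.
End Operator.

(** * Equivariance and boundedness *)

Section Equivariance.
Variables (R : realType) (n d : nat).
Notation bmx m n := (borelMx R m n).
Hypotheses (dn : (d <= n)%N) (d0 : (0 < d)%N).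
Variable sigma : {finite_measure set (bmx n d) -> \bar R}.
Hypothesis hsigma : Stiefel_measure sigma.
Variables (al be mu : R[i]).
Hypotheses (ab0 : 0 <= complex.Re (al - be)) (be0 : 0 <= complex.Re be).
Hypothesis bemu : be + be = mu - n%:R.
Notation S := (@Stiefel R n d : set (bmx n d)).

Let mS : measurable S := @measurable_Stiefel R n d.

Variable F : 'M[R]_(n, d) -> R[i].
Hypothesis mF : cmeasurable (@fullRank R n d : set (bmx n d)) F.
Hypothesis normF : (normL2 sigma F < +oo)%E.
Hypothesis homF : homogeneousL mu F.

(** [F] modified outside the matrices of full rank so as to be Borel everywhere. *)
Let G (y : bmx n d) : R[i] :=
  Complex (patch (fun=> 0) (@fullRank R n d : set (bmx n d)) (fun y => complex.Re (F y)) y)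
    (patch (fun=> 0) (@fullRank R n d : set (bmx n d)) (fun y => complex.Im (F y)) y).

Let GE (y : 'M[R]_(n, d)) : \rank y = d -> G y = F y.
Proof. by move=> ry; rewrite /G /patch mem_set //=; case: (F y). Qed.

Let mG : cmeasurable setT G.
Proof.
case: mF => mr mi; have mfr := @measurable_fullRank R n d.
by split; [apply/(measurable_restrictT _ mfr)|apply/(measurable_restrictT _ mfr)].
Qed.

(** The function [h y := F y * K(z, a *m y)] has degree [- mu + 2 beta = - n], so
    [Stiefel_transform_real] applies to its real and imaginary parts and gives the
    factor [`|\det a| ^+ d]; the equivariance of the kernel gives the other
    one. *)
Lemma opQ_piL (a z : 'M[R]_n) : a \in unitmx -> z^T = z ->
  opQ sigma al be (piL a F) z =
  Complex (`|\det a| ^+ d) 0 *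
  (cpow `|\det a| (al + al) * opQ sigma al be F (invmx a *m z *m invmx a^T)).
Proof.
move=> ua sz; set z' := invmx a *m z *m invmx a^T; set c := cpow `|\det a| (al + al).
have sz' : z'^T = z' by rewrite /z' !trmx_mul !trmx_inv trmxK sz mulmxA.
pose h (y : bmx n d) := G y * kernelK al be z (a *m (y : 'M[R]_(n, d))).
have [mhr mhi] : cmeasurable setT h.
  apply: cmeasurableM => //.
  exact: (measurable_kernelK al be (measurable_cst (z : bmx n n)) (measurable_lmul a)).
have hS (y : bmx n d) : S y -> h y = c * (F y * kernelK al be z' y).
  by move=> [ry _]; rewrite /h GE // kernelK_lmul // mulrCA.
have iFK := cintegrable_opQ ab0 be0 mF normF sz'.
have icFK := cintegrableZ c mS iFK.
have [ihr ihi] : cintegrable sigma S h.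
  case: icFK => i1 i2; split.
    by apply: eq_integrable i1 => // y; rewrite inE => Sy; rewrite hS.
  by apply: eq_integrable i2 => // y; rewrite inE => Sy; rewrite hS.
have hhom (y : 'M[R]_(n, d)) (k : 'M[R]_d) : \rank y = d -> k \in unitmx ->
    h (y *m k) = Complex ((`|\det k| ^+ n)^-1) 0 * h y.
  move=> ry uk; have k0 : 0 < `|\det k| by rewrite normr_gt0 -unitfE -unitmxE.
  have ryk : \rank (y *m k) = d by rewrite mxrankMfree // row_free_unit.
  rewrite /h !GE // homF // mulmxA kernelK_rmul // bemu mulrACA -cpowD //.
  congr (_ * _); rewrite (_ : - mu + (mu - n%:R) = - n%:R); last by ring.
  rewrite (@cpow_real _ _ (- n%:R)) ?cReN ?cImN ?cRe_nat ?cIm_nat ?oppr0 //.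
  by rewrite powRN powR_mulrn // ltW.
have opE : opQ sigma al be (piL a F) z =
    cintegral sigma S (fun y => h (invmx a *m (y : 'M[R]_(n, d)))).
  have e (y : bmx n d) : S y -> piL a F y * kernelK al be z y = h (invmx a *m (y : 'M[R]_(n, d))).
    move=> [ry _]; rewrite /h /piL mulKVmx // GE //.
    have fa : row_full (invmx a) by rewrite row_full_unit unitmx_inv.
    by rewrite (eqmxMfull y fa).
  exact: eq_cintegral.
rewrite opE.
have re_hom (y : 'M[R]_(n, d)) (k : 'M[R]_d) : \rank y = d -> k \in unitmx ->
    complex.Re (h (y *m k)) = (`|\det k| ^+ n)^-1 * complex.Re (h y).
  by move=> ry uk; rewrite -cRe_scale; exact: (congr1 (@complex.Re R) (hhom y k ry uk)).
have im_hom (y : 'M[R]_(n, d)) (k : 'M[R]_d) : \rank y = d -> k \in unitmx ->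
    complex.Im (h (y *m k)) = (`|\det k| ^+ n)^-1 * complex.Im (h y).
  by move=> ry uk; rewrite -cIm_scale; exact: (congr1 (@complex.Im R) (hhom y k ry uk)).
have Er := Stiefel_transform_real dn d0 hsigma re_hom mhr ua ihr.
have Ei := Stiefel_transform_real dn d0 hsigma im_hom mhi ua ihi.
rewrite -[c * _](cintegralZ c mS iFK).
have -> : cintegral sigma S (fun y => c * (F y * kernelK al be z' y)) = cintegral sigma S h.
  by apply: eq_cintegral => y Sy; rewrite hS.
have fr := integrable_fin_num mS ihr; have fi := integrable_fin_num mS ihi.
apply: complex_eq.
  rewrite cRe_scale; apply: (etrans (congr1 fine Er)); exact: fineM.
rewrite cIm_scale; apply: (etrans (congr1 fine Ei)); exact: fineM.
Qed.

End Equivariance.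

Lemma measurable_Sym (R : realType) n : measurable (@Sym R n : set (borelMx R n n)).
Proof.
rewrite (_ : @Sym R n = \bigcap_(ij in [set: 'I_n * 'I_n])
   ((fun z : borelMx R n n => z ij.2 ij.1 - z ij.1 ij.2) @^-1` [set 0])).
  apply: fin_bigcap_measurable => // -[i j] _ /=.
  rewrite -[X in measurable X]setTI.
  by apply: (measurable_funB (measurable_entry j i) (measurable_entry i j)).
apply/seteqP; split=> z /=.
  by move=> sz [i j] _ /=; have := congr1 (fun M : 'M[R]_n => M i j) sz; rewrite mxE => ->; exact: subrr.
move=> h; apply/matrixP => i j; rewrite mxE; apply/eqP; rewrite -subr_eq0; apply/eqP.
exact: (h (i, j)).
Qed.

Section NormBound.
Variables (R : realType) (n d : nat).
Notation bmx m n := (borelMx R m n).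
Variable sigma : {finite_measure set (bmx n d) -> \bar R}.
Variables (al be nu : R[i]).
Hypotheses (ab0 : 0 <= complex.Re (al - be)) (be0 : 0 <= complex.Re be).
Hypothesis expo : complex.Re al + complex.Re nu + 2^-1 <= 0.

(** By [cabs2_opQ_le] the integrand is at most a multiple of the power [- e] of
    det(1 + z^2), and [expo] says that [2 * e >= n + 2], as [detpow_integral_lty]
    requires. *)
Lemma normG2_opQ_le : exists C : R, forall F : 'M[R]_(n, d) -> R[i],
  cmeasurable (@fullRank R n d : set (bmx n d)) F -> (normL2 sigma F < +oo)%E ->
  (normG2 nu (opQ sigma al be F) <= C%:E * normL2 sigma F)%E.
Proof.
have [m [mE mI]] := lebesgue_Sym_exists R n.
pose e := n.+1%:R / 2 - complex.Re al - complex.Re nu.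
have ne : n%:R + 2 <= 2 * e by rewrite /e -[n.+1%:R]natr1; move: expo; lra.
have J := detpow_integral_lty ne.
set I := int_tuple _ _ in J.
have I0 : (0 <= I)%E by apply: integral_ge0 => t _; exact: detpow_ge0.
have If : I \is a fin_num by rewrite ge0_fin_numE.
pose s1 := fine (sigma (@Stiefel R n d : set (bmx n d))) + 1.
have s10 : 0 <= s1 by rewrite addr_ge0 // fine_ge0.
exists (s1 * fine I) => F mF nF.
have N0 : (0 <= normL2 sigma F)%E.
  by apply: integral_ge0 => y _; rewrite lee_fin cabs2_ge0.
have Nf : normL2 sigma F \is a fin_num by rewrite ge0_fin_numE.
pose k := s1 * fine (normL2 sigma F); have k0 : 0 <= k by rewrite mulr_ge0 // fine_ge0.
rewrite /normG2 -mE.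
have [qr qi] := cmeasurable_opQ sigma al be mF.
have mSym := @measurable_Sym R n.
have -> : ((s1 * fine I)%:E * normL2 sigma F = k%:E * I)%E.
  by rewrite -[in LHS](fineK Nf) -[in RHS](fineK If) -!EFinM /k; congr _%:E; ring.
have mdp := @measurable_detpow R e n.
have -> : I = (\int[m]_z detpow e (z : 'M[R]_n))%E.
  by rewrite mI // => z; exact: detpow_ge0.
rewrite -ge0_integralZl //; last by move=> z _; exact: detpow_ge0.
rewrite (integral_indicE m (@Sym R n : set (bmx n n))).
apply: ge0_le_integral => //.
- by move=> z _; rewrite mule_ge0 // lee_fin // mulr_ge0 ?cabs2_ge0 // powR_ge0.
- apply: emeasurable_funM; last first.
    by apply/measurable_EFinP; exact: measurable_indic.
  apply/measurable_EFinP; apply: measurable_funM.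
    by apply: measurable_funD; exact: measurable_funX.
  exact: (measurableT_comp (measurable_powR _) (@measurable_det_1Dsqr R n)).
- exact: measurable_funeM.
move=> z _; rewrite indicE; have [|_] := boolP (z \in _); last first.
  by rewrite mule0 mule_ge0 ?lee_fin // powR_ge0.
rewrite inE => sz; rewrite mule1 /detpow -EFinM lee_fin.
have D1 := det_1Dsqr_ge1 sz; have D0 := lt_le_trans ltr01 D1.
apply: le_trans (_ : s1 * (\det (1%:M + z *m z) `^ complex.Re al * fine (normL2 sigma F)) *
   \det (1%:M + z *m z) `^ (complex.Re nu - n.+1%:R / 2) <= _).
  by rewrite ler_wpM2r ?powR_ge0 // cabs2_opQ_le.
rewrite (_ : - e = complex.Re al + (complex.Re nu - n.+1%:R / 2)); last by rewrite /e; ring.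
rewrite [X in _ <= _ * X]powRD; last by apply/implyP => _; rewrite gt_eqF.
by rewrite le_eqVlt; apply/orP; left; apply/eqP; rewrite /k mulrACA !mulrA mulrAC.
Qed.

End NormBound.

(** * The intertwining operator *)

Lemma eqG_Sym (R : realType) n (f g : 'M[R]_n -> R[i]) :
  (forall z, Sym z -> f z = g z) -> eqG f g.
Proof.
have [m [mE _]] := lebesgue_Sym_exists R n.
by rewrite /eqG -mE => fg; apply: aeW => z; exact: fg.
Qed.

Theorem theorem7p2 (R : realType) (n d : nat) (hd : (1 <= d <= n - 1)%N)
  (sigma : {finite_measure set (borelMx R n d) -> \bar R})
  (hsigma : Stiefel_measure sigma)
  (nu mu alpha beta : R[i]) (nu0 mu0 : R)
  (hnu0 : nu0 = complex.Re nu) (hmu0 : mu0 = complex.Re mu)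
  (h1 : n%:R * nu0 + d%:R * mu0 < (n * n.+1)%:R / 2)
  (h2 : n%:R * nu0 - d%:R * mu0 < (n * n.+1)%:R / 2)
  (h3 : nu0 + mu0 <= n%:R - d%:R)
  (h4 : n%:R <= mu0)
  (halpha : alpha = - (nu + d%:R) / 2)
  (hbeta : beta = (mu - n%:R) / 2) :
  (forall F : 'M[R]_(n, d) -> R[i], HL sigma mu F ->
     forall z : 'M[R]_n, Sym z ->
       cintegrable sigma (@Stiefel R n d : set (borelMx R n d))
         (fun y => F y * kernelK alpha beta z y)) /\
  L_intertwiner sigma nu mu (opQ sigma alpha beta).
Proof.
have [d0 dn1] := andP hd; have dn : (d <= n)%N by exact: leq_trans dn1 (leq_subr _ _).
have two : (2 : R[i]) != 0 by rewrite pnatr_eq0.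
have al2 : alpha + alpha = - (nu + d%:R) by rewrite halpha; field.
have be2 : beta + beta = mu - n%:R by rewrite hbeta; field.
have Ral : complex.Re alpha + complex.Re alpha = - (nu0 + d%:R).
  by rewrite -cReD al2 cReN cReD cRe_nat hnu0.
have Rbe : complex.Re beta + complex.Re beta = mu0 - n%:R.
  by rewrite -cReD be2 cReD cReN cRe_nat hmu0.
have d1 : 1 <= d%:R :> R by rewrite ler1n.
have ab0 : 0 <= complex.Re (alpha - beta) by rewrite cReD cReN; lra.
have be0 : 0 <= complex.Re beta by lra.
(* h3 and h4 give nu0 <= - d, and d >= 1. *)
have expo : complex.Re alpha + complex.Re nu + 2^-1 <= 0 by rewrite -hnu0; lra.
have conv F : HL sigma mu F -> forall z : 'M[R]_n, Sym z ->
    cintegrable sigma (@Stiefel R n d : set (borelMx R n d))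
      (fun y => F y * kernelK alpha beta z y).
  by move=> [_ mF nF _] z sz; exact: cintegrable_opQ.
split=> //; have [C HC] := normG2_opQ_le sigma ab0 be0 expo.
split.
- move=> F [_ mF nF _]; split.
    have [mr mi] := cmeasurable_opQ sigma alpha beta mF.
    by split; apply: measurable_funTS.
  apply: le_lt_trans (HC _ mF nF) _.
  have Nf : normL2 sigma F \is a fin_num.
    by rewrite ge0_fin_numE //; apply: integral_ge0 => y _; rewrite lee_fin cabs2_ge0.
  by rewrite -(fineK Nf) -EFinM ltry.
- move=> c F1 F2 H1 H2; apply: eqG_Sym => z sz; rewrite /opQ.
  rewrite -(cintegral_linear c (@measurable_Stiefel R n d) (conv _ H1 _ sz) (conv _ H2 _ sz)).
  by apply: eq_cintegral => y _; rewrite mulrDl mulrA.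
- by exists C => F [_ mF nF _]; exact: HC.
- move=> a ua F [hF mF nF _]; apply: eqG_Sym => z sz.
  rewrite (opQ_piL dn d0 hsigma ab0 be0 be2 mF nF hF ua sz) mulrA /piG.
  congr (_ * _); have a0 : 0 < `|\det a| by rewrite normr_gt0 -unitfE -unitmxE.
  (* |det a| ^ d comes from the measure and |det a| ^ (2 alpha) from the kernel; their
     product is |det a| ^ (- nu). *)
  rewrite (_ : Complex (`|\det a| ^+ d) 0 = cpow `|\det a| d%:R); last first.
    by rewrite (@cpow_real _ _ d%:R) ?cRe_nat ?cIm_nat // powR_mulrn // ltW.
  by rewrite -cpowD // al2; congr cpow; ring.
Qed.
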